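(* Let $1\le r<\infty$ and let $(\alpha,s)$ be admissible. Then the formula defining $G^{\alpha}_{s,r}$ (with the stated branches) defines an analytic function on the whole upper half-plane $\mathbb{C}_+$ which maps $\mathbb{C}_+$ into the lower half-plane $\mathbb{C}_-$, is univalent on $\mathbb{C}_+$, and is the Cauchy transform $G_\mu(z)=\int_{\mathbb{R}}\frac{\mu(dx)}{z-x}$ of a Borel probability measure $\mu$ on $\mathbb{R}$. (This measure is denoted $\mu^{\alpha}_{s,r}$.)
   Context: Branch conventions: for $w\in\mathbb{C}\setminus[0,\infty)$ and $p\in\{\alpha,1/\alpha\}$, $w^{p}:=e^{p\log_{(1)}w}$, where $\log_{(1)}$ is the branch of the logarithm with imaginary part in $(0,2\pi)$; for $w\in\mathbb{C}\setminus(-\infty,0]$, $w^{1/r}:=e^{\frac1r\operatorname{Log}w}$ with the principal logarithm (imaginary part in $(-\pi,\pi)$); $r^{1/\alpha}>0$. For $0<\alpha\le2$, $r>0$, $s\in\mathbb{C}\setminus\{0\}$, \[ G^{\alpha}_{s,r}(z)=-r^{1/\alpha}\left(\frac{1-\big(1-s(-\tfrac1z)^{\alpha}\big)^{1/r}}{s}\right)^{1/\alpha}. \] A pair $(\alpha,s)$ with $s\in\mathbb{C}\setminus\{0\}$ and $\arg s\in(-\pi,\pi]$ is called admissible if either (1) $0<\alpha\le1$ and $(1-\alpha)\pi\le\arg s\le\pi$, or (2) $1<\alpha\le2$ and $0\le\arg s\le(2-\alpha)\pi$. *)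

(* Defs.v *)
From HB Require Import structures.
From mathcomp Require Import all_boot all_order all_algebra.
From mathcomp Require Import all_classical all_reals all_analysis.
From mathcomp Require Import complex.
Export Order.TTheory GRing.Theory Num.Theory numFieldNormedType.Exports.

Set Implicit Arguments.
Unset Strict Implicit.
Unset Printing Implicit Defensive.

Local Open Scope ring_scope.
Local Open Scope complex_scope.

Section Defs.
Context {R : realType}.

Definition cabs (w : R[i]) : R := Num.sqrt (complex.Re w ^+ 2 + complex.Im w ^+ 2).

Definition cexp (w : R[i]) : R[i] :=
  (expR (complex.Re w) * cos (complex.Im w)) +i* (expR (complex.Re w) * sin (complex.Im w)).

(* argument with values in (0, 2 pi), meaningful for w not in [0, +oo) *)
Definition arg1 (w : R[i]) : R :=
  if 0 <= complex.Im w then acos (complex.Re w / cabs w) else 2 * pi - acos (complex.Re w / cabs w).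

(* principal argument, values in (-pi, pi]; for w not in (-oo,0] it lies in (-pi,pi) *)
Definition Arg (w : R[i]) : R :=
  if 0 <= complex.Im w then acos (complex.Re w / cabs w) else - acos (complex.Re w / cabs w).

Definition log1 (w : R[i]) : R[i] := ln (cabs w) +i* arg1 w.

Definition Logp (w : R[i]) : R[i] := ln (cabs w) +i* Arg w.

Definition cpow1 (w : R[i]) (p : R) : R[i] := cexp (p%:C * log1 w).

Definition cpowP (w : R[i]) (p : R) : R[i] := cexp (p%:C * Logp w).

Definition Ginner (alpha : R) (s : R[i]) (z : R[i]) : R[i] :=
  1 - s * cpow1 (- z^-1) alpha.

Definition Gmid (alpha : R) (s : R[i]) (r : R) (z : R[i]) : R[i] :=
  (1 - cpowP (Ginner alpha s z) r^-1) / s.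

Definition Galpha (alpha : R) (s : R[i]) (r : R) (z : R[i]) : R[i] :=
  - (r `^ alpha^-1)%:C * cpow1 (Gmid alpha s r z) alpha^-1.

Definition admissible (alpha : R) (s : R[i]) : Prop :=
  s != 0 /\
  ((0 < alpha <= 1 /\ (1 - alpha) * pi <= Arg s <= pi) \/
   (1 < alpha <= 2 /\ 0 <= Arg s <= (2 - alpha) * pi)).

Definition upper (z : R[i]) : Prop := 0 < complex.Im z.

Definition on_nonneg_axis (w : R[i]) : Prop := complex.Im w = 0 /\ 0 <= complex.Re w.
Definition on_nonpos_axis (w : R[i]) : Prop := complex.Im w = 0 /\ complex.Re w <= 0.

End Defs.

(* Main.v *)
Require Import Defs.
From HB Require Import structures.
From mathcomp Require Import all_boot all_order all_algebra.
From mathcomp Require Import all_classical all_reals all_analysis.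
From mathcomp Require Import complex.
From mathcomp Require Import measurable_realfun ring lra.
Import Order.TTheory GRing.Theory Num.Theory numFieldNormedType.Exports.
Local Open Scope ring_scope.

Set Implicit Arguments.
Unset Strict Implicit.
Unset Printing Implicit Defensive.

Local Open Scope complex_scope.
Local Open Scope classical_set_scope.

Local Notation Re := (@complex.Re _).
Local Notation Im := (@complex.Im _).

(** Put [v = Logp z], so that the upper half-plane becomes the strip [0 < Im v < pi], and let
    [tau = Logp s + alpha (i pi - v)], the logarithm of [s (-1/z)^alpha].  Admissibility says
    exactly that [Arg s <= pi <= Arg s + alpha pi <= 2 pi], so [tau] stays in the strip
    [0 < Im tau < 2 pi].  With [p = 1/r], [t = e^tau] and [Q = (1 - (1 - t)^p) / (p t)] one gets
    [G z = exp (- v + Logp Q / alpha)].  The inequalities [sin (p b) >= p sin b] and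
    [e^y >= 1 + y] show that multiplication by [Q] moves the argument of [t] towards [pi]
    without crossing it; hence no branch cut is met and [Im G < 0], and univalence follows by
    undoing the branches one at a time.

    If [r = 1] then [G z = 1/z].  If [r > 1], then [G] is continuous up to both sides of the
    strip except at one point, and [|G| <= K e^(-e |Re v|) (1 + e^(-Re v))] with [e = 1 - p].
    Integrating [G(w) / (w - z)] and [G(w) / (w - conj z)] along the two sides of the strip (the
    contour integral is constant in [Im v], by differentiation under the integral sign)
    represents [G z] as the Cauchy transform of the boundary density [- Im G / pi >= 0].  Its
    total mass is the limit of [- y Im G(iy)], which is [1] because [Q] tends to [1]. *)

(** * Complex exponential and logarithms *)

(** The logarithmic coordinate turns every branch condition into an inequality between imaginary
    parts, and its two sides parametrize the real line without the origin: [X = expR u] on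
    [Im v = 0] and [X = - expR u] on [Im v = pi]. The exceptional point on a side is where
    [|t| = 1], because [t] may meet the branch point [1] of [(1 - t)^p] there.

    No residue is computed. The numerator is corrected by a multiple of [1 / (w - conj z)] so that
    it vanishes at [z]; the pole becomes removable, and the correction contributes an explicit
    Poisson integral on the boundary. Using [z] and [conj z] together is what leaves only [Im G] in
    the boundary integral.

    The case [r = 1] stands apart because the decay exponent [1 - p] is then zero, and the measure
    is a point mass, which has no density. For [r > 1] the growth bound alone does not make the
    density integrable at infinity: finiteness of the mass is itself deduced from the limit of
    [- y Im G(iy)], by monotone convergence. *)

Section ComplexAlgebra.
Context {R : realType}.
Implicit Types (z w : R[i]) (a b : R).

Lemma complex_ext z w : Re z = Re w -> Im z = Im w -> z = w.
Proof. by case: z w => ? ? [? ?] /= -> ->. Qed.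

Lemma cReD z w : Re (z + w) = Re z + Re w. Proof. by case: z w => ? ? []. Qed.
Lemma cImD z w : Im (z + w) = Im z + Im w. Proof. by case: z w => ? ? []. Qed.
Lemma cReN z : Re (- z) = - Re z. Proof. by case: z. Qed.
Lemma cImN z : Im (- z) = - Im z. Proof. by case: z. Qed.
Lemma cReM z w : Re (z * w) = Re z * Re w - Im z * Im w.
Proof. by case: z w => ? ? []. Qed.
Lemma cImM z w : Im (z * w) = Re z * Im w + Im z * Re w.
Proof. by case: z w => ? ? []. Qed.
Lemma cReMr a w : Re (a%:C * w) = a * Re w. Proof. by rewrite cReM /=; ring. Qed.
Lemma cImMr a w : Im (a%:C * w) = a * Im w. Proof. by rewrite cImM /=; ring. Qed.
Lemma cReV z : Re z^-1 = Re z / (Re z ^+ 2 + Im z ^+ 2). Proof. by case: z. Qed.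
Lemma cImV z : Im z^-1 = - Im z / (Re z ^+ 2 + Im z ^+ 2).
Proof. by case: z => x y /=; rewrite mulNr. Qed.

Definition reim := (cReD, cImD, cReN, cImN, cReM, cImM, (cReV, cImV)).

Lemma cabs_norm z : `|z| = (cabs z)%:C. Proof. by rewrite normc_def. Qed.

Lemma cabs_normc z : cabs z = Re `|z|. Proof. by rewrite cabs_norm. Qed.

Lemma cabs_ge0 z : 0 <= cabs z. Proof. exact: sqrtr_ge0. Qed.

Lemma sqr_cabs z : cabs z ^+ 2 = Re z ^+ 2 + Im z ^+ 2.
Proof. by rewrite sqr_sqrtr // addr_ge0 // sqr_ge0. Qed.

Lemma cabsM z w : cabs (z * w) = cabs z * cabs w.
Proof. by apply: (@complexI R); rewrite rmorphM /= -!cabs_norm normrM. Qed.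

Lemma cabsN z : cabs (- z) = cabs z.
Proof. by rewrite !cabs_normc normrN. Qed.

Lemma cabsV z : cabs z^-1 = (cabs z)^-1.
Proof. by apply: (@complexI R); rewrite fmorphV /= -!cabs_norm normfV. Qed.

Lemma cabsD z w : cabs (z + w) <= cabs z + cabs w.
Proof. by rewrite -lecR rmorphD /= -!cabs_norm ler_normD. Qed.

Lemma cabsB z w : cabs (z - w) <= cabs z + cabs w.
Proof. by rewrite -(cabsN w) cabsD. Qed.

Lemma cabs_distC z w : cabs (z - w) = cabs (w - z).
Proof. by rewrite -cabsN opprB. Qed.

Lemma cabs_real a : cabs a%:C = `|a|.
Proof. by rewrite /cabs /= expr0n /= addr0 sqrtr_sqr. Qed.

Lemma cabs0 : cabs (0 : R[i]) = 0. Proof. by rewrite (cabs_real 0) normr0. Qed.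
Lemma cabs1 : cabs (1 : R[i]) = 1. Proof. by rewrite (cabs_real 1) normr1. Qed.

Lemma cabs_eq0 z : (cabs z == 0) = (z == 0).
Proof. by rewrite -[RHS]normr_eq0 cabs_norm (inj_eq (@complexI R)). Qed.

Lemma cabs_gt0 z : (0 < cabs z) = (z != 0).
Proof. by rewrite lt_def cabs_eq0 cabs_ge0 andbT. Qed.

Lemma normr_Re_le z : `|Re z| <= cabs z.
Proof.
rewrite -(ler_pXn2r (n := 2)) ?nnegrE ?cabs_ge0 // sqr_cabs real_normK ?num_real //.
by rewrite lerDl sqr_ge0.
Qed.

Lemma normr_Im_le z : `|Im z| <= cabs z.
Proof.
rewrite -(ler_pXn2r (n := 2)) ?nnegrE ?cabs_ge0 // sqr_cabs real_normK ?num_real //.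
by rewrite lerDr sqr_ge0.
Qed.

Lemma cabs_le z : cabs z <= `|Re z| + `|Im z|.
Proof.
rewrite -(ler_pXn2r (n := 2)) ?nnegrE ?cabs_ge0 ?addr_ge0 // sqr_cabs.
rewrite sqrrD !real_normK ?num_real //.
by rewrite -addrA lerD2l lerDr mulrn_wge0 // mulr_ge0.
Qed.

Lemma ge_cabsB z w : cabs z - cabs w <= cabs (z - w).
Proof. by rewrite lerBlDr -{1}(subrK w z) cabsD. Qed.

Lemma cexpD z w : cexp (z + w) = cexp z * cexp w.
Proof.
apply: complex_ext; rewrite ?reim /= ?reim expRD.
- by rewrite cosD; ring.
- by rewrite sinD; ring.
Qed.

Lemma cexp0 : cexp (0 : R[i]) = 1.
Proof. by apply: complex_ext; rewrite /= expR0 ?cos0 ?sin0 ?mulr1 ?mulr0. Qed.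

Lemma cabs_cexp z : cabs (cexp z) = expR (Re z).
Proof.
rewrite /cabs /= !exprMn -mulrDr cos2Dsin2 mulr1 sqrtr_sqr.
by rewrite ger0_norm // expR_ge0.
Qed.

Lemma cexp_neq0 z : cexp z != 0.
Proof. by rewrite -cabs_gt0 cabs_cexp expR_gt0. Qed.

Lemma cexpN z : cexp (- z) = (cexp z)^-1.
Proof.
apply: (mulfI (cexp_neq0 z)).
by rewrite -cexpD subrr cexp0 divff // cexp_neq0.
Qed.

Lemma cexpB z w : cexp (z - w) = cexp z / cexp w.
Proof. by rewrite cexpD cexpN. Qed.

Lemma cexp_real a : cexp a%:C = (expR a)%:C.
Proof. by apply: complex_ext; rewrite /= ?cos0 ?sin0 ?mulr1 ?mulr0. Qed.

Lemma cexp_ipi : cexp (0 +i* pi) = - 1 :> R[i].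
Proof. by apply: complex_ext; rewrite /= ?cospi ?sinpi ?expR0; ring. Qed.

Lemma cexp_lnr a : 0 < a -> cexp (ln a)%:C = a%:C.
Proof. by move=> a0; rewrite cexp_real lnK. Qed.

Lemma Re_div_cabs_itv w : w != 0 -> -1 <= Re w / cabs w <= 1.
Proof.
move=> w0; have c0 : 0 < cabs w by rewrite cabs_gt0.
by rewrite -ler_norml normrM normfV (gtr0_norm c0) ler_pdivrMr // mul1r normr_Re_le.
Qed.

Lemma LogpK w : w != 0 -> cexp (Logp w) = w.
Proof.
move=> w0; have c0 : 0 < cabs w by rewrite cabs_gt0.
have I := Re_div_cabs_itv w0.
have S : sin (acos (Re w / cabs w)) = `|Im w| / cabs w.
  have -> : `|Im w| / cabs w = `|Im w / cabs w| by rewrite normrM normfV (gtr0_norm c0).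
  rewrite sin_acos // -sqrtr_sqr.
  congr Num.sqrt; have := sqr_cabs w => /(congr1 (fun x => x / cabs w ^+ 2)).
  rewrite divff ?sqrf_eq0 ?gt_eqF // => ->; rewrite !exprMn exprVn; ring.
apply: complex_ext; rewrite /= lnK ?posrE // /Arg.
- have -> : cos (if 0 <= Im w then acos (Re w / cabs w) else - acos (Re w / cabs w))
    = Re w / cabs w by case: ifP => _; rewrite ?cosN acosK // in_itv.
  by rewrite mulrC divfK ?gt_eqF.
- case: (lerP 0 (Im w)) => h; rewrite ?sinN S ?(ger0_norm h) ?(ltr0_norm h).
    by rewrite mulrC divfK ?gt_eqF.
  by rewrite mulNr opprK mulrC divfK ?gt_eqF.
Qed.

Lemma cexp_eq_real z w : cexp z = cexp w -> Re z = Re w.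
Proof. by move/(congr1 cabs); rewrite !cabs_cexp => /expR_inj. Qed.

(** Half angles turn [cos d = 1] into [sin (|d| / 2) = 0], which is impossible for
    [0 < |d| / 2 < pi]. Most identities between branches below, and univalence, go through this
    lemma. *)
Lemma cexp_inj z w : cexp z = cexp w -> `|Im z - Im w| < 2 * pi -> z = w.
Proof.
move=> e lt2pi; have eR := cexp_eq_real e.
have : cexp (z - w) = 1 by rewrite cexpB e divff // cexp_neq0.
move=> /(congr1 Re) /=; rewrite ?reim eR subrr expR0 mul1r.
set d := Im z - Im w in lt2pi * => cd.
apply: complex_ext => //; apply/eqP; rewrite -subr_eq0 -/d.
have cn : cos `|d| = 1 by rewrite cos_norm.
have h : sin (`|d| / 2) = 0.
  have : cos ((`|d| / 2) *+ 2) = 1 by rewrite -mulr_natr divfK.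
  rewrite cos_mulr2n => H; apply/eqP; rewrite -sqrf_eq0.
  have := cos2Dsin2 (`|d| / 2) => H2; apply/eqP.
  by move: H H2; rewrite -mulr_natr; lra.
case: (eqVneq d 0) => [//|d0].
have : 0 < sin (`|d| / 2) by apply: sin_gt0_pi; have := normr_gt0 d; rewrite d0; lra.
by rewrite h ltxx.
Qed.

Lemma Arg_le w : w != 0 -> - pi <= Arg w <= pi.
Proof.
move=> w0; have I := Re_div_cabs_itv w0.
have h0 := acos_ge0 I; have hpi := acos_lepi I; have := @pi_ge0 R.
by rewrite /Arg; case: ifP => _; lra.
Qed.

Lemma acos_eqpi a : -1 <= a <= 1 -> acos a = pi -> a = -1.
Proof. by move=> I e; rewrite -(acosK (x := a)) ?in_itv // e cospi. Qed.

Lemma Re_div_cabsN1 w : w != 0 -> Re w / cabs w = -1 -> on_nonpos_axis w.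
Proof.
move=> w0 e; have c0 : 0 < cabs w by rewrite cabs_gt0.
have eR : Re w = - cabs w by rewrite -mulN1r -e divfK ?gt_eqF.
split; last by rewrite eR oppr_le0 cabs_ge0.
have := sqr_cabs w; rewrite eR sqrrN => /esym /eqP.
by rewrite -subr_eq0 addrAC subrr add0r sqrf_eq0 => /eqP.
Qed.

Lemma Arg_lt w : ~ on_nonpos_axis w -> - pi < Arg w < pi.
Proof.
move=> H; have w0 : w != 0.
  by apply/eqP => e; apply: H; rewrite e /on_nonpos_axis /=.
have I := Re_div_cabs_itv w0.
have n : acos (Re w / cabs w) != pi.
  by apply/eqP => /(acos_eqpi I) /(Re_div_cabsN1 w0).
have h0 := acos_ge0 I; have hpi := acos_lepi I; have := @pi_gt0 R.
have {}hpi : acos (Re w / cabs w) < pi by rewrite lt_neqAle n.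
by rewrite /Arg; case: ifP => _; lra.
Qed.

Lemma cexpK z : - pi < Im z <= pi -> Logp (cexp z) = z.
Proof.
move=> H; apply: cexp_inj; first exact: LogpK (cexp_neq0 z).
have := Arg_le (cexp_neq0 z) => /andP[A1 A2].
rewrite ltr_norml /=; apply/andP; split; last by lra.
(* As [Im z = pi] is allowed, the value [- pi] of [Arg] would spoil the strict bound. It would force
   the imaginary part to be [0], where [Arg] takes its other branch. *)
have key : Arg (cexp z) != - pi -> - (2 * pi) < Arg (cexp z) - Im z.
  move=> n; have : - pi < Arg (cexp z) by rewrite lt_neqAle eq_sym n A1.
  lra.
apply: key; apply/eqP; rewrite /Arg; have I := Re_div_cabs_itv (cexp_neq0 z).
have h0 := acos_ge0 I; have pi0 := @pi_gt0 R.
case: ifP => [_|]; first lra.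
move=> F /oppr_inj /(acos_eqpi I) /(Re_div_cabsN1 (cexp_neq0 z)) [e _].
by rewrite e lexx in F.
Qed.

Lemma Logp1 : Logp (1 : R[i]) = 0.
Proof. by rewrite -cexp0 cexpK //= pi_ge0 oppr_lt0 pi_gt0. Qed.

Lemma Im_Logp w : Im (Logp w) = Arg w. Proof. by []. Qed.

Lemma log1K w : w != 0 -> cexp (log1 w) = w.
Proof.
move=> w0; rewrite -[RHS](LogpK w0) /log1 /Logp /arg1 /Arg; case: ifP => //= _.
have e : 2 * pi - acos (Re w / cabs w) = - acos (Re w / cabs w) + pi *+ 2 by ring.
by apply: complex_ext => /=; rewrite e ?cosD2pi ?sinD2pi.
Qed.

Lemma arg1_lt w : ~ on_nonneg_axis w -> 0 < arg1 w < 2 * pi.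
Proof.
move=> H; have w0 : w != 0.
  by apply/eqP => e; apply: H; rewrite e /on_nonneg_axis /=.
have I := Re_div_cabs_itv w0.
have n : acos (Re w / cabs w) != 0.
  apply/eqP => e; apply: H.
  have e1 : Re w / cabs w = 1 by rewrite -(acosK (x := _ / _)) ?in_itv // e cos0.
  have [] : on_nonpos_axis (- w).
    by apply: Re_div_cabsN1; rewrite ?oppr_eq0 // cabsN cReN mulNr e1.
  by rewrite cImN cReN => /eqP; rewrite oppr_eq0 oppr_le0 => /eqP.
have h0 := acos_ge0 I; have hpi := acos_lepi I; have := @pi_gt0 R.
have {}h0 : 0 < acos (Re w / cabs w) by rewrite lt_neqAle eq_sym n.
by rewrite /arg1; case: ifP => _; lra.
Qed.

Lemma Im_log1 w : Im (log1 w) = arg1 w. Proof. by []. Qed.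

Lemma cexp_nonneg_axis z : 0 < Im z < 2 * pi -> ~ on_nonneg_axis (cexp z).
Proof.
move=> H [] /=; have e0 := expR_gt0 (Re z) => /eqP; rewrite mulf_eq0 gt_eqF //= => /eqP s0.
rewrite pmulr_rge0 // => c0.
have /cexp_inj e : cexp (0 +i* Im z) = cexp 0.
  rewrite cexp0; apply: complex_ext; rewrite /= expR0 mul1r // ?s0 //.
  have := cos2Dsin2 (Im z); rewrite s0 expr0n addr0 => /eqP; rewrite sqrf_eq1.
  by case/orP => /eqP // e; rewrite e in c0; lra.
have : 0 +i* Im z = 0 by apply: e => /=; rewrite subr0 gtr0_norm; lra.
by move=> /(congr1 Im) /=; lra.
Qed.

Lemma cexp_log1 z : 0 < Im z < 2 * pi -> log1 (cexp z) = z.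
Proof.
move=> H; apply: cexp_inj; first exact: log1K (cexp_neq0 z).
have := arg1_lt (cexp_nonneg_axis H); rewrite Im_log1 => ?.
by rewrite ltr_norml; lra.
Qed.

End ComplexAlgebra.

(** * Complex derivatives *)

(** Without the quotient there is no punctured neighbourhood to handle. In this form complex
    derivatives become [cabs] estimates and can be restricted to horizontal and vertical lines. *)
Lemma is_derive_normP (K : numFieldType) (f : K^o -> K^o) (z d : K^o) :
  is_derive z 1 f d <->
  (forall e : K, 0 < e -> \forall h \near (0 : K^o), `|f (z + h) - f z - d * h| <= e * `|h|).
Proof.
pose q (h : K^o) : K^o := h^-1 *: ((f \o shift z) (h *: (1 : K^o)) - f z).
have qE h : h != 0 -> `|q h - d| = `|f (z + h) - f z - d * h| / `|h|.
  move=> h0; rewrite -normfV -normrM mulrBl mulfK // /q /= -[h *: 1]/(h * 1) mulr1.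
  by rewrite [h + z]addrC mulrC.
split=> [[D Dd] e e0|H].
  have : q h @[h --> 0^'] --> d by rewrite -Dd; exact: D.
  move=> /cvgr_dist_lt /(_ e e0);
  rewrite /dnbhs near_withinE; apply: filterS => h Hh.
  have [->|h0] := eqVneq h 0; first by rewrite addr0 subrr mulr0 subr0 normr0 mulr0.
  by have := Hh h0; rewrite distrC qE // ltr_pdivrMr ?normr_gt0 // => /ltW.
have D : q h @[h --> 0^'] --> d.
  apply/cvgrPdist_le => e e0; have := H e e0.
  rewrite /dnbhs near_withinE; apply: filterS => h Hh h0.
  by rewrite distrC qE // ler_pdivrMr ?normr_gt0.
by split; [exact: cvgP D | exact: cvg_lim D].
Qed.

Section DeriveField.
Context {K : numFieldType}.
Implicit Types (f g : K^o -> K^o) (z a b : K^o).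

Lemma is_derive1_compK f g z a b :
  is_derive (g z) 1 f a -> is_derive z 1 g b -> is_derive z 1 (f \o g) (a * b).
Proof.
move=> [Df Ef] [Dg Eg].
have df : differentiable f (g z) by apply/derivable1_diffP.
have dg : differentiable g z by apply/derivable1_diffP.
split; first by apply/derivable1_diffP; exact: differentiable_comp.
rewrite deriveE; last exact: differentiable_comp.
rewrite diff_comp // /= -[X in 'd f _ X]deriveE // Eg.
rewrite (_ : b = b *: (1 : K^o)); last by rewrite /GRing.scale /= mulr1.
by rewrite linearZ -deriveE // Ef /GRing.scale /= mulr1 mulrC.
Qed.

Lemma is_deriveMK f g z a b :
  is_derive z 1 f a -> is_derive z 1 g b ->
  is_derive z 1 (fun w => f w * g w : K^o) (f z * b + g z * a).
Proof. by move=> Df Dg; apply: is_derive_eq. Qed.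

Lemma is_derive_invK z : z != 0 -> is_derive z 1 (fun w : K^o => w^-1 : K^o) (- z ^- 2).
Proof.
move=> z0; split; first exact: (@derivableV _ _ id).
by rewrite (@deriveV _ _ id) // derive_id /GRing.scale /= mulr1.
Qed.

Lemma is_derive_continuous f z a : is_derive z 1 f a -> {for z, continuous f}.
Proof.
by move=> [D _]; apply: differentiable_continuous; apply/derivable1_diffP.
Qed.

End DeriveField.

Section ComplexTopology.
Context {R : realType}.
Local Notation C := (R[i]^o).
Implicit Types (z w d : C) (f g : C -> C) (e : R).

(** A positive element of the partially ordered field [R[i]] is real, so the radii of its norm
    topology may be taken in [R]. *)
Lemma gt0_complexP (e : R[i]) : 0 < e -> e = (Re e)%:C /\ 0 < Re e.
Proof. by case: e => a b; rewrite ltcE /= => /andP[/eqP -> ->]. Qed.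

Lemma cvg_cabsP (T : Type) (F : set_system T) {FF : Filter F} (f : T -> C) (l : C) :
  f x @[x --> F] --> l <->
  (forall e, 0 < e -> \forall x \near F, cabs (f x - l) < e).
Proof.
split=> [/cvgrPdist_lt H e e0 | H].
  have e0' : 0 < e%:C by rewrite ltcR.
  near=> x; rewrite cabs_distC -ltcR -cabs_norm; near: x; exact: H.
apply/cvgrPdist_lt => e /gt0_complexP[-> e0].
near=> x; rewrite cabs_norm ltcR cabs_distC; near: x; exact: H.
Unshelve. all: by end_near. Qed.

Lemma nbhs_cabsP (z : C) (P : set C) :
  nbhs z P <-> exists2 e, 0 < e & forall w, cabs (w - z) < e -> P w.
Proof.
split=> [/nbhs_ballP[e /= /gt0_complexP[-> e0] H]|[e e0 H]].
  exists (Re e) => // w wz; apply: H; rewrite -ball_normE /=.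
  by rewrite cabs_norm ltcR cabs_distC.
apply/nbhs_ballP; exists e%:C; first by rewrite /= ltcR.
by move=> w; rewrite -ball_normE /= cabs_norm ltcR cabs_distC; exact: H.
Qed.

Lemma cvg_Re (T : Type) (F : set_system T) {FF : Filter F} (f : T -> C) (l : C) :
  f x @[x --> F] --> l -> Re (f x) @[x --> F] --> Re l.
Proof.
move=> /cvg_cabsP H; apply/cvgrPdist_lt => e /H; apply: filterS => x.
by apply: le_lt_trans; rewrite distrC -cReN -cReD normr_Re_le.
Qed.

Lemma cvg_Im (T : Type) (F : set_system T) {FF : Filter F} (f : T -> C) (l : C) :
  f x @[x --> F] --> l -> Im (f x) @[x --> F] --> Im l.
Proof.
move=> /cvg_cabsP H; apply/cvgrPdist_lt => e /H; apply: filterS => x.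
by apply: le_lt_trans; rewrite distrC -cImN -cImD normr_Im_le.
Qed.

Lemma cvg_Complex (T : Type) (F : set_system T) {FF : Filter F} (a b : T -> R) (k l : R) :
  a x @[x --> F] --> k -> b x @[x --> F] --> l ->
  (a x +i* b x : C) @[x --> F] --> (k +i* l : C).
Proof.
move=> /cvgrPdist_lt H1 /cvgrPdist_lt H2; apply/cvg_cabsP => e e0.
have e2 : 0 < e / 2 by rewrite divr_gt0.
near=> x; apply: le_lt_trans (cabs_le _) _; rewrite /= [e]splitr ltrD // distrC.
- by near: x; exact: H1.
- by near: x; exact: H2.
Unshelve. all: by end_near. Qed.

Lemma is_derive_cabsP f z d :
  is_derive z 1 f d <->
  (forall e, 0 < e -> exists2 dl, 0 < dl & forall h, cabs h < dl ->
     cabs (f (z + h) - f z - d * h) <= e * cabs h).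
Proof.
split=> [/is_derive_normP H e e0|H].
  have e0' : 0 < e%:C by rewrite ltcR.
  have /nbhs_cabsP[dl dl0 K] := H _ e0'; exists dl => // h hdl.
  have := K h; rewrite subr0 => /(_ hdl).
  by rewrite /= !cabs_norm -rmorphM /= lecR.
apply/is_derive_normP => e /gt0_complexP[-> /H[dl dl0 K]].
apply/nbhs_cabsP; exists dl => // h; rewrite subr0 => /K.
by rewrite !cabs_norm -rmorphM /= lecR.
Qed.

Lemma real_is_derive_norm (f : R -> R) (x d e : R) : is_derive x 1 f d -> 0 < e ->
  exists2 dl, 0 < dl & forall h, `|h| < dl -> `|f (x + h) - f x - d * h| <= e * `|h|.
Proof.
move=> /is_derive_normP H /H /nbhs_ballP[dl /= dl0 K]; exists dl => // h hd.
by apply: K; rewrite -ball_normE /= sub0r normrN.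
Qed.

Lemma is_derive_cexp z : is_derive z 1 (@cexp R : C -> C) (cexp z).
Proof.
(* The functional equation reduces differentiability at [z] to the origin. *)
suff K0 e : 0 < e -> exists2 dl, 0 < dl & forall h : C, cabs h < dl ->
     cabs (cexp h - 1 - h) <= e * cabs h.
  apply/is_derive_cabsP => e e0.
  have c0 : 0 < cabs (cexp z) by rewrite cabs_gt0 cexp_neq0.
  have [dl dl0 K] := K0 _ (divr_gt0 e0 c0); exists dl => // h /K H.
  have -> : cexp (z + h) - cexp z - cexp z * h = cexp z * (cexp h - 1 - h).
    by rewrite cexpD; ring.
  by rewrite cabsM mulrC -ler_pdivlMr // mulrAC.
move=> e0.
(* Error budget: with [expR a <= 3], the four terms cost [e/8], [3e/8], [3e/8] and [2 * e/16], in
   total [e]. The minimum with [1] in [e2] is what yields [expR a <= 3]. *)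
have e1 : 0 < e / 8 by lra.
have e2 : 0 < Num.min (e / 8) 1 by rewrite lt_min e1 ltr01.
have [d1 d10 K1] := real_is_derive_norm (is_derive_expR 0) e2.
have [d2 d20 K2] := real_is_derive_norm (is_derive_cos 0) e1.
have [d3 d30 K3] := real_is_derive_norm (is_derive_sin 0) e1.
have e3 : 0 < e / 16 by lra.
exists (Num.min (Num.min d1 d2) (Num.min d3 (Num.min 1 (e / 16)))).
  by rewrite !lt_min d10 d20 d30 ltr01.
move=> h; rewrite !lt_min => /andP[/andP[h1 h2] /and3P[h3 h4 h5]].
have ha := normr_Re_le h; have hb := normr_Im_le h; have hc := cabs_ge0 h.
case: h => a b /= in h1 h2 h3 h4 h5 ha hb hc *; set c := cabs _ in h1 h2 h3 h4 h5 ha hb hc *.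
have {K1} := K1 a (le_lt_trans ha h1); have {K2} := K2 b (le_lt_trans hb h2).
have {K3} := K3 b (le_lt_trans hb h3).
rewrite !add0r expR0 cos0 sin0 subr0 oppr0 !mul0r !mul1r subr0 => K3 K2 K1.
have E2 : `|expR a - 1 - a| <= c.
  by apply: le_trans K1 _; rewrite -[leRHS]mul1r ler_pM // ?(ltW e2) // ge_min lexx orbT.
have E3 : expR a <= 3.
  have : `|a| <= 1 by apply: le_trans ha _; exact: ltW.
  by move: E2; rewrite !ler_norml; lra.
have E0 := expR_gt0 a.
have {}K1 : `|expR a - 1 - a| <= e / 8 * c.
  apply: le_trans K1 _; rewrite ler_pM // ?ge_min ?lexx //; exact: ltW.
have {}K2 : `|cos b - 1| <= e / 8 * c.
  by apply: le_trans K2 _; rewrite ler_pM2l.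
have {}K3 : `|sin b - b| <= e / 8 * c.
  by apply: le_trans K3 _; rewrite ler_pM2l.
have {}E2 : `|expR a - 1| <= 2 * c.
  by move: E2 ha; rewrite !ler_norml; lra.
apply: le_trans (cabs_le _) _; rewrite /= subr0.
have -> : expR a * cos b - 1 - a = (expR a - 1 - a) + expR a * (cos b - 1) by ring.
have -> : expR a * sin b - b = expR a * (sin b - b) + (expR a - 1) * b by ring.
have R1 : `|expR a * (cos b - 1)| <= 3 * (e / 8 * c).
  by rewrite normrM (gtr0_norm E0) ler_pM // ltW.
have R2 : `|expR a * (sin b - b)| <= 3 * (e / 8 * c).
  by rewrite normrM (gtr0_norm E0) ler_pM // ltW.
have R3 : `|(expR a - 1) * b| <= 2 * c * (e / 16).
  by rewrite normrM ler_pM // (le_trans hb) // ltW.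
have R4 := ler_normD (expR a - 1 - a) (expR a * (cos b - 1)).
have R5 := ler_normD (expR a * (sin b - b)) ((expR a - 1) * b).
by lra.
Qed.

(** [acos] has infinite slope at [1]; near the positive axis the argument is therefore expressed by
    [asin], which is differentiable at [0]. *)
Lemma Arg_asin (w : R[i]) : 0 < Re w -> Arg w = asin (Im w / cabs w).
Proof.
move=> r0; have w0 : w != 0 by apply/eqP => e; rewrite e ltxx in r0.
have c0 : 0 < cabs w by rewrite cabs_gt0.
have I := Re_div_cabs_itv w0.
have h0 := acos_ge0 I; have hpi := acos_lepi I; have pi0 := @pi_gt0 R.
have lt : acos (Re w / cabs w) < pi / 2.
  rewrite -ltr_cos ?in_itv /= ?h0 ?hpi //; last by apply/andP; split; lra.
  by rewrite cos_pihalf acosK ?in_itv // divr_gt0.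
have <- : sin (Arg w) = Im w / cabs w.
  rewrite -{2}(LogpK w0) /= lnK ?posrE //.
  by rewrite mulrAC divff ?gt_eqF // mul1r.
by rewrite sinK // in_itv /= /Arg; case: ifP => _; apply/andP; split; lra.
Qed.

(** For [|h| < 1/2] the modulus part costs a factor [2] and the argument part a factor [4], so [8]
    is a comfortable Lipschitz constant at [1]. It makes the inverse function argument for [Logp]
    possible. *)
Lemma Logp1_bound : exists2 dl, 0 < dl &
  forall h : R[i], cabs h < dl -> cabs (Logp (1 + h)) <= 8 * cabs h.
Proof.
have [d1 d10 K1] := real_is_derive_norm (is_derive1_ln (@ltr01 R)) (@ltr01 R).
have asin0 : asin (0 : R) = 0.
  by rewrite -[in LHS](@sin0 R) sinK // in_itv /=; have := @pi_gt0 R; lra.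
have D : is_derive (0 : R) 1 (@asin R) 1.
  apply: is_derive_eq (is_derive1_asin _) _; first by rewrite ltrN10 ltr01.
  by rewrite expr0n subr0 sqrtr1 invr1.
have [d2 d20 K2] := real_is_derive_norm D (@ltr01 R).
exists (Num.min (Num.min d1 (d2 / 2)) (1 / 2)).
  by rewrite !lt_min d10 divr_gt0 //= divr_gt0.
move=> h; rewrite !lt_min => /andP[/andP[h1 h2] h3].
have ha := normr_Re_le h; have hb := normr_Im_le h; have hc := cabs_ge0 h.
have R0 : 0 < Re (1 + h) by rewrite cReD /=; move: ha; rewrite ler_norml; lra.
have k1 : `|cabs (1 + h) - 1| <= cabs h.
  rewrite ler_norml; have := cabsD 1 h; have := cabsB (1 + h) h.
  by rewrite addrK cabs1; lra.
have c2 : 1 / 2 <= cabs (1 + h) by move: k1; rewrite ler_norml; lra.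
have R1 : `|ln (cabs (1 + h))| <= 2 * cabs h.
  have := K1 _ (le_lt_trans k1 h1); rewrite [1 + (_ - 1)]addrC subrK ln1 subr0 !invr1 !mul1r.
  by have k := k1; move: k1; rewrite !ler_norml => ? ?; lra.
set y := Im (1 + h) / cabs (1 + h).
have y2 : `|y| <= 2 * cabs h.
  rewrite /y normrM normfV (gtr0_norm (_ : 0 < cabs (1 + h))); last by lra.
  rewrite ler_pdivrMr; last by lra.
  rewrite cImD /= add0r; apply: le_trans hb _; rewrite mulrAC ler_peMl //; lra.
have yd : `|y| < d2 by lra.
have R2 : `|Arg (1 + h)| <= 4 * cabs h.
  rewrite (Arg_asin R0) -/y; have := K2 _ yd; rewrite add0r asin0 subr0 !mul1r.
  have k := y2; move: y2; rewrite !ler_norml => ? ?; lra.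
by apply: le_trans (cabs_le _) _; rewrite /=; lra.
Qed.

(** Put [k = Logp (1 + h)]. Then [cexp k - 1 - k = h - k] is [o(k)] by the derivative of [cexp] at
    [0], hence [o(h)] by the linear bound on [k], whose factor [8] is absorbed in [e / 8]. *)
Lemma is_derive_Logp1 : is_derive (1 : C) 1 (@Logp R : C -> C) 1.
Proof.
apply/is_derive_cabsP => e e0.
have [d1 d10 B] := Logp1_bound.
have /is_derive_cabsP D := is_derive_cexp 0.
have [d2 d20 K] := D _ (divr_gt0 e0 (ltr0Sn _ 7)).
exists (Num.min (Num.min d1 (d2 / 8)) 1); first by rewrite !lt_min d10 divr_gt0 //=.
move=> h; rewrite !lt_min => /andP[/andP[h1 h2] h3].
have {}B := B _ h1.
have w0 : 1 + h != 0.
  apply/eqP => w0; have : cabs h = 1 by rewrite -cabsN -cabs1 -(addrK h 1) w0 add0r.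
  lra.
rewrite Logp1 subr0 mul1r; set k := Logp (1 + h) in B *.
have := K k; rewrite add0r cexp0 mul1r [cexp k]LogpK // (addrC 1 h) addrK cabs_distC.
move=> /(_ _) H; apply: le_trans (H _) _; first by lra.
by rewrite mulrAC ler_pdivrMr // mulrAC -mulrA ler_pM2l // mulrC.
Qed.

Lemma near_on_nonpos_axis z : ~ on_nonpos_axis z -> \forall w \near z, ~ on_nonpos_axis (w : R[i]).
Proof.
move=> H; case: (eqVneq (Im z) 0) => [i0|i0].
  have r0 : 0 < Re z by rewrite ltNge; apply/negP => ?; apply: H.
  apply/nbhs_cabsP; exists (Re z) => // w wz [_ rw].
  by have := le_lt_trans (normr_Re_le _) wz; rewrite cReD cReN ltr_norml; lra.
apply/nbhs_cabsP; exists `|Im z|; first by rewrite normr_gt0.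
move=> w wz [iw _]; have := le_lt_trans (normr_Im_le _) wz.
by rewrite cImD cImN iw add0r normrN ltxx.
Qed.

(** Near [z] one has [L w = L z + Logp (w / z)], so the derivative at [1] is transported by the
    homomorphism law. *)
Lemma is_derive_log_branch (L : C -> C) z : z != 0 ->
  (\forall w \near (1 : C), L (z * w) = L z + Logp w) -> is_derive z 1 L z^-1.
Proof.
move=> z0 H.
have zz : z / z = 1 by rewrite divff.
have D : is_derive z 1 (fun w : C => w / z : C) z^-1.
  apply: is_derive_eq (is_deriveMK (is_derive_id _ _) (is_derive_cst z^-1 _ _)) _.
  by rewrite mulr0 add0r mulr1.
pose g w : C := L z + Logp (w / z).
have : is_derive z 1 g z^-1.
  rewrite -[X in is_derive _ _ _ X](add0r); apply: is_deriveD.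
  rewrite -[X in is_derive _ _ _ X]mul1r.
  by apply: is_derive1_compK; rewrite zz; exact: is_derive_Logp1.
apply: near_eq_is_derive.
have cD := is_derive_continuous D.
have H' : nbhs (z / z : C) [set w | L (z * w) = L z + Logp w] by rewrite zz.
have : \forall w \near z, L (z * (w / z)) = L z + Logp (w / z) by exact: (cD _ H').
by apply: filterS => w; rewrite mulrC divfK // => ->.
Qed.

Lemma Arg_small e : 0 < e -> \forall w \near (1 : C), `|Arg (w : R[i])| < e.
Proof.
move=> e0; have [d1 d10 B] := Logp1_bound.
apply/nbhs_cabsP; exists (Num.min d1 (e / 8)); first by rewrite lt_min d10 divr_gt0.
move=> w; rewrite lt_min => /andP[/B h1 h2]; have := normr_Im_le (Logp (1 + (w - 1))).
by rewrite (addrC 1) subrK in h1 *; rewrite Im_Logp; lra.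
Qed.

Lemma near1_neq0 : \forall w \near (1 : C), w != 0.
Proof.
apply/nbhs_cabsP; exists 1 => // w; apply: contraTneq => ->.
by rewrite sub0r cabsN cabs1 ltxx.
Qed.

Lemma is_derive_Logp z : ~ on_nonpos_axis z -> is_derive z 1 (@Logp R : C -> C) z^-1.
Proof.
move=> H; have z0 : z != 0.
  by apply/eqP => e; apply: H; rewrite e /on_nonpos_axis /=.
have /andP[A1 A2] := Arg_lt H.
apply: is_derive_log_branch => //; have pi0 := @pi_gt0 R.
(* The distance from [Arg z] to [- pi] and [pi]: a smaller [Arg w] cannot push the sum over the
   cut. *)
have e0 : 0 < Num.min (Arg z + pi) (pi - Arg z) by rewrite lt_min; apply/andP; split; lra.
near=> w; have w0 : w != 0 by near: w; exact: near1_neq0.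
rewrite -[X in Logp (X * _)](LogpK z0) -[X in Logp (_ * X)](LogpK w0) -cexpD cexpK //.
rewrite cImD !Im_Logp.
have : `|Arg (w : R[i])| < Num.min (Arg z + pi) (pi - Arg z) by near: w; exact: Arg_small.
by rewrite lt_min !ltr_norml; lra.
Unshelve. all: by end_near. Qed.

Lemma is_derive_horizontal f (u y : R) d : is_derive (u +i* y : C) 1 f d ->
  is_derive u 1 (fun x : R => Re (f (x +i* y))) (Re d).
Proof.
move=> /is_derive_cabsP H; apply/is_derive_normP => e /H[dl dl0 K].
apply/nbhs_ballP; exists dl => //= h; rewrite -ball_normE /= sub0r normrN => hd.
have := K h%:C; rewrite cabs_real => /(_ hd); apply: le_trans.
apply: le_trans (normr_Re_le _).
rewrite !reim /= mulr0 subr0.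
by rewrite (_ : u +i* y + h%:C = (u + h) +i* y) //; apply: complex_ext; rewrite !reim /= ?addr0.
Qed.

(** Moving vertically multiplies the increment by [i], and [Re (i d) = - Im d]. This is the
    Cauchy-Riemann input for shifting contours. *)
Lemma is_derive_vertical f (u y : R) d : is_derive (u +i* y : C) 1 f d ->
  is_derive y 1 (fun x : R => Re (f (u +i* x))) (- Im d).
Proof.
move=> /is_derive_cabsP H; apply/is_derive_normP => e /H[dl dl0 K].
apply/nbhs_ballP; exists dl => //= h; rewrite -ball_normE /= sub0r normrN => hd.
have ch : cabs (0 +i* h) = `|h| by rewrite /cabs /= expr0n /= add0r sqrtr_sqr.
have := K (0 +i* h); rewrite ch => /(_ hd); apply: le_trans.
apply: le_trans (normr_Re_le _).
rewrite !reim /= mulr0 sub0r mulNr.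
by rewrite (_ : u +i* y + 0 +i* h = u +i* (y + h)) //; apply: complex_ext; rewrite !reim /= ?addr0.
Qed.

End ComplexTopology.

(** * Calculus of continuously differentiable functions *)

Section C1.
Context {K : numFieldType}.
Implicit Types (f g h : K^o -> K^o) (z : K^o).

(** Continuity of the derivative is included because differentiation under the integral sign needs
    the derivative to be bounded on compact rectangles. *)
Definition C1at f z :=
  (\forall w \near z, derivable f w 1) /\ {for z, continuous ('D_1 f)}.

Lemma C1at_intro f (f' : K^o -> K^o) z :
  (\forall w \near z, is_derive (w : K^o) 1 f (f' w)) -> {for z, continuous f'} -> C1at f z.
Proof.
move=> H cf; split; first by apply: filterS H => w [].
have E : \forall w \near z, f' w = 'D_1 f w by apply: filterS H => w [_ ->].
rewrite /prop_for /continuous_at -(nbhs_singleton E).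
exact: cvg_trans (near_eq_cvg E) cf.
Qed.

Lemma C1at_is_derive f z : C1at f z -> \forall w \near z, is_derive (w : K^o) 1 f ('D_1 f w).
Proof. by move=> [H _]; apply: filterS H => w /derivableP. Qed.

Lemma C1at_is_derive1 f z : C1at f z -> is_derive z 1 f ('D_1 f z).
Proof. by move=> /C1at_is_derive /nbhs_singleton. Qed.

Lemma C1at_continuous f z : C1at f z -> {for z, continuous f}.
Proof. by move=> /C1at_is_derive1 /is_derive_continuous. Qed.

Lemma C1at_near f g z : (\forall w \near z, f w = g w) -> C1at f z -> C1at g z.
Proof.
move=> E cf; apply: (@C1at_intro _ ('D_1 f)); last by case: cf.
have := C1at_is_derive cf; have := near_join E; apply: filterS2 => w Ew.
exact: near_eq_is_derive.
Qed.

Lemma C1at_cst (c : K^o) z : C1at (cst c) z.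
Proof.
apply: (@C1at_intro _ (cst 0)); last exact: cst_continuous.
by apply: (@filterE _ (nbhs z)) => w; exact: is_derive_cst.
Qed.

Lemma C1at_id z : C1at id z.
Proof.
apply: (@C1at_intro _ (cst 1)); last exact: cst_continuous.
by apply: (@filterE _ (nbhs z)) => w; exact: is_derive_id.
Qed.

Lemma C1atD f g z : C1at f z -> C1at g z -> C1at (fun w => f w + g w) z.
Proof.
move=> cf cg; apply: (@C1at_intro _ (fun w => 'D_1 f w + 'D_1 g w)).
  have := C1at_is_derive cf; have := C1at_is_derive cg; apply: filterS2 => w ? ?.
  exact: is_deriveD.
by apply: (@cvgD K K^o _ (nbhs z) _); [case: cf | case: cg].
Qed.

Lemma C1atM f g z : C1at f z -> C1at g z -> C1at (fun w => f w * g w) z.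
Proof.
move=> cf cg; apply: (@C1at_intro _ (fun w => f w * 'D_1 g w + g w * 'D_1 f w)).
  have := C1at_is_derive cf; have := C1at_is_derive cg; apply: filterS2 => w ? ?.
  exact: is_deriveMK.
apply: (@cvgD K K^o _ (nbhs z) _); apply: (@cvgM K _ (nbhs z) _).
- exact: C1at_continuous.
- by case: cg.
- exact: C1at_continuous.
- by case: cf.
Qed.

Lemma C1atN f z : C1at f z -> C1at (fun w => - f w) z.
Proof.
move=> cf; apply: (@C1at_intro _ (fun w => - 'D_1 f w)).
  have := C1at_is_derive cf; apply: filterS => w ?; exact: is_deriveN.
by apply: (@cvgN K K^o _ (nbhs z) _); case: cf.
Qed.

Lemma C1at_comp f g z : C1at f (g z) -> C1at g z -> C1at (f \o g) z.
Proof.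
move=> cf cg; have ctg := C1at_continuous cg.
apply: (@C1at_intro _ (fun w => 'D_1 f (g w) * 'D_1 g w)).
  have H2 : \forall w \near z, is_derive (g w) 1 f ('D_1 f (g w)).
    exact: (ctg _ (C1at_is_derive cf)).
  have := C1at_is_derive cg; apply: filterS2 H2 => w ? ?.
  exact: is_derive1_compK.
apply: (@cvgM K _ (nbhs z) _); last by case: cg.
exact: (@continuous_comp _ _ _ g ('D_1 f) z ctg (proj2 cf)).
Qed.

Lemma near_neq0 z : z != 0 -> \forall w \near z, w != 0.
Proof.
move=> z0; apply/nbhs_ballP; exists `|z|; first by rewrite /= normr_gt0.
by move=> w; rewrite -ball_normE /=; apply: contraTneq => ->; rewrite subr0 ltxx.
Qed.

Lemma C1at_inv z : z != 0 -> C1at (fun w => w^-1) z.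
Proof.
move=> z0; apply: (@C1at_intro _ (fun w => - w ^- 2)).
  by apply: filterS (near_neq0 z0) => w; exact: is_derive_invK.
apply: (@cvgN K K^o _ (nbhs z) _); apply: (@cvgV K _ (nbhs z) _); first by rewrite expf_neq0.
by rewrite expr2; apply: (@cvgM K _ (nbhs z) _); exact: cvg_id.
Qed.

Lemma C1atV f z : f z != 0 -> C1at f z -> C1at (fun w => (f w)^-1) z.
Proof. by move=> f0 cf; apply: (@C1at_comp (fun w => w^-1)) => //; exact: C1at_inv. Qed.

End C1.

Section C1Complex.
Context {R : realType}.
Local Notation C := (R[i]^o).
Implicit Types (f g h : C -> C) (z : C).

Lemma C1at_cexp z : C1at (@cexp R : C -> C) z.
Proof.
apply: (@C1at_intro _ _ cexp).
  by apply: (@filterE _ (nbhs z)) => w; exact: is_derive_cexp.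
exact: is_derive_continuous (is_derive_cexp z).
Qed.

Lemma neq0_on_nonpos_axis (z : R[i]) : ~ on_nonpos_axis z -> z != 0.
Proof. by move=> H; apply/eqP => e; apply: H; rewrite e /on_nonpos_axis /=. Qed.

Lemma C1at_Logp z : ~ on_nonpos_axis (z : R[i]) -> C1at (@Logp R : C -> C) z.
Proof.
move=> H; apply: (@C1at_intro _ _ (fun w => w^-1)).
  by apply: filterS (near_on_nonpos_axis H) => w; exact: is_derive_Logp.
exact: C1at_continuous (C1at_inv (neq0_on_nonpos_axis H)).
Qed.

End C1Complex.

(** * Contour integrals over a strip *)

Section Integration.
Context {R : realType}.
Local Notation C := (R[i]^o).
Notation mu := (@lebesgue_measure R).

Lemma continuous_Complex : continuous (fun p : R * R => p.2 +i* p.1 : C).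
Proof. by move=> p; apply: cvg_Complex; [exact: cvg_snd | exact: cvg_fst]. Qed.

Lemma continuous_horizontal (f : C -> C) (u y : R) :
  {for (u +i* y : C), continuous f} -> {for u, continuous (fun x : R => Re (f (x +i* y)))}.
Proof.
move=> cf; apply: cvg_Re.
have c : (x +i* y : C) @[x --> u] --> (u +i* y : C).
  by apply: cvg_Complex; [exact: cvg_id | exact: cvg_cst].
exact: cvg_comp c cf.
Qed.

Lemma continuous_vertical (f : C -> C) (u y : R) :
  {for (u +i* y : C), continuous f} -> {for y, continuous (fun x : R => Re (f (u +i* x)))}.
Proof.
move=> cf; apply: cvg_Re.
have c : (u +i* x : C) @[x --> y] --> (u +i* y : C).
  by apply: cvg_Complex; [exact: cvg_cst | exact: cvg_id].
exact: cvg_comp c cf.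
Qed.

(** By evenness only the half line matters, where the integrand is [e^-1] times the exponential
    density of rate [e]. *)
Lemma integrable_expR_abs (e : R) : 0 < e ->
  mu.-integrable setT (EFin \o (fun u : R => expR (- (e * `|u|)))).
Proof.
move=> e0; have cE : continuous (fun u : R => expR (- (e * `|u|))).
  move=> u; apply: continuous_comp; last exact: continuous_expR.
  by apply: cvgN; apply: cvgM; [exact: cvg_cst | exact: norm_continuous].
apply/integrableP; split.
  by apply/measurable_EFinP; exact: continuous_measurable_fun.
have -> : (\int[mu]_x `|(expR (- (e * `|x|)))%:E| = \int[mu]_x (expR (- (e * `|x|)))%:E)%E.
  by apply: eq_integral => x _; rewrite /= ger0_norm // expR_ge0.
rewrite ge0_symfun_integralT //; last by move=> x /=; rewrite normrN.
have -> : (\int[mu]_(x in [set x | (0 <= x)%R]) (expR (- (e * `|x|)))%:E =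
           \int[mu]_x (e^-1%:E * (exponential_pdf e x)%:E))%E.
  rewrite integral_mkcond; apply: eq_integral => x _.
  rewrite /exponential_pdf !patchE.
  have -> : (x \in [set x : R | 0 <= x]) = (0 <= x) by apply/idP/idP; rewrite inE.
  have -> : (x \in `[0, +oo[) = (0 <= x) by apply/idP/idP; rewrite inE /= in_itv /= andbT.
  case: (lerP 0 x) => x0; last by rewrite /point /= mule0.
  by rewrite -EFinM mulKf ?gt_eqF // ger0_norm // mulNr.
rewrite ge0_integralZl ?lee_fin ?invr_ge0 ?(ltW e0) //; last 2 first.
- by apply/measurable_EFinP; exact: measurable_exponential_pdf.
- by move=> x _; rewrite lee_fin exponential_pdf_ge0 // ltW.
by rewrite integral_exponential_pdf // mule1 -EFinM ltry.
Qed.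

End Integration.

Section Strip.
Context {R : realType}.
Local Notation C := (R[i]^o).
Notation mu := (@lebesgue_measure R).

Lemma within_continuous_segment (f : R -> R) (a b : R) :
  (forall x, a <= x <= b -> {for x, continuous f}) -> {within `[a, b], continuous f}.
Proof. by move=> cf; apply: continuous_in_subspaceT => x; rewrite inE /= in_itv /= => /cf. Qed.

Lemma integrable_segment (f : R -> R) (a b : R) :
  (forall x, a <= x <= b -> {for x, continuous f}) ->
  mu.-integrable `[a, b] (EFin \o f).
Proof.
move=> cf; apply: continuous_compact_integrable; first exact: segment_compact.
exact: within_continuous_segment.
Qed.

Lemma FTC2_segment (f F : R -> R) (a b : R) : a < b ->
  (forall x, a <= x <= b -> is_derive x 1 F (f x)) ->
  (forall x, a <= x <= b -> {for x, continuous f}) ->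
  \int[mu]_(x in `[a, b]) f x = F b - F a.
Proof.
move=> ab dF cf.
have cF x : a <= x <= b -> {for x, continuous F} by move=> /dF /is_derive_continuous.
have oo x : x \in `]a, b[%R -> a <= x <= b by rewrite in_itv /= => /andP[/ltW -> /ltW ->].
rewrite /Rintegral (@continuous_FTC2 _ _ F) //.
- exact: within_continuous_segment.
- split.
  + by move=> x /oo /dF [].
  + by apply: cvg_at_right_filter; apply: cF; rewrite lexx ltW.
  + by apply: cvg_at_left_filter; apply: cF; rewrite lexx ltW.
- by move=> x /oo /dF [_ <-]; rewrite derive1E.
Qed.

Lemma is_derive_horizontal_Im (f : C -> C) (u y : R) d : is_derive (u +i* y : C) 1 f d ->
  is_derive u 1 (fun x : R => Im (f (x +i* y))) (Im d).
Proof.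
move=> D; have := is_deriveMK (is_derive_cst (0 -i* 1 : C) _ _) D.
rewrite mulr0 addr0 => /is_derive_horizontal.
have E (w : R[i]) : Re ((0 -i* 1) * w) = Im w by rewrite cReM /=; ring.
by rewrite E; under eq_fun do rewrite E.
Qed.

(** By Cauchy-Riemann, the [y]-derivative of [Re M] is [- Im M'], which is also the [u]-derivative
    of [- Im M]. After differentiation under the integral the integrand is thus exact in [u], and
    only the ends remain. *)
Lemma is_derive_strip_integral (M : C -> C) (l h a b y : R) : a < b ->
  (forall v, l < Im v < h -> C1at M v) -> l < y < h ->
  is_derive y 1 (fun t : R => \int[mu]_(u in `[a, b]) Re (M (u +i* t)))
    (Im (M (a +i* y)) - Im (M (b +i* y))).
Proof.
move=> ab cM /andP[ly yh].
pose D : C -> C := 'D_1 M.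
(* A closed band around [y] inside the open strip: on the compact rectangle over it [M'] is bounded,
   and that bound [G] dominates. *)
pose y1 := (l + y) / 2; pose y2 := (y + h) / 2.
have yy : y1 < y < y2 by apply/andP; split; rewrite /y1 /y2; lra.
have I12 t : y1 <= t <= y2 -> l < t < h by rewrite /y1 /y2; lra.
have cD u t : l < t < h -> {for (u +i* t : C), continuous D}.
  by move=> lt; case: (cM (u +i* t) lt).
have dM u t : l < t < h -> is_derive (u +i* t : C) 1 M (D (u +i* t)).
  by move=> lt; apply: C1at_is_derive1; exact: cM.
have cM0 u t : l < t < h -> {for (u +i* t : C), continuous M}.
  by move=> lt; apply: C1at_continuous; exact: cM.
pose A : set (R * R) := `[y1, y2] `*` `[a, b].
have [G GP] : exists G : R, forall t u, y1 <= t <= y2 -> a <= u <= b ->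
    `|Im (D (u +i* t))| <= G.
  pose g (p : R * R) := `|Im (D (p.2 +i* p.1))|.
  have cg : {within A, continuous g}.
    apply: continuous_in_subspaceT => p; rewrite inE => -[/= p1 p2].
    apply: (@cvg_norm _ _ _ (nbhs p)); apply: cvg_Im.
    apply: (@continuous_comp _ _ _ (fun p : R * R => p.2 +i* p.1 : C) D p).
      exact: continuous_Complex.
    by apply: cD; apply: I12; move: p1; rewrite ?in_itv.
  have [||c _ cP] := compact_EVT_max _ _ cg.
  - exists (y, a); split => /=; rewrite in_itv /=; first by apply/andP; split; apply: ltW; case/andP: yy.
    by rewrite lexx ltW.
  - by apply: compact_setX; exact: segment_compact.
  - exists (g c) => t u t12 ub; apply: (cP (t, u)).
    by rewrite inE; split; rewrite /= in_itv.
pose f (t u : R) := Re (M (u +i* t)).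
have df t u : l < t < h -> is_derive t 1 (f ^~ u) (- Im (D (u +i* t))).
  by move=> lt; apply: is_derive_vertical; exact: dM.
have Iy : `]y1, y2[%classic y by rewrite /= in_itv.
have intf t : `]y1, y2[%classic t -> mu.-integrable `[a, b] (EFin \o f t).
  rewrite /= in_itv /= => /andP[/ltW t1 /ltW t2].
  apply: integrable_segment => u _; apply: continuous_horizontal; apply: cM0.
  by apply: I12; rewrite t1 t2.
have I12o t : `]y1, y2[%classic t -> y1 <= t <= y2.
  by rewrite /= in_itv /= => /andP[/ltW -> /ltW ->].
have derf t u : `]y1, y2[%classic t -> `[a, b]%classic u -> derivable (f ^~ u) t 1.
  by move=> /I12o /I12 lt _; case: (df t u lt).
have G0 : 0 <= G.
  apply: le_trans (GP y a _ _); first exact: normr_ge0.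
    by apply: I12o.
  by rewrite lexx ltW.
have d1E t u : l < t < h -> partial1of2 f t u = - Im (D (u +i* t)).
  by move=> lt; rewrite partial1of2E; case: (df t u lt).
have Gub t u : `]y1, y2[%classic t -> `[a, b]%classic u -> `|partial1of2 f t u| <= G.
  move=> /I12o lt; rewrite /= in_itv /= => ub.
  by rewrite d1E ?normrN; [exact: GP | exact: I12].
have intG : mu.-integrable `[a, b] (EFin \o (cst G : R -> R)).
  by apply: integrable_segment => u _; exact: cvg_cst.
have mab := @measurable_itv R `[a, b]%R.
split.
  exact: (derivable_under_integral (mu := mu) mab Iy intf derf (fun=> G0) intG Gub).
have := differentiation_under_integral (mu := mu) mab Iy intf derf (fun=> G0) intG Gub.
rewrite derive1E => ->.
under eq_Rintegral do rewrite d1E ?ly //.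
have dI u : a <= u <= b -> is_derive u 1 (fun u : R => - Im (M (u +i* y)))
    (- Im (D (u +i* y))).
  by move=> _; apply: is_deriveN; apply: is_derive_horizontal_Im; apply: dM; rewrite ly.
rewrite (FTC2_segment ab dI) ?opprK 1?addrC // => u _.
apply: (@cvgN _ _ _ (nbhs u)); apply: cvg_Im.
apply: (@continuous_comp _ _ _ (fun u : R => u +i* y : C) D u).
  by apply: cvg_Complex; [exact: cvg_id | exact: cvg_cst].
by apply: cD; rewrite ly.
Qed.

End Strip.

Section StripContour.
Context {R : realType}.
Notation mu := (@lebesgue_measure R).

Lemma measurable_fun_continuous_except (f : R -> R) (u0 : R) :
  (forall u, u != u0 -> {for u, continuous f}) -> measurable_fun [set: measurableTypeR R] f.
Proof.
move=> cf; have -> : [set: measurableTypeR R] = [set u : R | u != u0] `|` [set u0].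
  by apply/esym; rewrite -subTset => u _ /=; case: (eqVneq u u0) => [->|]; [right|left].
have oD : open [set u : R | u != u0] := @open_neq R u0.
apply/measurable_funU; [exact: open_measurable | exact: measurable_set1 | split].
  by apply: open_continuous_measurable_fun => // u; rewrite inE /=; exact: cf.
exact: measurable_fun_set1.
Qed.

(** The point [u0] is a null set; it stands for the boundary point where continuity may fail. *)
Lemma Rintegral_dominated (f_ : nat -> R -> R) (f g : R -> R) (u0 : R) :
  (forall n, measurable_fun [set: measurableTypeR R] (f_ n)) ->
  measurable_fun [set: measurableTypeR R] f ->
  (forall u, u != u0 -> f_ n u @[n --> \oo] --> f u) ->
  mu.-integrable setT (EFin \o g) ->
  (forall n u, u != u0 -> `|f_ n u| <= g u) ->
  mu.-integrable setT (EFin \o f) /\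
  \int[mu]_u f_ n u @[n --> \oo] --> \int[mu]_u f u.
Proof.
move=> mf_ mf cf ig fg.
have n0 : mu.-negligible [set u0].
  by exists [set u0]; split => //; exact: lebesgue_measure_set1.
have [|||||H1 _ H2] := @dominated_convergence _ _ _ mu setT measurableT
  (fun n => EFin \o f_ n) (EFin \o f) (EFin \o g).
- by move=> n; apply/measurable_EFinP.
- exact/measurable_EFinP.
- apply: negligibleS n0 => u /=; apply: contra_notP => /eqP u0' _.
  by apply: cvg_EFin; [exact: nearW | exact: cf].
- exact: ig.
- apply: negligibleS n0 => u /=; apply: contra_notP => /eqP u0' n _.
  by rewrite lee_fin fg.
split=> //; apply: fine_cvg; rewrite fineK //.
exact: integrable_fin_num.
Qed.

Lemma Rintegral_truncate (f : R -> R) : mu.-integrable setT (EFin \o f) ->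
  \int[mu]_(u in `[- n.+1%:R, n.+1%:R]) f u @[n --> \oo] --> \int[mu]_u f u.
Proof.
move=> fi; pose f_ n := f \_ `[- n.+1%:R, n.+1%:R].
have mf : measurable_fun [set: measurableTypeR R] f.
  by apply/measurable_EFinP; exact: measurable_int fi.
have -> : (fun n => \int[mu]_(u in `[- n.+1%:R, n.+1%:R]) f u) = (fun n => \int[mu]_u f_ n u).
  by apply/funext => n; rewrite Rintegral_mkcond.
apply: (proj2 (@Rintegral_dominated f_ f (fun u => `|f u|) 0 _ mf _ _ _)).
- move=> n; apply/(measurable_restrictT f (measurable_itv _)).
  exact: measurable_funS mf.
- move=> u _; apply: (@cvg_trans _ ((fun=> f u) @ \oo)); last exact: cvg_cst.
  apply: near_eq_cvg; near=> n; rewrite /f_ patchE ifT // inE /= in_itv /= -ler_norml.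
  apply: (le_trans (ltW (truncnS_gt _))); rewrite ler_nat ltnS.
  by near: n; exact: nbhs_infty_ge.
- exact: integrable_abse fi.
- by move=> n u _; rewrite /f_ patchE; case: ifP => // _; rewrite /point /= normr0.
Unshelve. all: by end_near. Qed.

End StripContour.

Section StripConst.
Context {R : realType}.
Local Notation C := (R[i]^o).
Notation mu := (@lebesgue_measure R).

Lemma cvg_expR_natN (e : R) : 0 < e -> expR (- (e * n.+1%:R)) @[n --> \oo] --> (0 : R).
Proof.
move=> e0; apply: (@cvg_comp _ _ _ (fun n : nat => e * n.+1%:R) (fun x => expR (- x)) _ +oo).
  apply/cvgryPge => A; near=> n.
  rewrite mulrC -ler_pdivrMr // (le_trans (ltW (truncnS_gt (A / e)))) // ler_nat ltnS.
  by near: n; exact: nbhs_infty_ge.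
exact: cvgr_expR.
Unshelve. all: by end_near. Qed.

Section Bounds.
Variables (M : C -> C) (l h e K : R).
Hypothesis e0 : 0 < e.
Hypothesis cM : forall v, l < Im v < h -> C1at M v.
Hypothesis bM : forall v, l < Im v < h -> cabs (M v) <= K * expR (- (e * `|Re v|)).

Let W (u : R) := K * expR (- (e * `|u|)).

Let intW : mu.-integrable setT (EFin \o W).
Proof.
have -> : EFin \o W = (fun u => K%:E * (EFin \o (fun u : R => expR (- (e * `|u|)))) u)%E.
  by apply/funext => u; rewrite /= EFinM.
by apply: integrableZl => //; exact: integrable_expR_abs.
Qed.

Lemma strip_measurable y : l < y < h ->
  measurable_fun [set: measurableTypeR R] (fun u : R => Re (M (u +i* y))).
Proof.
move=> ly; apply: (@measurable_fun_continuous_except _ _ 0) => u _.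
by apply: continuous_horizontal; apply: C1at_continuous; exact: cM.
Qed.

Lemma strip_integrable y : l < y < h ->
  mu.-integrable setT (EFin \o (fun u : R => Re (M (u +i* y)))).
Proof.
move=> ly; apply: le_integrable intW => //.
  by apply/measurable_EFinP; exact: strip_measurable.
move=> u _; rewrite /= lee_fin; apply: le_trans (normr_Re_le _) _.
by apply: le_trans (bM _) (ler_norm _).
Qed.

(** For the integral truncated at distance [n], the derivative in the height consists of two end
    values, at most [2 K expR (- e n)] together. By the mean value theorem the difference between
    two heights tends to [0] as the truncation is removed. *)
Lemma strip_const y1 y2 : l < y1 < h -> l < y2 < h -> y1 <= y2 ->
  \int[mu]_u Re (M (u +i* y1)) = \int[mu]_u Re (M (u +i* y2)).
Proof.
move=> ly1 ly2 y12.
pose J n y := \int[mu]_(u in `[- n.+1%:R, n.+1%:R]) Re (M (u +i* y)).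
have cJ y : l < y < h -> J n y @[n --> \oo] --> \int[mu]_u Re (M (u +i* y)).
  by move=> ly; apply: Rintegral_truncate; exact: strip_integrable.
have cD : J n y2 - J n y1 @[n --> \oo] -->
    \int[mu]_u Re (M (u +i* y2)) - \int[mu]_u Re (M (u +i* y1)).
  by apply: cvgB; exact: cJ.
have c0 : J n y2 - J n y1 @[n --> \oo] --> (0 : R).
  pose w n := expR (- (e * n.+1%:R)) * (2 * K * (y2 - y1)).
  have cw : w n @[n --> \oo] --> (0 : R).
    rewrite -[X in _ --> X](mul0r (2 * K * (y2 - y1))).
    by apply: cvgM; [exact: cvg_expR_natN | exact: cvg_cst].
  apply: (@squeeze_cvgr _ _ _ _ (fun n => - w n) w) => //; last first.
    by rewrite -oppr0; exact: cvgN.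
  apply: nearW => n; rewrite -ler_norml.
  have n0 : - n.+1%:R < n.+1%:R :> R by rewrite gtrN.
  have I y : y1 <= y <= y2 -> l < y < h by lra.
  have dJ y : y1 <= y <= y2 -> is_derive y 1 (J n)
      (Im (M (- n.+1%:R +i* y)) - Im (M (n.+1%:R +i* y))).
    by move=> /I ly; exact: is_derive_strip_integral n0 cM ly.
  have [||c] := @MVT_segment _ (J n)
      (fun y => Im (M (- n.+1%:R +i* y)) - Im (M (n.+1%:R +i* y))) y1 y2 y12.
  - by move=> y; rewrite in_itv /= => /andP[/ltW ? /ltW ?]; apply: dJ; apply/andP.
  - by apply: within_continuous_segment => y /dJ /is_derive_continuous.
  rewrite in_itv /= => /I lc ->; rewrite normrM (ger0_norm (_ : 0 <= y2 - y1)) ?subr_ge0 //.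
  rewrite /w mulrA ler_wpM2r ?subr_ge0 //.
  apply: le_trans (ler_normB _ _) _.
  have B1 := le_trans (normr_Im_le _) (bM (v := - n.+1%:R +i* c) lc).
  have B2 := le_trans (normr_Im_le _) (bM (v := n.+1%:R +i* c) lc).
  by move: B1 B2; rewrite /= normrN (ger0_norm (ler0n _ _)); lra.
apply/eqP; rewrite eq_sym -subr_eq0; apply/eqP.
exact: cvg_unique cD c0.
Qed.

Lemma strip_limit (y : R) (y_ : nat -> R) (u0 c : R) :
  (forall n, l < y_ n < h) -> y_ n @[n --> \oo] --> y ->
  (forall u, u != u0 -> {for (u +i* y : C), continuous M}) ->
  (forall n, \int[mu]_u Re (M (u +i* y_ n)) = c) ->
  mu.-integrable setT (EFin \o (fun u : R => Re (M (u +i* y)))) /\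
  \int[mu]_u Re (M (u +i* y)) = c.
Proof.
move=> ly cy ctM E.
have [|||||H1 H2] := @Rintegral_dominated _ (fun n u => Re (M (u +i* y_ n)))
  (fun u => Re (M (u +i* y))) W u0.
- by move=> n; exact: strip_measurable.
- by apply: (@measurable_fun_continuous_except _ _ u0) => u /ctM H;
  exact: (@continuous_horizontal _ M u y H).
- move=> u /ctM H; have cu := @continuous_vertical _ M u y H.
  by apply: (cvg_comp _ _ cy cu).
- exact: intW.
- by move=> n u _; apply: le_trans (normr_Re_le _) _; exact: (bM (v := u +i* y_ n) (ly n)).
split=> //; move: H2; under eq_fun do rewrite E.
have H3 : (fun=> c) n @[n --> \oo] --> c by exact: cvg_cst.
by move=> H2; exact: cvg_unique H2 H3.
Qed.

(** All interior heights give the same value. One exponential majorant serves every height, so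
    dominated convergence carries this value to each side. *)
Lemma strip_closed (ul uh : R) : l < h ->
  (forall u, u != ul -> {for (u +i* l : C), continuous M}) ->
  (forall u, u != uh -> {for (u +i* h : C), continuous M}) ->
  [/\ mu.-integrable setT (EFin \o (fun u : R => Re (M (u +i* l)))),
      mu.-integrable setT (EFin \o (fun u : R => Re (M (u +i* h)))) &
      \int[mu]_u Re (M (u +i* l)) = \int[mu]_u Re (M (u +i* h))].
Proof.
move=> lh cl ch.
(* With [n.+1] the first term would be [h - l] and land on the opposite side; [n.+2] keeps every
   height interior. *)
pose d n : R := (h - l) / n.+2%:R.
have d0 n : 0 < d n < h - l.
  rewrite /d divr_gt0 ?subr_gt0 //= ltr_pdivrMr // ltr_pMr ?subr_gt0 // ltr1n //.
have cd : d n @[n --> \oo] --> (0 : R).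
  rewrite -[X in _ --> X](mulr0 (h - l)); apply: cvgM; first exact: cvg_cst.
  by have := @cvg_harmonic R; rewrite -cvg_shiftS.
pose c := \int[mu]_u Re (M (u +i* ((l + h) / 2))).
have Ec y : l < y < h -> \int[mu]_u Re (M (u +i* y)) = c.
  have m : l < (l + h) / 2 < h by apply/andP; split; lra.
  by move=> ly; case: (leP y ((l + h) / 2)) => [|/ltW] yy; [|apply/esym]; exact: strip_const.
have [||||i1 e1] := @strip_limit l (fun n => l + d n) ul c.
- by move=> n; have := d0 n; lra.
- by rewrite -[X in _ --> X]addr0; apply: cvgD => //; exact: cvg_cst.
- exact: cl.
- by move=> n; apply: Ec; have := d0 n; lra.
have [||||i2 e2] := @strip_limit h (fun n => h - d n) uh c.
- by move=> n; have := d0 n; lra.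
- by rewrite -[X in _ --> X]subr0; apply: cvgB => //; exact: cvg_cst.
- exact: ch.
- by move=> n; apply: Ec; have := d0 n; lra.
by split=> //; rewrite e1 e2.
Qed.

End Bounds.

End StripConst.

(** * Contour integrals against a Cauchy kernel *)

Section Contour.
Context {R : realType}.
Local Notation C := (R[i]^o).
Notation mu := (@lebesgue_measure R).

(** Away from [a], [|w - a|] is comparable to [1 + |w|]: indeed [|w| <= |w - a| + |a|], and
    [1 + |a|] is at most [(1 + |a|) / d] times [|w - a|]. *)
Lemma cabs_sub_ge (w a : R[i]) (d : R) : 0 < d -> d <= cabs (w - a) ->
  d / (1 + cabs a + d) * (1 + cabs w) <= cabs (w - a).
Proof.
move=> d0 dw; have a0 := cabs_ge0 a; have p : 0 < 1 + cabs a + d by lra.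
rewrite mulrAC ler_pdivrMr //.
have : cabs w <= cabs (w - a) + cabs a by rewrite -{1}(subrK a w) cabsD.
move: dw; set t := cabs (w - a) => dw wt.
have : d * (1 + cabs w) <= d * (1 + (t + cabs a)) by rewrite ler_pM2l // lerD2l.
have : (1 + cabs a) * d <= (1 + cabs a) * t by rewrite ler_pM2l //; lra.
lra.
Qed.

Lemma Im_cexp_gt0 (v : R[i]) : 0 < Im v < pi -> 0 < Im (cexp v).
Proof. by move=> H; rewrite /= mulr_gt0 ?expR_gt0 // sin_gt0_pi. Qed.

Lemma cexp_Logp_strip (v : R[i]) : 0 < Im v < pi -> Logp (cexp v) = v.
Proof. by move=> H; apply: cexpK; lra. Qed.

Lemma is_derive_lipschitz (f : C -> C) (z d : C) : is_derive z 1 f d ->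
  exists2 dl : R, 0 < dl & forall w : C, cabs (w - z) < dl ->
    cabs (f w - f z) <= (cabs d + 1) * cabs (w - z).
Proof.
move=> /is_derive_cabsP /(_ 1 ltr01)[dl dl0 H]; exists dl => // w /H.
rewrite mul1r (addrC z) subrK => B.
rewrite mulrDl mul1r -cabsM -lerBlDl; apply: le_trans B; exact: ge_cabsB.
Qed.

Variables (n : C -> C) (u1 e K : R) (a : C).
Hypothesis e01 : 0 < e.
Hypothesis cn : forall v, 0 < Im v < pi -> C1at n v.
Hypothesis bn : forall v, 0 < Im v < pi ->
  cabs (n v) <= K * expR (- (e * `|Re v|)) * (1 + expR (- Re v)).
Hypothesis n0 : forall u, u != u1 -> {for (u +i* 0 : C), continuous n}.
Hypothesis npi : forall u, u != u1 -> {for (u +i* pi : C), continuous n}.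
Hypothesis a0 : Im a != 0.
Hypothesis na : 0 < Im a -> n (Logp a) = 0.

(* [n w dw / (w - a)] in the coordinate [w = e^v]. *)
Definition kernelM (v : C) : C := n v * (cexp v * (cexp v - a)^-1).

Lemma growth_constant_ge0 : 0 <= K.
Proof.
have I : 0 < Im (0 +i* (pi / 2) : R[i]) < pi by rewrite /=; have := @pi_gt0 R; lra.
have := le_trans (cabs_ge0 _) (bn I).
by rewrite pmulr_lge0 ?ltr_wpDr ?expR_ge0 // pmulr_lge0 // expR_gt0.
Qed.

(** Away from the pole the kernel is of size [expR x / (1 + expR x)] with [x = Re v]. This cancels
    the growth factor [1 + expR (- x)] exactly and leaves pure exponential decay. *)
Lemma kernelM_far (v : C) (d : R) : 0 < d -> 0 < Im v < pi -> d <= cabs (cexp v - a) ->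
  cabs (kernelM v) <= K * ((1 + cabs a + d) / d) * expR (- (e * `|Re v|)).
Proof.
move=> d0 Iv dv; have c0 := cabs_ge0 a; have H := cabs_sub_ge d0 dv.
have p : 0 < 1 + cabs a + d by lra.
have E := expR_gt0 (Re v).
have q : 0 < cabs (cexp v - a) by exact: lt_le_trans dv.
rewrite /kernelM !cabsM cabsV cabs_cexp.
have B1 : expR (Re v) / cabs (cexp v - a) <=
    (1 + cabs a + d) / d * (expR (Re v) / (1 + expR (Re v))).
  rewrite cabs_cexp in H; have q2 : 0 < 1 + expR (Re v) by lra.
  have H2 : 1 + expR (Re v) <= (1 + cabs a + d) / d * cabs (cexp v - a).
    by rewrite -ler_pdivrMl ?divr_gt0 // invf_div.
  rewrite ler_pdivrMr // mulrAC; apply: le_trans (ler_wpM2r _ H2).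
    by rewrite mulrC divfK ?gt_eqF.
  by rewrite divr_ge0 // ltW.
apply: le_trans (ler_pM (cabs_ge0 _) _ (bn Iv) B1) _.
  by rewrite divr_ge0 ?cabs_ge0 // ltW.
have -> : expR (- Re v) = (expR (Re v))^-1 by rewrite expRN.
rewrite le_eqVlt; apply/orP; left; apply/eqP; field.
by rewrite !gt_eqF //; lra.
Qed.

Lemma kernel_C1 (v : C) : cexp v != a -> C1at (fun v : C => cexp v * (cexp v - a)^-1 : C) v.
Proof.
move=> va; apply: (@C1atM R[i] (@cexp R) (fun v => (cexp v - a)^-1)); first exact: C1at_cexp.
apply: (@C1atV R[i] (fun v => cexp v - a)); first by rewrite subr_eq0.
exact: (@C1atD R[i] (@cexp R) (cst (- a)) v (C1at_cexp v) (C1at_cst _ _)).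
Qed.

Lemma kernelM_C1 (v : C) : C1at n v -> cexp v != a -> C1at kernelM v.
Proof.
move=> cv va.
exact: (@C1atM R[i] n (fun v => cexp v * (cexp v - a)^-1) v cv (kernel_C1 va)).
Qed.

Lemma kernelM_continuous (v : C) : {for v, continuous n} -> cexp v != a ->
  {for v, continuous kernelM}.
Proof.
move=> cv va; have ck := C1at_continuous (kernel_C1 va).
exact: (@cvgM R[i] _ (nbhs v) _ n (fun v => cexp v * (cexp v - a)^-1) _ _ cv ck).
Qed.

Lemma cexp_real_neq (u : R) : (cexp (u +i* 0) != a) && (cexp (u +i* pi) != a).
Proof.
apply/andP; split; apply: contra a0 => /eqP <-.
  by rewrite /= sin0 mulr0.
by rewrite /= sinpi mulr0.
Qed.

(** If [Im a < 0], the kernel has no pole in the strip. If [Im a > 0], the zero of [n] makes the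
    kernel bounded near the pole but not [C1] there. The strip is then cut at height [Arg a]: the
    pole becomes an exceptional point on the common side of two strips, to each of which
    [strip_closed] applies. *)
Lemma contour_Re :
  [/\ mu.-integrable setT (EFin \o (fun u : R => Re (kernelM (u +i* 0)))),
      mu.-integrable setT (EFin \o (fun u : R => Re (kernelM (u +i* pi)))) &
      \int[mu]_u Re (kernelM (u +i* 0)) = \int[mu]_u Re (kernelM (u +i* pi))].
Proof.
have K0 := growth_constant_ge0; have pi0 := @pi_gt0 R.
have ct0 u : u != u1 -> {for (u +i* 0 : C), continuous kernelM}.
  by move=> uu; apply: kernelM_continuous; [exact: n0 | case/andP: (cexp_real_neq u)].
have ctpi u : u != u1 -> {for (u +i* pi : C), continuous kernelM}.
  by move=> uu; apply: kernelM_continuous; [exact: npi | case/andP: (cexp_real_neq u)].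
case: (ltrP 0 (Im a)) => [ap|an]; last first.
  have {}an : 0 < - Im a by rewrite oppr_gt0 lt_neqAle a0.
  have d v : 0 < Im v < pi -> - Im a <= cabs (cexp v - a).
    move=> /Im_cexp_gt0 H; apply: le_trans (normr_Im_le _).
    by rewrite cImD cImN (le_trans _ (ler_norm _)) // lerDr ltW.
  apply: (strip_closed (K := K * ((1 + cabs a + - Im a) / - Im a)) e01 _ _ pi0 ct0 ctpi).
    move=> v Iv; apply: kernelM_C1; first exact: cn.
    apply/eqP => E; have := d v Iv; rewrite E subrr cabs0; lra.
  by move=> v Iv; apply: kernelM_far => //; exact: d.
have az : a != 0 by apply: contra a0 => /eqP ->.
have A0 : ~ on_nonpos_axis (a : R[i]) by move=> [ia _]; rewrite ia ltxx in ap.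
have Aa : 0 < Arg (a : R[i]) < pi.
  have := Arg_lt A0 => /andP[A1 A2]; rewrite A2 andbT ltNge; apply/negP => A3.
  have : Im (cexp (Logp a)) <= 0.
    rewrite /= pmulr_rle0 ?expR_gt0 // -oppr_ge0 -sinN sin_ge0_pi //; lra.
  by rewrite LogpK //; lra.
(* [n (Logp w)] vanishes at [w = a], so its Lipschitz bound compensates the denominator [w - a]. *)
have [L [d [d0 dL]]] : exists L d : R, 0 < d /\
    forall w : C, cabs (w - a) < d -> cabs (n (Logp w)) <= L * cabs (w - a).
  have D1 := C1at_is_derive1 (cn (v := Logp a) Aa).
  have D := is_derive1_compK D1 (is_derive_Logp A0).
  have [d d0 H] := is_derive_lipschitz D.
  exists (cabs (('D_1 n (Logp a) : C) * a^-1) + 1), d; split=> // w /H.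
  by rewrite /= na // subr0.
(* The radius [|a| / 2] keeps [expR (Re v)] between [|a| / 2] and [2 |a|], hence [|Re v| <= U]. A
   bounded kernel then satisfies the exponential bound at the cost of a factor [expR (e * U)]. *)
pose d' := Num.min d (cabs a / 2).
have ca : 0 < cabs a by rewrite cabs_gt0.
have d'0 : 0 < d' by rewrite lt_min d0 divr_gt0.
pose U := `|ln (cabs a / 2)| + `|ln (cabs a * 2)|.
pose K1 := `|L| * (cabs a * 2) * expR (e * U).
pose K2 := K * ((1 + cabs a + d') / d').
have bM v : 0 < Im v < pi -> cexp v != a -> cabs (kernelM v) <= (K1 + K2) * expR (- (e * `|Re v|)).
  move=> Iv va; have [far|near] := leP d' (cabs (cexp v - a)).
    apply: le_trans (kernelM_far d'0 Iv far) _; rewrite ler_wpM2r ?expR_ge0 //.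
    by rewrite lerDr !mulr_ge0 ?expR_ge0 // ltW.
  move: (near); rewrite lt_min => /andP[near1 near2].
  have q : 0 < cabs (cexp v - a) by rewrite cabs_gt0 subr_eq0.
  have eu : expR (Re v) <= cabs a * 2.
    by rewrite -cabs_cexp; have := ge_cabsB (cexp v) a; lra.
  have el : cabs a / 2 <= expR (Re v).
    by rewrite -cabs_cexp; have := ge_cabsB a (cexp v); rewrite cabs_distC; lra.
  have vU : `|Re v| <= U.
    have h1 : Re v <= ln (cabs a * 2) by rewrite -ler_expR lnK // posrE; lra.
    have h2 : ln (cabs a / 2) <= Re v by rewrite -ler_expR lnK // posrE; lra.
    have := ler_norm (ln (cabs a * 2)); have := ler_norm (- ln (cabs a / 2)).
    have := normr_ge0 (ln (cabs a * 2)); have := normr_ge0 (ln (cabs a / 2)).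
    by rewrite normrN /U ler_norml; lra.
  have B1 : cabs (kernelM v) <= `|L| * (cabs a * 2).
    rewrite /kernelM !cabsM cabsV cabs_cexp mulrCA mulrA -mulrA mulrC.
    rewrite ler_pM ?expR_ge0 ?divr_ge0 ?cabs_ge0 // ler_pdivrMr //.
    have := dL _ near1; rewrite cexp_Logp_strip // => /le_trans; apply.
    by rewrite ler_pM2r // ler_norm.
  apply: le_trans B1 _; rewrite mulrDl.
  have B2 : 1 <= expR (e * U) * expR (- (e * `|Re v|)).
    by rewrite -expRD -expR0 ler_expR subr_ge0 ler_pM2l.
  have B3 : 0 <= K2 * expR (- (e * `|Re v|)).
    by rewrite !mulr_ge0 ?expR_ge0 ?invr_ge0 ?(ltW d'0) //; lra.
  have B4 : `|L| * (cabs a * 2) <= K1 * expR (- (e * `|Re v|)).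
    by rewrite /K1 -mulrA ler_peMr // mulr_ge0 // mulr_ge0 // ltW.
  lra.
have neq v : 0 < Im v < pi -> v != Logp a -> cexp v != a.
  move=> Iv; apply: contra => /eqP E; apply/eqP.
  by rewrite -(cexp_Logp_strip Iv) E.
have ctm u : u != ln (cabs a) -> {for (u +i* Arg (a : R[i]) : C), continuous kernelM}.
  move=> uu; apply: kernelM_continuous; first exact: C1at_continuous (cn _).
  apply: neq => //; apply: contra uu => /eqP /(congr1 (@complex.Re R)) /= ->; exact: eqxx.
have neq' v : 0 < Im v < pi -> Im v != Arg (a : R[i]) -> cexp v != a.
  by move=> Iv H; apply: neq => //; apply: contra H => /eqP ->.
have /andP[Aa1 Aa2] := Aa.
have s1 v : 0 < Im v < Arg (a : R[i]) -> 0 < Im v < pi /\ Im v != Arg (a : R[i]).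
  by move=> /andP[h1 h2]; split; [lra | rewrite lt_eqF].
have s2 v : Arg (a : R[i]) < Im v < pi -> 0 < Im v < pi /\ Im v != Arg (a : R[i]).
  by move=> /andP[h1 h2]; split; [lra | rewrite gt_eqF].
have [||i1 _ e1] := strip_closed (M := kernelM) (l := 0) (h := Arg (a : R[i])) (K := K1 + K2) e01 _ _ Aa1 ct0 ctm.
- by move=> v /s1[Iv H]; apply: kernelM_C1; [exact: cn | exact: neq'].
- by move=> v /s1[Iv H]; apply: bM => //; exact: neq'.
have [||_ i2 e2] := strip_closed (M := kernelM) (l := Arg (a : R[i])) (h := pi) (K := K1 + K2) e01 _ _ Aa2 ctm ctpi.
- by move=> v /s2[Iv H]; apply: kernelM_C1; [exact: cn | exact: neq'].
- by move=> v /s2[Iv H]; apply: bM => //; exact: neq'.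
by split=> //; rewrite e1.
Qed.

End Contour.

(** * The Poisson integral over a half line *)

Section Boundary.
Context {R : realType}.
Notation mu := (@lebesgue_measure R).

Lemma integrable_lin3 (f1 f2 f3 : R -> R) (c1 c2 c3 : R) :
  mu.-integrable setT (EFin \o f1) -> mu.-integrable setT (EFin \o f2) ->
  mu.-integrable setT (EFin \o f3) ->
  mu.-integrable setT (EFin \o (fun u => c1 * f1 u + c2 * f2 u + c3 * f3 u)) /\
  \int[mu]_u (c1 * f1 u + c2 * f2 u + c3 * f3 u) =
    c1 * \int[mu]_u f1 u + c2 * \int[mu]_u f2 u + c3 * \int[mu]_u f3 u.
Proof.
move=> i1 i2 i3.
have Z (f : R -> R) c : mu.-integrable setT (EFin \o f) ->
    mu.-integrable setT (EFin \o (fun u => c * f u)).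
  move=> i; have -> : EFin \o (fun u => c * f u) = (fun u => c%:E * (EFin \o f) u)%E.
    by apply/funext => u; rewrite /= EFinM.
  exact: integrableZl.
have A (f h : R -> R) : mu.-integrable setT (EFin \o f) -> mu.-integrable setT (EFin \o h) ->
    mu.-integrable setT (EFin \o (fun u => f u + h u)).
  move=> i j; have -> : EFin \o (fun u => f u + h u) = ((EFin \o f) \+ (EFin \o h))%E.
    by apply/funext => u; rewrite /= EFinD.
  exact: integrableD.
have z1 := Z _ c1 i1; have z2 := Z _ c2 i2; have z3 := Z _ c3 i3.
split; first exact: (A _ _ (A _ _ z1 z2) z3).
rewrite RintegralD //; last exact: (A _ _ z1 z2).
by rewrite RintegralD // !RintegralZl.
Qed.

(** In [X = expR u] this is the integral of [1 / ((a - X)^2 + b^2)] over [X > 0], with primitive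
    [atan ((X - a) / b) / b]. The values for [a] and [- a] add up to [pi / b]. *)
Lemma poisson_half (a b : R) : 0 < b ->
  mu.-integrable setT (EFin \o (fun u : R => expR u / ((a - expR u) ^+ 2 + b ^+ 2))) /\
  \int[mu]_u (expR u / ((a - expR u) ^+ 2 + b ^+ 2)) = (pi / 2 + atan (a / b)) / b.
Proof.
move=> b0; pose f u : R := expR u / ((a - expR u) ^+ 2 + b ^+ 2).
have Q0 u : 0 < (a - expR u) ^+ 2 + b ^+ 2 by rewrite ltr_wpDl ?sqr_ge0 // exprn_gt0.
pose F u := atan ((expR u - a) / b) / b.
have dF (u : R) : is_derive u 1 F (f u).
  have d0 := is_deriveB (is_derive_expR u) (is_derive_cst a u 1).
  have d1 := is_deriveMK d0 (is_derive_cst b^-1 u 1).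
  pose G (w : R) := (expR w - a) / b.
  have d2 := @is_derive1_comp _ atan G u _ _ (is_derive1_atan (G u)) d1.
  have d3 := is_deriveMK d2 (is_derive_cst b^-1 u 1).
  apply: is_derive_eq d3 _; rewrite !mulr0 !add0r subr0 /f /G /=.
  have p : 0 < (expR u - a) ^+ 2 + b ^+ 2 by rewrite ltr_wpDl ?sqr_ge0 // exprn_gt0.
  have q : (a - expR u) ^+ 2 = (expR u - a) ^+ 2 by ring.
  rewrite q; field; rewrite !gt_eqF //=.
have cf (u : R) : {for u, continuous f}.
  have ce : {for u, continuous (fun x : R => a - expR x)}.
    by apply: (@cvgB R R^o _ (nbhs u)); [exact: cvg_cst | exact: continuous_expR].
  have cq : {for u, continuous (fun x : R => (a - expR x) * (a - expR x) + b ^+ 2)}.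
    apply: (@cvgD R R^o _ (nbhs u)); last exact: cvg_cst.
    exact: (@cvgM R _ (nbhs u) _ _ _ _ _ ce ce).
  apply: (@cvgM R _ (nbhs u)); first exact: continuous_expR.
  by apply: (@cvgV R _ (nbhs u)); [rewrite gt_eqF | exact: cq].
(* The constant of [cabs_sub_ge] at distance [b]: the denominator is at least
   [(c * (1 + expR u))^2], which gives the integrable majorant [c^-2 * expR (- |u|)]. *)
pose c := b / (1 + cabs (a +i* b) + b).
have z0 := cabs_ge0 (a +i* b).
have c0 : 0 < c by rewrite divr_gt0 //; lra.
have int : mu.-integrable setT (EFin \o f).
  have := integrable_expR_abs (@ltr01 R) => /(integrableZl measurableT (c ^- 2)).
  apply: le_integrable => //.
    by apply/measurable_EFinP; apply: (@measurable_fun_continuous_except _ _ 0) => u _; exact: cf.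
  move=> u _; rewrite /= lee_fin.
  have f0 : 0 <= f u by rewrite /f divr_ge0 ?expR_ge0 // ltW.
  have g0 : 0 <= c ^- 2 * expR (- (1 * `|u|)) by rewrite mulr_ge0 ?invr_ge0 ?sqr_ge0 ?expR_ge0.
  rewrite (ger0_norm f0) (ger0_norm g0).
  have H : c * (1 + expR u) <= cabs ((expR u)%:C - (a +i* b)).
    have := @cabs_sub_ge _ (expR u)%:C (a +i* b) b b0.
    rewrite cabs_real ger0_norm ?expR_ge0 //; apply.
    apply: le_trans (normr_Im_le _); rewrite cImD cImN /= sub0r normrN gtr0_norm //.
  have E := expR_gt0 u.
  have H2 : (c * (1 + expR u)) ^+ 2 <= (a - expR u) ^+ 2 + b ^+ 2.
    have -> : (a - expR u) ^+ 2 + b ^+ 2 = cabs ((expR u)%:C - (a +i* b)) ^+ 2.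
      rewrite sqr_cabs cReD cImD cReN cImN /=; ring.
    by rewrite ler_pXn2r // nnegrE ?cabs_ge0 // mulr_ge0 ?ltW //; lra.
  have H3 : expR u <= expR (- (1 * `|u|)) * (1 + expR u) ^+ 2.
    rewrite mul1r expRN mulrC ler_pdivlMr ?expR_gt0 //.
    case: (ger0P u) => u0.
      rewrite sqrrD expr1n mul1r -expr2 lerDr; lra.
    rewrite -expRD subrr expR0; nra.
  rewrite /f ler_pdivrMr //; apply: le_trans H3 _.
  rewrite [leRHS]mulrAC [leRHS]mulrC ler_pM2l ?expR_gt0 //.
  by rewrite ler_pdivlMl ?exprn_gt0 // -exprMn.
split=> //.
have cJ := Rintegral_truncate int.
have E n : \int[mu]_(u in `[- n.+1%:R, n.+1%:R]) f u = F n.+1%:R - F (- n.+1%:R).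
  by apply: FTC2_segment => //; rewrite gtrN.
move: cJ; under eq_fun do rewrite E.
move=> cJ; suff : F n.+1%:R - F (- n.+1%:R) @[n --> \oo] --> (pi / 2 + atan (a / b)) / b.
  by move=> cJ2; exact: cvg_unique cJ cJ2.
have -> : (pi / 2 + atan (a / b)) / b = pi / 2 / b - atan ((0 - a) / b) / b.
  by rewrite sub0r mulNr atanN mulNr opprK mulrDl.
have cn : (n.+1%:R : R) @[n --> \oo] --> +oo.
  apply/cvgryPge => A; near=> n.
  rewrite (le_trans (ltW (truncnS_gt A))) // ler_nat ltnS.
  by near: n; exact: nbhs_infty_ge.
apply: cvgB; apply: cvgM; try exact: cvg_cst.
  apply: (@cvg_comp _ _ _ (fun n : nat => (expR n.+1%:R - a) / b) _ _ +oo); last exact: cvgy_atan.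
  apply/cvgryPge => A; near=> n.
  rewrite ler_pdivlMr // lerBrDr (le_trans _ (expR_ge1Dx _)) // -lerBlDl.
  by near: n; move/cvgryPge: cn; apply.
apply: (@cvg_comp _ _ _ (fun n : nat => (expR (- n.+1%:R) - a) / b)); last exact: continuous_atan.
apply: cvgM; last exact: cvg_cst.
apply: cvgB; last exact: cvg_cst.
by have := cvg_expR_natN (@ltr01 R); under eq_fun do rewrite mul1r.
Unshelve. all: by end_near. Qed.

End Boundary.

(** * Cauchy integrals of boundary values *)

Section CauchyBoundary.
Context {R : realType}.
Local Notation C := (R[i]^o).
Notation mu := (@lebesgue_measure R).

Variables (g : C -> C) (u1 e K : R).
Hypothesis e01 : 0 < e <= 1.
Hypothesis cg : forall v, 0 < Im v < pi -> C1at g v.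
Hypothesis bg : forall v, 0 < Im v < pi ->
  cabs (g v) <= K * expR (- (e * `|Re v|)) * (1 + expR (- Re v)).
Hypothesis g0 : forall u, u != u1 -> {for (u +i* 0 : C), continuous g}.
Hypothesis gpi : forall u, u != u1 -> {for (u +i* pi : C), continuous g}.

(* On the boundary the residue [G] at [z] enters through [M2], whose correction term makes the
   numerator vanish at [z], so that both kernels have contour integral zero; only the Poisson
   term [b X / Q] remains. *)
Lemma boundary_kernels (gam G : R[i]) (a b X : R) : 0 < b ->
  let zc : R[i] := a -i* b in let z : R[i] := a +i* b in
  let M1 := gam * (X%:C * (X%:C - zc)^-1) in
  let M2 := (gam - G * (0 +i* (b *+ 2)) * (X%:C - zc)^-1) * (X%:C * (X%:C - z)^-1) in
  let Q := (a - X) ^+ 2 + b ^+ 2 in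
  Im gam * (X * (X - a) / Q) = 2^-1 * Im M2 + 2^-1 * Im M1 + b * Re G * (X / Q) /\
  Im gam * (X * b / Q) = - 2^-1 * Re M2 + 2^-1 * Re M1 + b * Im G * (X / Q).
Proof.
move=> b0 /=; have Q0 : (a - X) ^+ 2 + b ^+ 2 != 0.
  by rewrite gt_eqF // ltr_wpDl ?sqr_ge0 // exprn_gt0.
have zi (y : R) : y ^+ 2 = b ^+ 2 -> (X%:C - (a +i* y))^-1 =
    ((X - a) / ((a - X) ^+ 2 + b ^+ 2)) +i* (y / ((a - X) ^+ 2 + b ^+ 2)) :> R[i].
  move=> yb; apply: complex_ext; rewrite !reim /= sub0r ?opprK sqrrN yb;
    have -> : (X - a) ^+ 2 = (a - X) ^+ 2 by ring.
  - by [].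
  - by [].
rewrite (zi b) // (zi (- b)) ?sqrrN //; case: gam G => s t [p q] /=.
by split; field.
Qed.

(** Since [Re (- i w) = Im w], the real statement is applied to [- i n], which satisfies the same
    hypotheses. *)
Lemma contour_Im (n : C -> C) (K' : R) (a : C) :
  (forall v, 0 < Im v < pi -> C1at n v) ->
  (forall v, 0 < Im v < pi ->
    cabs (n v) <= K' * expR (- (e * `|Re v|)) * (1 + expR (- Re v))) ->
  (forall u, u != u1 -> {for (u +i* 0 : C), continuous n}) ->
  (forall u, u != u1 -> {for (u +i* pi : C), continuous n}) ->
  Im a != 0 -> (0 < Im a -> n (Logp a) = 0) ->
  [/\ mu.-integrable setT (EFin \o (fun u : R => Im (kernelM n a (u +i* 0)))),
      mu.-integrable setT (EFin \o (fun u : R => Im (kernelM n a (u +i* pi)))) &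
      \int[mu]_u Im (kernelM n a (u +i* 0)) = \int[mu]_u Im (kernelM n a (u +i* pi))].
Proof.
have /andP[e0 _] := e01.
move=> cn bn n0 npi a0 na; pose n' (v : C) : C := (0 -i* 1) * n v.
have E v : Re (kernelM n' a v) = Im (kernelM n a v).
  by rewrite /kernelM /n' -mulrA cReM /=; ring.
have ct v : {for v, continuous n} -> {for v, continuous n'}.
  exact: (@cvgM R[i] _ (nbhs v) _ (cst (0 -i* 1)) n _ (n v) (@cvg_cst C _ _ _ _)).
have [|||||i1 i2 i3] := @contour_Re R n' u1 e K' a e0 _ _ _ _ a0 _.
- move=> v /cn cv.
  exact: (@C1atM R[i] (cst (0 -i* 1)) n v (C1at_cst _ _) cv).
- move=> v /bn; rewrite /n' cabsM.
  have -> : cabs (0 -i* 1 : R[i]) = 1 by rewrite /cabs /= expr0n /= add0r sqrrN expr1n sqrtr1.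
  by rewrite mul1r.
- by move=> u /n0 /ct.
- by move=> u /npi /ct.
- by move=> /na; rewrite /n' => ->; rewrite mulr0.
have F y : (fun u : R => Re (kernelM n' a (u +i* y))) = (fun u : R => Im (kernelM n a (u +i* y))).
  by apply/funext => u; rewrite E.
by move: i1 i2 i3; rewrite !F.
Qed.

Section Point.
Variable z : R[i].
Hypothesis z0 : 0 < Im z.
Let a := Re z.
Let b := Im z.
Let G0 : R[i] := g (Logp z).
Let zc : C := a -i* b.
(** At [cexp v = z] the denominator [cexp v - zc] equals [2 i b]; this constant makes the correction
    in [n2] equal to [G0] there. *)
Let kap : C := G0 * (0 +i* (b *+ 2)).
Let n2 (v : C) : C := g v - kap * (cexp v - zc)^-1.

Let zNpos : ~ on_nonpos_axis z.
Proof. by move=> [h _]; move: z0; rewrite h ltxx. Qed.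

Let Argz : 0 < Arg z < pi.
Proof.
have /andP[A1 A2] := Arg_lt zNpos; rewrite A2 andbT ltNge; apply/negP => A3.
have zn0 := neq0_on_nonpos_axis zNpos.
have : Im (cexp (Logp z)) <= 0.
  rewrite /= pmulr_rle0 ?expR_gt0 // -oppr_ge0 -sinN sin_ge0_pi //; lra.
by rewrite LogpK // leNgt z0.
Qed.

Let zcN (v : C) : 0 <= Im v <= pi -> b <= cabs (cexp v - zc).
Proof.
move=> Iv; have : 0 <= Im (cexp v) by rewrite /= mulr_ge0 ?expR_ge0 ?sin_ge0_pi.
move=> H; apply: le_trans (normr_Im_le _).
by rewrite cImD cImN /= opprK (le_trans _ (ler_norm _)) // lerDr.
Qed.

Let zcneq (v : C) : 0 <= Im v <= pi -> cexp v - zc != 0.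
Proof. by move=> /zcN H; rewrite -cabs_gt0 (lt_le_trans z0). Qed.

Let kC1 (v : C) : 0 <= Im v <= pi -> C1at (fun v : C => - (kap * (cexp v - zc)^-1) : C) v.
Proof.
move=> /zcneq H.
have c1 := @C1atD R[i] (@cexp R) (cst (- zc)) v (C1at_cexp v) (C1at_cst _ _).
have c2 := @C1atV R[i] (fun v => cexp v - zc) v H c1.
have c3 := @C1atM R[i] (cst kap) (fun v => (cexp v - zc)^-1) v (C1at_cst _ _) c2.
exact: (@C1atN R[i] (fun v => kap * (cexp v - zc)^-1) v c3).
Qed.

Let n2C1 (v : C) : 0 < Im v < pi -> C1at n2 v.
Proof.
move=> Iv; have c1 : C1at (fun v : C => - (kap * (cexp v - zc)^-1) : C) v.
  by apply: kC1; case/andP: Iv => /ltW -> /ltW ->.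
exact: (@C1atD R[i] g (fun v => - (kap * (cexp v - zc)^-1)) v (cg Iv) c1).
Qed.

Let n2ct (v : C) : 0 <= Im v <= pi -> {for v, continuous g} -> {for v, continuous n2}.
Proof.
move=> Iv cv; have c1 := C1at_continuous (kC1 Iv).
exact: (@cvgD R[i] C _ (nbhs v) _ g (fun v => - (kap * (cexp v - zc)^-1)) _ _ cv c1).
Qed.

Let n2z : n2 (Logp z) = 0.
Proof.
have zn0 := neq0_on_nonpos_axis zNpos.
have e1 : cexp (Logp z) - zc = 0 +i* (b *+ 2).
  rewrite LogpK // /zc /a /b; case: (z) => x y; apply: complex_ext => /=; ring.
have e2 : (0 +i* (b *+ 2) : R[i]) != 0.
  by rewrite -e1; apply: zcneq; rewrite Im_Logp; case/andP: Argz => /ltW -> /ltW ->.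
by rewrite /n2 e1 /kap mulfK // subrr.
Qed.

Let n2b : exists K2 : R, forall v : C, 0 < Im v < pi ->
    cabs (n2 v) <= K2 * expR (- (e * `|Re v|)) * (1 + expR (- Re v)).
Proof.
have /andP[e0 e1] := e01.
pose c := b / (1 + cabs zc + b); have ca := cabs_ge0 zc; have ck := cabs_ge0 kap.
have b0 : 0 < b by [].
have c0 : 0 < c by rewrite divr_gt0 //; lra.
exists (K + cabs kap / c) => v Iv; rewrite -mulrA mulrDl.
have Iv' : 0 <= Im v <= pi by case/andP: Iv => /ltW -> /ltW ->.
apply: le_trans (cabsB _ _) _; rewrite lerD //; first by rewrite mulrA; exact: bg.
rewrite cabsM cabsV -mulrA ler_wpM2l //.
have H := cabs_sub_ge z0 (zcN Iv'); rewrite cabs_cexp -/b -/c in H.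
have E := expR_gt0 (Re v).
have q : 0 < c * (1 + expR (Re v)) by rewrite mulr_gt0 //; lra.
apply: le_trans (_ : (c * (1 + expR (Re v)))^-1 <= _).
  by rewrite lef_pV2 // posrE (lt_le_trans q).
rewrite invfM ler_pM2l ?invr_gt0 //.
set x := Re v in E q H *; pose F := expR (e * `|x|).
have F0 : 0 < F by exact: expR_gt0.
(* This puts the correction, of order [1 / (1 + expR x)], into the growth class of [g]. Both signs
   of [x] use [e <= 1]. *)
have H3 : expR x * F <= (1 + expR x) ^+ 2.
  rewrite /F; case: (ger0P x) => x0.
    have : expR (e * x) <= expR x by rewrite ler_expR ler_piMl.
    rewrite -(ler_pM2l E); nra.
  have : expR x * expR (e * - x) <= 1.
    by rewrite -expRD -expR0 ler_expR mulrN -subr_ge0; nra.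
  nra.
rewrite expRN -/F (expRN x) -div1r ler_pdivrMr; last by lra.
have -> : F^-1 * (1 + (expR x)^-1) * (1 + expR x) = (1 + expR x) ^+ 2 / (expR x * F).
  by field; rewrite !gt_eqF.
by rewrite ler_pdivlMr ?mulr_gt0 // mul1r.
Qed.

(* The density [- Im G / pi] of the measure at [e^(u + i y)], with respect to [du]. *)
Definition density (y u : R) : R := - (Im (g (u +i* y)) * expR u / pi).
(** [cauchy_re] and [cauchy_im] are the real and imaginary parts of [(z - X)^-1]. *)
Definition cauchy_re (X : R) := (Re z - X) / ((Re z - X) ^+ 2 + Im z ^+ 2).
Definition cauchy_im (X : R) := - Im z / ((Re z - X) ^+ 2 + Im z ^+ 2).

(** On the upper side [X = - expR u], so the contour integrals enter with the opposite sign and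
    cancel those of the lower side. The Poisson terms remain; their sum [pi / b] cancels the factor
    [b / pi] in front of [G0]. *)
Lemma cauchy_boundary :
  [/\ mu.-integrable setT (EFin \o (fun u => density 0 u * cauchy_re (expR u))),
      mu.-integrable setT (EFin \o (fun u => density pi u * cauchy_re (- expR u))) &
      \int[mu]_u (density 0 u * cauchy_re (expR u)) +
      \int[mu]_u (density pi u * cauchy_re (- expR u)) = Re G0] /\
  [/\ mu.-integrable setT (EFin \o (fun u => density 0 u * cauchy_im (expR u))),
      mu.-integrable setT (EFin \o (fun u => density pi u * cauchy_im (- expR u))) &
      \int[mu]_u (density 0 u * cauchy_im (expR u)) +
      \int[mu]_u (density pi u * cauchy_im (- expR u)) = Im G0].
Proof.
have /andP[e0 _] := e01; have b0 : 0 < b := z0; have pi0 := @pi_gt0 R.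
have zcn : Im zc != 0 by rewrite /zc /= oppr_eq0 gt_eqF.
have zcf : 0 < Im zc -> g (Logp zc) = 0 by rewrite /zc /= oppr_gt0 ltNge (ltW b0).
have zn : Im (z : C) != 0 by rewrite gt_eqF.
have [K2 b2] := n2b.
have c0 u : u != u1 -> {for (u +i* 0 : C), continuous n2}.
  by move=> /g0 c; apply: n2ct => //=; rewrite lexx ltW.
have cpi u : u != u1 -> {for (u +i* pi : C), continuous n2}.
  by move=> /gpi c; apply: n2ct => //=; rewrite lexx ltW.
have [r1 r1' R1] := contour_Re e0 cg bg g0 gpi zcn zcf.
have [i1 i1' I1] := contour_Im cg bg g0 gpi zcn zcf.
have [r2 r2' R2] := contour_Re e0 n2C1 b2 c0 cpi zn (fun=> n2z).
have [i2 i2' I2] := contour_Im n2C1 b2 c0 cpi zn (fun=> n2z).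
have [p0 P0] := poisson_half a b0; have [pp PP] := poisson_half (- a) b0.
have X0 u : cexp (u +i* 0) = (expR u)%:C :> R[i] by exact: cexp_real.
have Xpi u : cexp (u +i* pi) = (- expR u)%:C :> R[i].
  by apply: complex_ext; rewrite /= ?cospi ?sinpi; ring.
have BK := boundary_kernels _ G0 a _ b0.
have zE : z = a +i* b by rewrite /a /b; case: (z).
have BKy y (X u : R) : cexp (u +i* y) = X%:C :> R[i] ->
    Im (g (u +i* y)) * (X * (X - a) / ((a - X) ^+ 2 + b ^+ 2)) =
      2^-1 * Im (kernelM n2 z (u +i* y)) + 2^-1 * Im (kernelM g zc (u +i* y))
        + b * Re G0 * (X / ((a - X) ^+ 2 + b ^+ 2)) /\
    Im (g (u +i* y)) * (X * b / ((a - X) ^+ 2 + b ^+ 2)) =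
      - 2^-1 * Re (kernelM n2 z (u +i* y)) + 2^-1 * Re (kernelM g zc (u +i* y))
        + b * Im G0 * (X / ((a - X) ^+ 2 + b ^+ 2)).
  move=> XE; have := BK (g (u +i* y)) X; rewrite /= -zE => H.
  by rewrite /kernelM /n2 XE; exact: H.
have Er0 u : density 0 u * cauchy_re (expR u) = (2^-1 / pi) * Im (kernelM n2 z (u +i* 0))
   + (2^-1 / pi) * Im (kernelM g zc (u +i* 0))
   + (b * Re G0 / pi) * (expR u / ((a - expR u) ^+ 2 + b ^+ 2)).
  have [H _] := BKy _ _ _ (X0 u); rewrite /density /cauchy_re -/a -/b.
  move: H; set Q := _ + b ^+ 2; set m2 := Im (kernelM _ _ _); set m1 := Im (kernelM _ _ _).
  move=> H; transitivity (pi^-1 * (Im (g (u +i* 0)) * (expR u * (expR u - a) / Q))); first ring.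
  rewrite H; ring.
have Erpi u : density pi u * cauchy_re (- expR u) = (- 2^-1 / pi) * Im (kernelM n2 z (u +i* pi))
   + (- 2^-1 / pi) * Im (kernelM g zc (u +i* pi))
   + (b * Re G0 / pi) * (expR u / ((- a - expR u) ^+ 2 + b ^+ 2)).
  have [H _] := BKy _ _ _ (Xpi u); rewrite /density /cauchy_re -/a -/b.
  have -> : (- a - expR u) ^+ 2 = (a - - expR u) ^+ 2 by ring.
  move: H; set Q := _ + b ^+ 2; set m2 := Im (kernelM _ _ _); set m1 := Im (kernelM _ _ _).
  move=> H; transitivity (- pi^-1 * (Im (g (u +i* pi)) * (- expR u * (- expR u - a) / Q))).
    ring.
  rewrite H; ring.
have Ei0 u : density 0 u * cauchy_im (expR u) = (- 2^-1 / pi) * Re (kernelM n2 z (u +i* 0))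
   + (2^-1 / pi) * Re (kernelM g zc (u +i* 0))
   + (b * Im G0 / pi) * (expR u / ((a - expR u) ^+ 2 + b ^+ 2)).
  have [_ H] := BKy _ _ _ (X0 u); rewrite /density /cauchy_im -/a -/b.
  move: H; set Q := _ + b ^+ 2; set m2 := Re (kernelM _ _ _); set m1 := Re (kernelM _ _ _).
  move=> H; transitivity (pi^-1 * (Im (g (u +i* 0)) * (expR u * b / Q))); first ring.
  rewrite H; ring.
have Eipi u : density pi u * cauchy_im (- expR u) = (2^-1 / pi) * Re (kernelM n2 z (u +i* pi))
   + (- 2^-1 / pi) * Re (kernelM g zc (u +i* pi))
   + (b * Im G0 / pi) * (expR u / ((- a - expR u) ^+ 2 + b ^+ 2)).
  have [_ H] := BKy _ _ _ (Xpi u); rewrite /density /cauchy_im -/a -/b.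
  have -> : (- a - expR u) ^+ 2 = (a - - expR u) ^+ 2 by ring.
  move: H; set Q := _ + b ^+ 2; set m2 := Re (kernelM _ _ _); set m1 := Re (kernelM _ _ _).
  move=> H; transitivity (- pi^-1 * (Im (g (u +i* pi)) * (- expR u * b / Q))).
    ring.
  rewrite H; ring.
have pib : pi / b = (pi / 2 + atan (a / b)) / b + (pi / 2 + atan (- a / b)) / b.
  by rewrite mulNr atanN; field; rewrite gt_eqF.
have [A1 B1] := integrable_lin3 (2^-1 / pi) (2^-1 / pi) (b * Re G0 / pi) i2 i1 p0.
have [A2 B2] := integrable_lin3 (- 2^-1 / pi) (- 2^-1 / pi) (b * Re G0 / pi) i2' i1' pp.
have [A3 B3] := integrable_lin3 (- 2^-1 / pi) (2^-1 / pi) (b * Im G0 / pi) r2 r1 p0.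
have [A4 B4] := integrable_lin3 (2^-1 / pi) (- 2^-1 / pi) (b * Im G0 / pi) r2' r1' pp.
have F1 := funext Er0; have F2 := funext Erpi; have F3 := funext Ei0; have F4 := funext Eipi.
rewrite F1 F2 F3 F4 B1 B2 B3 B4 P0 PP R1 R2 I1 I2.
split; split=> //.
- transitivity (b * Re G0 / pi * (pi / b)); first by rewrite pib; ring.
  transitivity (Re G0 * (b / b) * (pi / pi)); first ring.
  by rewrite !divff ?mulr1 ?(gt_eqF b0) ?(gt_eqF pi0).
- transitivity (b * Im G0 / pi * (pi / b)); first by rewrite pib; ring.
  transitivity (Im G0 * (b / b) * (pi / pi)); first ring.
  by rewrite !divff ?mulr1 ?(gt_eqF b0) ?(gt_eqF pi0).
Qed.

End Point.
End CauchyBoundary.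

(** * Measures from densities on two rays *)

(** An alias to which the probability structure can be attached once the mass is known. *)
Definition unit_mass d (T : measurableType d) (R : realType)
  (m : {measure set T -> \bar R}) (m1 : m setT = 1%E) : set T -> \bar R := m.

Section UnitMass.
Context d (T : measurableType d) (R : realType).
Variables (m : {measure set T -> \bar R}) (m1 : m setT = 1%E).
HB.instance Definition _ := Measure.copy (unit_mass m1) m.
HB.instance Definition _ := Measure_isProbability.Build _ _ _ (unit_mass m1) m1.
End UnitMass.

Section DensityMeasure.
Context {R : realType}.
Notation mu := (@lebesgue_measure R).
Local Notation T := (measurableTypeR R).

(** Nonnegativity and integrability travel with the name, so that the finite measure structure can
    be attached to it. *)
Definition density_measure (h : R -> R) (h0 : forall u, 0 <= h u)
  (ih : mu.-integrable setT (EFin \o h)) (A : set T) : \bar R :=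
  \int[mu]_(u in A) (h u)%:E.

Section Fixed.
Variables (h : R -> R) (h0 : forall u, 0 <= h u) (ih : mu.-integrable setT (EFin \o h)).
Local Notation nu := (density_measure h0 ih).

Let mh : measurable_fun [set: T] (EFin \o h). Proof. exact: measurable_int ih. Qed.

Let nu0 : nu set0 = 0%E. Proof. by rewrite /density_measure integral_set0. Qed.

Let nu_ge0 A : (0 <= nu A)%E.
Proof. by apply: integral_ge0 => u _; rewrite lee_fin. Qed.

Let nu_sigma : semi_sigma_additive nu.
Proof. by apply: semi_sigma_additive_nng_induced => // u; rewrite lee_fin. Qed.

HB.instance Definition _ := isMeasure.Build _ _ _ nu nu0 nu_ge0 nu_sigma.

Let nu_fin : fin_num_fun nu.
Proof.
by move=> A mA; apply: integrable_fin_num => //; exact: integrableS ih.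
Qed.

HB.instance Definition _ := Measure_isFinite.Build _ _ _ nu nu_fin.

Lemma density_measure_dom : nu `<< mu.
Proof.
apply/null_content_dominatesP => A mA A0.
by apply: null_set_integral => //; exact: measurable_funS mh.
Qed.

(** The Radon-Nikodym derivative of [nu] and [h] have the same integral over every measurable set,
    hence agree almost everywhere; the change of variables formula then applies. *)
Lemma integral_density_measure (f : R -> R) (B : R) :
  measurable_fun [set: T] f -> (forall u, `|f u| <= B) ->
  nu.-integrable setT (EFin \o f) /\
  (\int[nu]_u (f u)%:E = \int[mu]_u (f u * h u)%:E)%E.
Proof.
move=> mf fB.
have intf : nu.-integrable setT (EFin \o f).
  apply: measurable_bounded_integrable => //.
    by rewrite ltey_eq nu_fin.
  exists B; split; first exact: num_real.
  by move=> x Bx u _; apply: le_trans (fB u) (ltW Bx).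
split=> //.
rewrite -(Radon_Nikodym_change_of_variables density_measure_dom) //.
under [RHS]eq_integral do rewrite EFinM.
apply: ae_eq_integral => //.
- apply: emeasurable_funM; first exact/measurable_EFinP.
  by apply: (measurable_int mu); apply: Radon_Nikodym_integrable; exact: density_measure_dom.
- by apply: emeasurable_funM => //; exact/measurable_EFinP.
- apply: ae_eqe_mul2l => /=.
  rewrite Radon_NikodymE//=; first exact: density_measure_dom.
  move=> ?; case: cid => /= k [k1 k2 k3].
  apply: integral_ae_eq => //=.
  by move=> E _ mE; rewrite -k3.
Qed.

End Fixed.

(** The measure is the sum of the images of [h du] under [expR] and of [k du] under [- expR], living
    on the positive and the negative half line. *)
Lemma two_ray_probability (h k : R -> R) :
  (forall u, 0 <= h u) -> (forall u, 0 <= k u) ->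
  mu.-integrable setT (EFin \o h) -> mu.-integrable setT (EFin \o k) ->
  (\int[mu]_u (h u)%:E + \int[mu]_u (k u)%:E = 1)%E ->
  exists P : probability R R, forall (f : R -> R) (B : R),
    measurable_fun [set: R] f -> (forall x, `|f x| <= B) ->
    (\int[P]_x (f x)%:E =
     \int[mu]_u (f (expR u) * h u)%:E + \int[mu]_u (f (- expR u) * k u)%:E)%E.
Proof.
move=> h0 k0 ih ik hk.
have m1 : measurable_fun [set: T] (fun u : T => expR u : R) by exact: measurable_expR.
have m2 : measurable_fun [set: T] (fun u : T => - expR u : R).
  by apply: measurableT_comp => //; exact: measurable_expR.
pose nu1 : {finite_measure set T -> \bar R} := density_measure h0 ih.
pose nu2 : {finite_measure set T -> \bar R} := density_measure k0 ik.
pose phi1 (u : T) : R := expR u.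
pose phi2 (u : T) : R := - expR u.
unshelve epose (p1 := (pushforward nu1 phi1 : {measure set R -> \bar R})); first exact: m1.
unshelve epose (p2 := (pushforward nu2 phi2 : {measure set R -> \bar R})); first exact: m2.
pose m : {measure set R -> \bar R} := measure_add p1 p2.
have mT : m setT = 1%E.
  transitivity (p1 setT + p2 setT)%E; first exact: measure_addE.
  by rewrite -hk /p1 /p2 /= /pushforward !preimage_setT.
pose P : probability R R := unit_mass mT.
exists P => f B mf fB.
have mf1 : measurable_fun [set: T] (f \o phi1) by exact: measurableT_comp.
have mf2 : measurable_fun [set: T] (f \o phi2) by exact: measurableT_comp.
have [i1 e1] := @integral_density_measure h h0 ih (f \o phi1) B mf1 (fun u => fB _).
have [i2 e2] := @integral_density_measure k k0 ik (f \o phi2) B mf2 (fun u => fB _).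
have mfE : measurable_fun [set: R] (EFin \o f) by exact/measurable_EFinP.
have j1 : p1.-integrable setT (EFin \o f).
  by apply: (integrable_pushforward m1 mfE i1).
have j2 : p2.-integrable setT (EFin \o f).
  by apply: (integrable_pushforward m2 mfE i2).
transitivity (\int[m]_x (f x)%:E)%E; first by [].
transitivity (\int[p1]_x (f x)%:E + \int[p2]_x (f x)%:E)%E; first exact: integral_measure_add.
congr (_ + _)%E.
  transitivity (\int[nu1]_u (f (phi1 u))%:E)%E => //.
  exact: (integral_pushforward m1 mfE i1).
transitivity (\int[nu2]_u (f (phi2 u))%:E)%E => //.
exact: (integral_pushforward m2 mfE i2).
Qed.

End DensityMeasure.

(** * The argument of a power quotient *)

Section Key.
Context {R : realType}.

(** The difference vanishes at [0] and has derivative [p (cos (p x) - cos x)], nonnegative because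
    [cos] decreases on [[0, pi]]. *)
Lemma sin_ge_scale (p b : R) : 0 <= p <= 1 -> 0 <= b <= pi -> p * sin b <= sin (p * b).
Proof.
move=> /andP[p0 p1] /andP[b0 bpi].
pose f x := sin (p * x) - p * sin x.
have df (x : R) : is_derive x 1 f (p * cos (p * x) - p * cos x).
  have d1 : is_derive x 1 (fun x => p * x) p.
    apply: is_derive_eq (is_deriveMK (is_derive_cst p x 1) (is_derive_id x 1)) _.
    by rewrite /= mulr1 mulr0 addr0.
  have d2 := @is_derive1_comp _ sin (fun x => p * x) x _ _ (is_derive_sin (p * x)) d1.
  have d3 := is_deriveMK (is_derive_cst p x 1) (is_derive_sin x).
  apply: is_derive_eq (is_deriveB d2 d3) _.
  by rewrite /= mulr0 addr0 mulrC.
have cf : {within `[0, b], continuous f}.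
  apply: continuous_in_subspaceT => x _; exact: is_derive_continuous (df x).
have [c] := MVT_segment b0 (fun x _ => df x) cf.
rewrite in_itv /= => /andP[c0 cb]; rewrite /f mulr0 sin0 mulr0 !subr0 => E.
rewrite -subr_ge0 E mulr_ge0 // -mulrBr mulr_ge0 // subr_ge0.
have pc : p * c <= c by rewrite ler_piMl.
have cI : c \in `[0, pi]%R by rewrite in_itv /= c0 (le_trans cb).
have pcI : p * c \in `[0, pi]%R by rewrite in_itv /= mulr_ge0 // (le_trans pc) // (le_trans cb).
by rewrite leNgt (ltr_cos cI pcI) -leNgt.
Qed.

(* With [l = x - i b = log (1 - t)], the first conclusion amounts to
   [e^((p-1) x) sin (p b) + e^(p x) sin ((1-p) b) >= sin b]. *)
Lemma power_quotient_arg (p x b : R) : 0 < p <= 1 -> 0 <= b <= pi -> p * b < pi ->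
  ~ (x = 0 /\ b = 0) ->
  let t := 1 - cexp (x -i* b) in let q := 1 - cexp (p%:C * (x -i* b)) in
  [/\ 0 <= Im (q * t^*%C), 0 <= Im q, 0 < b -> 0 < Im q & ~ on_nonpos_axis (q / t)].
Proof.
move=> /andP[p0 p1] /andP[b0 bpi] pb nxb t q.
have pb0 : 0 <= p * b by rewrite mulr_ge0 // ltW.
have tE : t = (1 - expR x * cos b) +i* (expR x * sin b).
  by apply: complex_ext; rewrite /t !reim /= ?cosN ?sinN; ring.
have qE : q = (1 - expR (p * x) * cos (p * b)) +i* (expR (p * x) * sin (p * b)).
  have pl : p%:C * (x -i* b) = (p * x) -i* (p * b).
    by apply: complex_ext; rewrite !reim /=; ring.
  by apply: complex_ext; rewrite /q pl !reim /= ?cosN ?sinN; ring.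
have sb : 0 <= sin b by rewrite sin_ge0_pi ?b0.
have sp : p * sin b <= sin (p * b) by apply: sin_ge_scale; rewrite ?b0 ?(ltW p0).
have sq : (1 - p) * sin b <= sin ((1 - p) * b) by apply: sin_ge_scale; rewrite ?b0 //; lra.
have q0 : 0 <= Im q by rewrite qE /= mulr_ge0 ?expR_ge0 // sin_ge0_pi // pb0 ltW.
have q1 : 0 < b -> 0 < Im q.
  by move=> b1; rewrite qE /= mulr_gt0 ?expR_gt0 // sin_gt0_pi // mulr_gt0.
split => //.
  have E1 := expR_ge1Dx ((p - 1) * x); have E2 := expR_ge1Dx (p * x).
  have E3 : expR (p * x) = expR x * expR ((p - 1) * x) by rewrite -expRD; congr expR; ring.
  have S : sin ((1 - p) * b) = sin b * cos (p * b) - cos b * sin (p * b).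
    by rewrite -sinB; congr sin; ring.
  have -> : Im (q * t^*%C) = expR x * (expR ((p - 1) * x) * sin (p * b)
      + expR (p * x) * sin ((1 - p) * b) - sin b).
    rewrite S qE tE /= E3; ring.
  rewrite mulr_ge0 ?expR_ge0 // subr_ge0.
  have F1 := ler_wpM2l (expR_ge0 ((p - 1) * x)) sp.
  have F2 := ler_wpM2l (expR_ge0 (p * x)) sq.
  apply: le_trans (lerD F1 F2).
  (* Weighting the two bounds [1 + y <= e^y] by [p] and [1 - p] cancels the terms linear in [x]. *)
  have F3 : 1 <= expR ((p - 1) * x) * p + expR (p * x) * (1 - p).
    have G1 := ler_wpM2r (ltW p0) E1.
    have G2 : (1 + p * x) * (1 - p) <= expR (p * x) * (1 - p) by rewrite ler_wpM2r // subr_ge0.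
    lra.
  by rewrite !mulrA -mulrDl ler_peMl.
case: (ltrP 0 b) => [b1|b1].
  have qp := q1 b1; have ti : 0 <= Im t by rewrite tE /= mulr_ge0 ?expR_ge0.
  have tn : t != 0.
    apply/eqP => /(congr1 (fun z : R[i] => (Re z, Im z))); rewrite tE /= => -[h1 h2].
    have E := expR_gt0 x.
    have s0 : sin b = 0 by move/eqP: h2; rewrite mulf_eq0 gt_eqF //= => /eqP.
    have c1 : cos b = 1.
      have := cos2Dsin2 b; rewrite s0 expr0n addr0 => /eqP; rewrite sqrf_eq1.
      case/orP => /eqP // cN; move: h1; rewrite cN; lra.
    suff : b = 0 by move=> b00; rewrite b00 ltxx in b1.
    by apply: cos_inj; rewrite ?in_itv /= ?lexx ?b0 ?bpi ?pi_ge0 // cos0.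
  (* A nonpositive real multiple of [t], which has [Im t >= 0], cannot be [q], which has
     [Im q > 0]. *)
  move=> [h1 h2]; have : Im (q / t * t) <= 0.
    by rewrite cImM h1 mul0r addr0 mulr_le0_ge0.
  by rewrite divfK // leNgt qp.
have be : b = 0 by apply/eqP; rewrite eq_le b1 b0.
have x0 : x != 0 by apply/eqP => x0; apply: nxb.
move=> [_]; rewrite leNgt => /negP; apply.
have -> : Re (q / t) = (1 - expR (p * x)) / (1 - expR x).
  rewrite qE tE be mulr0 !cos0 !sin0 !mulr1 !mulr0 cReM cReV cImV /= expr0n addr0 !mul0r subr0.
  have : 1 - expR x != 0 by rewrite subr_eq0 -expR0 eq_sym (inj_eq (@expR_inj R)).
  by move=> H; field.
case: (ltgtP x 0) x0 => // x0 _.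
  by rewrite divr_gt0 ?subr_gt0 ?expR_lt1 // pmulr_rlt0.
by rewrite nmulr_rgt0 ?invr_lt0 subr_lt0 expR_gt1 // mulr_gt0.
Qed.

End Key.

(** * A continuous logarithm of [1 - e^tau] *)

Section Branch.
Context {R : realType}.

Lemma Re_gt0_off_cut (w : R[i]) : 0 < Re w -> ~ on_nonpos_axis w.
Proof. by move=> H [_]; rewrite leNgt H. Qed.

Lemma Im_neq0_off_cut (w : R[i]) : Im w != 0 -> ~ on_nonpos_axis w.
Proof. by move=> H [e _]; rewrite e eqxx in H. Qed.

Lemma Im_polar (w : R[i]) : w != 0 -> Im w = cabs w * sin (Arg w).
Proof.
by move=> w0; rewrite -{1}(LogpK w0) /= lnK // posrE cabs_gt0.
Qed.

Lemma Arg_le0 (w : R[i]) : ~ on_nonpos_axis w -> Im w <= 0 -> Arg w <= 0.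
Proof.
move=> H; have w0 := neq0_on_nonpos_axis H; have /andP[_ A] := Arg_lt H.
apply: contraTT; rewrite -!ltNge => A0.
by rewrite (Im_polar w0) mulr_gt0 ?cabs_gt0 // sin_gt0_pi // A0.
Qed.

Lemma Arg_ge0 (w : R[i]) : ~ on_nonpos_axis w -> 0 <= Im w -> 0 <= Arg w.
Proof.
move=> H; have w0 := neq0_on_nonpos_axis H; have /andP[A _] := Arg_lt H.
apply: contraTT; rewrite -!ltNge => A0.
rewrite (Im_polar w0) pmulr_rlt0 ?cabs_gt0 // -oppr_gt0 -sinN sin_gt0_pi //; lra.
Qed.

Lemma Arg_lt0 (w : R[i]) : Im w < 0 -> Arg w < 0.
Proof.
move=> iw; have H : ~ on_nonpos_axis w by apply: Im_neq0_off_cut; rewrite lt_eqF.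
have := Arg_le0 H (ltW iw); rewrite le_eqVlt => /orP[/eqP A|//].
by move: iw; rewrite (Im_polar (neq0_on_nonpos_axis H)) A sin0 mulr0 ltxx.
Qed.

Lemma Arg_gt0 (w : R[i]) : 0 < Im w -> 0 < Arg w.
Proof.
move=> iw; have H : ~ on_nonpos_axis w by apply: Im_neq0_off_cut; rewrite gt_eqF.
have := Arg_ge0 H (ltW iw); rewrite le_eqVlt => /orP[/eqP A|//].
by move: iw; rewrite (Im_polar (neq0_on_nonpos_axis H)) -A sin0 mulr0 ltxx.
Qed.

Lemma cexp_conj (z : R[i]) : cexp z^*%C = (cexp z)^*%C.
Proof. by case: z => x y; apply: complex_ext; rewrite /= ?cosN ?sinN ?mulrN. Qed.

Lemma Logp_conj (w : R[i]) : ~ on_nonpos_axis w -> Logp w^*%C = (Logp w)^*%C.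
Proof.
move=> H; have /andP[A1 A2] := Arg_lt H; have w0 := neq0_on_nonpos_axis H.
rewrite -{1}(LogpK w0) -cexp_conj cexpK // /=; lra.
Qed.

Lemma cexp_off_ray (tau : R[i]) : 0 < Im tau < 2 * pi -> ~ on_nonpos_axis (1 - cexp tau).
Proof.
move=> H [h1 h2]; apply: (cexp_nonneg_axis H); split.
  by move: h1; rewrite cImD cImN /= sub0r => /eqP; rewrite oppr_eq0 => /eqP.
by move: h2; rewrite cReD cReN; rewrite /= in h1 *; lra.
Qed.

Lemma Re_1Bcexp_gt0 (tau : R[i]) : Re tau < 0 -> 0 < Re (1 - cexp tau).
Proof.
move=> H; rewrite cReD cReN subr_gt0 (le_lt_trans (ler_norm _)) //.
by rewrite (le_lt_trans (normr_Re_le _)) // cabs_cexp expR_lt1.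
Qed.

(* A version of [Logp (1 - cexp tau)] that extends continuously to both sides of the cut
   [1, +oo), i.e. to [Im tau = 0] and [Im tau = 2 pi]. *)
Definition ell (tau : R[i]) : R[i] :=
  if Re tau < 0 then Logp (1 - cexp tau)
  else tau - (0 +i* pi) + Logp (1 - cexp (- tau)).

Lemma cexp_ell (tau : R[i]) : (0 < Im tau < 2 * pi) \/ Re tau != 0 ->
  cexp (ell tau) = 1 - cexp tau.
Proof.
move=> H; rewrite /ell; case: ltrP => Rt.
  by rewrite LogpK // neq0_on_nonpos_axis //; apply: Re_gt0_off_cut; exact: Re_1Bcexp_gt0.
rewrite cexpD cexpB cexp_ipi LogpK; last first.
  case: H => [H|H].
    rewrite subr_eq0 eq_sym cexpN; apply/eqP => /(congr1 (fun z => z^-1)).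
    rewrite invrK invr1 => E; apply: (cexp_nonneg_axis H).
    by rewrite E; split => //=; exact: ler01.
  apply: neq0_on_nonpos_axis; apply: Re_gt0_off_cut; apply: Re_1Bcexp_gt0.
  by rewrite cReN oppr_lt0 lt_neqAle eq_sym H.
rewrite cexpN invrN1 mulrN1 mulrBr mulr1 mulNr divff ?cexp_neq0 //; ring.
Qed.

(** For [Re tau >= 0] one factors [1 - e^tau = - e^tau (1 - e^(- tau))]. The argument of the last
    factor has the sign of [sin (Im tau)], opposite to that of [Im tau - pi], so the sum of both
    never leaves the principal range. *)
Lemma ell_Logp (tau : R[i]) : 0 < Im tau < 2 * pi -> ell tau = Logp (1 - cexp tau).
Proof.
move=> H; have pi0 := @pi_gt0 R.
rewrite -(cexp_ell (or_introl H)) cexpK // /ell; case: (ltrP (Re tau) 0) => Rt.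
  have := Arg_lt (Re_gt0_off_cut (Re_1Bcexp_gt0 Rt)) => /andP[A1 A2].
  by rewrite Im_Logp A1 ltW.
have n0 : ~ on_nonpos_axis (1 - cexp (- tau)).
  move=> [h1 h2]; apply: (cexp_nonneg_axis H).
  have /eqP : Im (cexp (- tau)) = 0.
    by move: h1; rewrite cImD cImN sub0r => /eqP; rewrite oppr_eq0 => /eqP.
  rewrite /= mulf_eq0 gt_eqF ?expR_gt0 //= cImN sinN oppr_eq0 => /eqP s0.
  split; first by rewrite /= s0 mulr0.
  move: h2; rewrite cReD cReN /= cImN cosN => h2.
  have e1 : 0 < expR (Re (- tau)) by exact: expR_gt0.
  rewrite /= mulr_ge0 ?expR_ge0 // -(pmulr_rge0 _ e1); lra.
have /andP[A1 A2] := Arg_lt n0.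
have Ie : Im (1 - cexp (- tau)) = expR (- Re tau) * sin (Im tau).
  by rewrite cImD cImN /= cReN cImN sinN; ring.
have E := expR_gt0 (- Re tau).
rewrite !cImD cImN Im_Logp /=.
case: (ltrgtP (Im tau) pi) => It.
- have : 0 < Arg (1 - cexp (- tau)).
    by apply: Arg_gt0; rewrite Ie mulr_gt0 // sin_gt0_pi //; case/andP: H => -> _.
  lra.
- have : Arg (1 - cexp (- tau)) < 0.
    apply: Arg_lt0; rewrite Ie pmulr_rlt0 // -(subrK pi (Im tau)) sinDpi oppr_lt0 sin_gt0_pi //; lra.
  lra.
- have Ie0 : Im (1 - cexp (- tau)) = 0 by rewrite Ie It sinpi mulr0.
  have := Arg_le0 n0; have := Arg_ge0 n0; rewrite Ie0 lexx => /(_ isT) a1 /(_ isT) a2.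
  lra.
Qed.
End Branch.

Section Quotient.
Context {R : realType}.
Variable p : R.
Hypothesis p01 : 0 < p <= 1.

(* On the sides of the strip, [p < 1] keeps [p * Im (ell tau)] above [- pi]. *)
Definition regular (tau : R[i]) : Prop :=
  (0 < Im tau < 2 * pi) \/ [/\ p < 1, 0 <= Im tau <= 2 * pi & Re tau != 0].

(* [(1 - (1 - t)^p) / (p t)] for [t = e^tau]. *)
Definition QQ (tau : R[i]) : R[i] :=
  p^-1%:C * ((1 - cexp (p%:C * ell tau)) * cexp (- tau)).

Lemma regular_cexp_ell (tau : R[i]) : regular tau -> cexp (ell tau) = 1 - cexp tau.
Proof. by move=> [H|[_ _ H]]; apply: cexp_ell; [left | right]. Qed.

(** Here [1 - t] lies in the closed lower half-plane. The conclusions are the hypotheses of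
    [power_quotient_arg] for [b = - Im (ell tau)]. *)
Lemma ell_lower (tau : R[i]) : regular tau -> Im tau <= pi ->
  [/\ - pi <= Im (ell tau) <= 0, - pi < p * Im (ell tau),
      ell tau != 0 & 0 < Im tau < pi -> Im (ell tau) < 0].
Proof.
move=> G It; have pi0 := @pi_gt0 R; have /andP[p0 p1] := p01.
have ln0 : ell tau != 0.
  apply/eqP => E; have := regular_cexp_ell G; rewrite E cexp0 => /eqP.
  rewrite eq_sym -subr_eq0 addrAC subrr add0r oppr_eq0 => /eqP E2.
  by have := cexp_neq0 tau; rewrite E2 eqxx.
have [H|H] := ltrP 0 (Im tau).
  have I2 : 0 < Im tau < 2 * pi by lra.
  have n0 := cexp_off_ray I2; have /andP[A1 A2] := Arg_lt n0.
  have Ie : Im (1 - cexp tau) = - (expR (Re tau) * sin (Im tau)).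
    by rewrite cImD cImN /= sub0r.
  have A0 : Arg (1 - cexp tau) <= 0.
    apply: (Arg_le0 n0); rewrite Ie oppr_le0 mulr_ge0 ?expR_ge0 // sin_ge0_pi //.
    by rewrite It ltW.
  rewrite ell_Logp // Im_Logp; split=> //.
  - by rewrite A0 ltW.
  - by nra.
  - by rewrite -ell_Logp.
  - move=> I1; apply: Arg_lt0; rewrite Ie oppr_lt0 mulr_gt0 ?expR_gt0 //.
    by rewrite sin_gt0_pi //; lra.
case: G => [G|[p1' G Rt]]; first by lra.
have I0 : Im tau = 0 by lra.
have E0 (w : R[i]) : Im w = 0 -> Re w < 0 -> Arg (1 - cexp w) = 0.
  move=> iw rw; have n0 := Re_gt0_off_cut (Re_1Bcexp_gt0 rw).
  have Ie : Im (1 - cexp w) = 0 by rewrite cImD cImN /= iw sin0; ring.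
  by apply/eqP; rewrite eq_le Arg_le0 ?Arg_ge0 ?Ie.
(* On the side [Im tau = 0], [1 - t] is real: positive for [Re tau < 0], and negative with argument
   [- pi] for [Re tau > 0]. *)
suff : Im (ell tau) = 0 \/ Im (ell tau) = - pi.
  move=> E; split=> //.
    by case: E => ->; rewrite ?lexx ?oppr_le0 ?ltW.
  by case: E => ->; nra.
rewrite /ell; case: ltrP => Rt'.
  by left; rewrite Im_Logp E0.
right; rewrite !cImD !cImN Im_Logp E0 ?I0 /=; first by ring.
- by rewrite cImN I0 oppr0.
- by rewrite cReN oppr_lt0 lt_neqAle eq_sym Rt.
Qed.

Lemma QQ_cexp (tau : R[i]) : QQ tau * cexp tau = p^-1%:C * (1 - cexp (p%:C * ell tau)).
Proof. by rewrite /QQ -!mulrA -cexpD addNr cexp0 !mulr1. Qed.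

(** This is [power_quotient_arg] at [x -i* b = ell tau]. Since [t^-1] is a positive multiple of the
    conjugate of [t], the sign found there is that of [Im (QQ tau)]. *)
Lemma QQ_lower (tau : R[i]) : regular tau -> Im tau <= pi ->
  [/\ 0 <= Im (QQ tau), ~ on_nonpos_axis (QQ tau) &
      0 < Im tau < pi -> 0 < Im (QQ tau * cexp tau)].
Proof.
move=> G It; have [/andP[L1 L2] L3 L4 L5] := ell_lower G It.
have /andP[p0 p1] := p01; have pV : 0 < p^-1 by rewrite invr_gt0.
have E : ell tau = Re (ell tau) -i* (- Im (ell tau)).
  by rewrite opprK; case: (ell tau).
have [|||] := @power_quotient_arg _ p (Re (ell tau)) (- Im (ell tau)) p01.
- lra.
- lra.
- move=> [h1 h2]; move/eqP: L4; apply; rewrite E h1 h2; apply: complex_ext => //=; exact: oppr0.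
have e1 : 1 - cexp (ell tau) = cexp tau by rewrite regular_cexp_ell // opprB addrC subrK.
rewrite -E e1 => K1 K2 K3 K4.
have QE : QQ tau = p^-1%:C * ((1 - cexp (p%:C * ell tau)) / cexp tau) by rewrite /QQ cexpN.
have et := cexp_neq0 tau.
have J (w : R[i]) : w != 0 -> w^-1 = (cabs w ^- 2)%:C * w^*%C.
  move=> w0; rewrite sqr_cabs; case: (w) => x y; apply: complex_ext => /=; ring.
split.
- rewrite QE cImMr pmulr_rge0 // J // mulrCA cImMr.
  by rewrite mulr_ge0 // invr_ge0 sqr_ge0.
- move=> [h1 h2]; apply: K4; rewrite QE cImMr cReMr in h1 h2; split.
    by move/eqP: h1; rewrite mulf_eq0 gt_eqF //= => /eqP.
  by rewrite -(pmulr_rle0 _ pV).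
- by move=> H; rewrite QQ_cexp cImMr mulr_gt0 // K3 // oppr_gt0 L5.
Qed.

End Quotient.

(** * Reflection, and regularity of the quotient *)

Section Reflection.
Context {R : realType}.
Local Notation C := (R[i]^o).
Variable p : R.
Hypothesis p01 : 0 < p <= 1.

(* The reflection in the line [Im tau = pi], which lifts [t |-> conj t]. *)
Definition refl (tau : R[i]) : R[i] := tau^*%C + (0 +i* (2 * pi)).

Lemma Re_refl tau : Re (refl tau) = Re tau.
Proof. by rewrite /refl; case: tau => x y /=; rewrite addr0. Qed.

Lemma Im_refl tau : Im (refl tau) = 2 * pi - Im tau.
Proof. by rewrite /refl; case: tau => x y /=; rewrite addrC. Qed.

Lemma cexp_2pi_i : cexp (0 +i* (2 * pi)) = 1 :> R[i].
Proof.
rewrite (_ : 0 +i* (2 * pi) = (0 +i* pi) + (0 +i* pi)).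
  by rewrite cexpD cexp_ipi mulrNN mulr1.
by apply: complex_ext => /=; ring.
Qed.

Lemma cexp_refl tau : cexp (refl tau) = (cexp tau)^*%C.
Proof. by rewrite /refl cexpD cexp_2pi_i mulr1 cexp_conj. Qed.

Lemma cexp_Nrefl tau : cexp (- refl tau) = (cexp (- tau))^*%C.
Proof. by rewrite !cexpN cexp_refl conjc_inv. Qed.

Lemma regular_refl tau : regular p tau -> regular p (refl tau).
Proof.
by move=> [H|[h1 h2 h3]]; [left | right; split=> //]; rewrite ?Re_refl ?Im_refl //; lra.
Qed.

Lemma conj_1B (w : R[i]) : 1 - w^*%C = (1 - w)^*%C.
Proof. by case: w => x y; apply: complex_ext => /=; ring. Qed.

Lemma ell_refl tau : regular p tau -> ell (refl tau) = (ell tau)^*%C.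
Proof.
move=> [H|[h1 h2 h3]].
  have H' : 0 < Im (refl tau) < 2 * pi by rewrite Im_refl; lra.
  by rewrite !ell_Logp // cexp_refl conj_1B Logp_conj //; exact: cexp_off_ray.
rewrite /ell Re_refl; case: (ltrP (Re tau) 0) => Rt.
  rewrite cexp_refl conj_1B Logp_conj //; apply: Re_gt0_off_cut; exact: Re_1Bcexp_gt0.
have Rn : Re (- tau) < 0 by rewrite cReN oppr_lt0 lt_neqAle eq_sym h3.
rewrite cexp_Nrefl conj_1B Logp_conj; last by apply: Re_gt0_off_cut; exact: Re_1Bcexp_gt0.
rewrite rmorphD /= /refl; congr (_ + _); case: (tau) => x y.
by apply: complex_ext => /=; ring.
Qed.

Lemma conj_M (z w : R[i]) : (z * w)^*%C = z^*%C * w^*%C.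
Proof. by case: z w => x y [a b]; apply: complex_ext => /=; ring. Qed.

Lemma QQ_refl tau : regular p tau -> QQ p (refl tau) = (QQ p tau)^*%C.
Proof.
move=> G; rewrite /QQ ell_refl // cexp_Nrefl !conj_M conjc_real -conj_1B -(cexp_conj (_ * _)).
by rewrite conj_M conjc_real.
Qed.

Lemma Im_conj (w : R[i]) : Im w^*%C = - Im w. Proof. by case: w. Qed.
Lemma Re_conj (w : R[i]) : Re w^*%C = Re w. Proof. by case: w. Qed.

Lemma QQ_upper tau : regular p tau -> pi <= Im tau ->
  [/\ Im (QQ p tau) <= 0, ~ on_nonpos_axis (QQ p tau) &
      pi < Im tau < 2 * pi -> Im (QQ p tau * cexp tau) < 0].
Proof.
move=> G It; have := QQ_lower p01 (regular_refl G); rewrite Im_refl QQ_refl // cexp_refl -conj_M.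
move=> /(_ _)[|]; first by lra.
rewrite !Im_conj oppr_ge0 oppr_gt0 => h1 h2 h3; split=> //.
  by move=> [k1 k2]; apply: h2; split; rewrite ?Im_conj ?Re_conj // k1 oppr0.
by move=> H; apply: h3; lra.
Qed.

Lemma QQ_off_cut tau : regular p tau -> ~ on_nonpos_axis (QQ p tau).
Proof.
move=> G; case: (leP (Im tau) pi) => [H|/ltW H].
  by have [] := QQ_lower p01 G H.
by have [] := QQ_upper G H.
Qed.

Lemma cexp_Logp_QQ tau : regular p tau ->
  cexp (Logp (QQ p tau) + tau) = QQ p tau * cexp tau.
Proof.
by move=> /QQ_off_cut /neq0_on_nonpos_axis H; rewrite cexpD LogpK.
Qed.

(* Multiplying [e^tau] by [QQ tau] moves the argument towards [pi] without crossing it. *)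
Lemma Arg_QQ_sector tau lo hi : 0 < Im tau < 2 * pi -> lo <= pi <= hi ->
  lo < Im tau < hi -> lo < Im tau + Arg (QQ p tau) < hi.
Proof.
move=> I /andP[l1 h1] /andP[l2 h2].
have G : regular p tau by left.
have n0 := QQ_off_cut G; have /andP[A1 A2] := Arg_lt n0; have pi0 := @pi_gt0 R.
have E := cexp_Logp_QQ G.
have IE : Im (QQ p tau * cexp tau) = expR (Re (Logp (QQ p tau) + tau)) *
    sin (Im tau + Arg (QQ p tau)) by rewrite -E -(Im_Logp (QQ p tau)) [Im tau + _]addrC -cImD.
case: (ltgtP (Im tau) pi) => It.
- have [B1 _ B3] := QQ_lower p01 G (ltW It).
  have A0 := Arg_ge0 n0 B1.
  (* Otherwise the angle would lie in [[pi, 2 pi)], where the sine is nonpositive, against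
     [Im (QQ tau * cexp tau) > 0]. *)
  have : Im tau + Arg (QQ p tau) < pi.
    rewrite ltNge; apply/negP => K.
    have : 0 < Im (QQ p tau * cexp tau) by apply: B3; lra.
    rewrite IE pmulr_rgt0 ?expR_gt0 // -(subrK pi (_ + _)) sinDpi oppr_gt0 ltNge.
    by rewrite sin_ge0_pi //; lra.
  lra.
- have [B1 _ B3] := QQ_upper G (ltW It).
  have A0 := Arg_le0 n0 B1.
  have : pi < Im tau + Arg (QQ p tau).
    rewrite ltNge; apply/negP => K.
    have : Im (QQ p tau * cexp tau) < 0 by apply: B3; lra.
    rewrite IE pmulr_rlt0 ?expR_gt0 // ltNge.
    by rewrite sin_ge0_pi //; lra.
  lra.
- have [Il Iu] : Im tau <= pi /\ pi <= Im tau by rewrite It.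
  have [B1 _ _] := QQ_lower p01 G Il; have [B2 _ _] := QQ_upper G Iu.
  have A0 := Arg_le0 n0 B2; have A0' := Arg_ge0 n0 B1; lra.
Qed.

Lemma near_Re_lt (z : C) (b : R) : Re z < b -> \forall w \near z, Re (w : R[i]) < b.
Proof.
by move=> H; exact: (cvgr_lt _ (cvg_Re (@cvg_id _ (nbhs z)))).
Qed.

Lemma near_Re_gt (z : C) (b : R) : b < Re z -> \forall w \near z, b < Re (w : R[i]).
Proof.
by move=> H; exact: (cvgr_gt _ (cvg_Re (@cvg_id _ (nbhs z)))).
Qed.

Lemma near_Im_lt (z : C) (b : R) : Im z < b -> \forall w \near z, Im (w : R[i]) < b.
Proof.
by move=> H; exact: (cvgr_lt _ (cvg_Im (@cvg_id _ (nbhs z)))).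
Qed.

Lemma near_Im_gt (z : C) (b : R) : b < Im z -> \forall w \near z, b < Im (w : R[i]).
Proof.
by move=> H; exact: (cvgr_gt _ (cvg_Im (@cvg_id _ (nbhs z)))).
Qed.

Lemma C1at_Logp_1B (f : C -> C) (z : C) : C1at f z -> ~ on_nonpos_axis (1 - f z : R[i]) ->
  C1at (fun w : C => Logp (1 - f w) : C) z.
Proof.
move=> cf H.
have c1 := @C1atD R[i] (cst 1) (fun w => - f w) z (C1at_cst _ _) (C1atN cf).
exact: (@C1at_comp R[i] (@Logp R) (fun w => 1 - f w) z (C1at_Logp H) c1).
Qed.

Lemma C1at_cexp_comp (f : C -> C) (z : C) : C1at f z -> C1at (fun w : C => cexp (f w) : C) z.
Proof. by move=> cf; exact: (@C1at_comp R[i] (@cexp R) f z (C1at_cexp _) cf). Qed.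

(** In the open strip both cases of [ell] agree by [ell_Logp], so the seam [Re tau = 0] is
    invisible. On the sides [Re tau != 0] keeps a neighbourhood within one case. *)
Lemma C1at_ell (tau : C) : regular p tau -> C1at (@ell R : C -> C) tau.
Proof.
have c0 : C1at (fun w : C => Logp (1 - cexp w) : C) tau ->
    (\forall w \near tau, Logp (1 - cexp (w : R[i])) = ell w) -> C1at (@ell R : C -> C) tau.
  by move=> h1 h2; exact: (C1at_near h2 h1).
move=> [H|[h1 h2 h3]].
  apply: c0; first by apply: C1at_Logp_1B; [exact: C1at_cexp | exact: cexp_off_ray].
  have /andP[/near_Im_gt N1 /near_Im_lt N2] := H.
  by apply: filterS2 N1 N2 => w w1 w2; rewrite ell_Logp // w1.
case: (ltgtP (Re tau) 0) h3 => // Rt _.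
  apply: c0; first apply: C1at_Logp_1B; first exact: C1at_cexp.
    by apply: Re_gt0_off_cut; exact: Re_1Bcexp_gt0.
  by apply: filterS (near_Re_lt Rt) => w w1; rewrite /ell w1.
have cN : C1at (fun w : C => cexp (- w) : C) tau.
  by apply: C1at_cexp_comp; exact: C1atN (C1at_id _).
have c1 : C1at (fun w : C => Logp (1 - cexp (- w)) : C) tau.
  apply: (C1at_Logp_1B cN); apply: Re_gt0_off_cut; apply: Re_1Bcexp_gt0.
  by rewrite cReN oppr_lt0.
have c2 := @C1atD R[i] id (cst (- (0 +i* pi))) tau (C1at_id _) (C1at_cst _ _).
have c3 := @C1atD R[i] (fun w => w - (0 +i* pi)) _ tau c2 c1.
apply: C1at_near c3; apply: filterS (near_Re_gt Rt) => w w1.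
by rewrite /ell ltNge (ltW w1).
Qed.

Lemma C1at_QQ (tau : C) : regular p tau -> C1at (QQ p : C -> C) tau.
Proof.
move=> G; have cl := C1at_ell G.
have c1 := @C1atM R[i] (cst p%:C) (@ell R) tau (C1at_cst _ _) cl.
have c2 := C1at_cexp_comp c1.
have c3 := @C1atD R[i] (cst 1) _ tau (C1at_cst _ _) (C1atN c2).
have cN : C1at (fun w : C => cexp (- w) : C) tau.
  by apply: C1at_cexp_comp; exact: C1atN (C1at_id _).
have c4 := C1atM c3 cN.
exact: (@C1atM R[i] (cst p^-1%:C) _ tau (C1at_cst _ _) c4).
Qed.

End Reflection.

Lemma cpowP_inj (R : realType) (q : R) (a b : R[i]) : 0 < q <= 1 ->
  ~ on_nonpos_axis a -> ~ on_nonpos_axis b -> cpowP a q = cpowP b q -> a = b.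
Proof.
move=> /andP[q0 q1] na nb; have /andP[A1 A1'] := Arg_lt na; have /andP[A2 A2'] := Arg_lt nb.
have qn : q%:C != 0 :> R[i] by rewrite eq_complex /= negb_and gt_eqF.
move=> /cexp_inj H; have {H} : q%:C * Logp a = q%:C * Logp b.
  apply: H; rewrite !cImMr !Im_Logp -mulrBr normrM gtr0_norm //.
  have : `|Arg a - Arg b| < 2 * pi by rewrite ltr_norml; lra.
  by apply: le_lt_trans; rewrite ler_piMl.
move=> /(mulfI qn) /(congr1 cexp).
by rewrite LogpK ?(neq0_on_nonpos_axis na) // LogpK ?(neq0_on_nonpos_axis nb).
Qed.

(** * The transform in the logarithmic coordinate *)

Section CauchyTransform.
Context {R : realType}.
Local Notation C := (R[i]^o).
Variables (alpha r : R) (s : R[i]).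
Hypothesis r1 : 1 <= r.
Hypothesis adm : admissible alpha s.

Notation p := r^-1.

Lemma admissibleE : [/\ s != 0, 0 < alpha, 0 <= Arg s <= pi & pi <= Arg s + alpha * pi <= 2 * pi].
Proof.
have pi0 := @pi_gt0 R; case: adm => s0 [[/andP[a0 a1] /andP[h1 h2]]|[/andP[a0 a1] /andP[h1 h2]]].
  have h3 : alpha * pi <= pi by rewrite ler_piMl // ltW.
  by split=> //; lra.
have h3 : pi <= alpha * pi by rewrite ler_peMl // ltW.
by split=> //; lra.
Qed.

Lemma alpha_gt0 : 0 < alpha. Proof. by case: admissibleE. Qed.
Lemma s_neq0 : s != 0. Proof. by case: admissibleE. Qed.
Lemma invr01 : 0 < p <= 1.
Proof. by rewrite invr_gt0 (lt_le_trans ltr01) //= invf_le1 // (lt_le_trans ltr01). Qed.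
Lemma r_gt0 : 0 < r. Proof. exact: lt_le_trans ltr01 r1. Qed.

(* [log (s (-1/z)^alpha)] in terms of [v = Logp z]. *)
Definition tauv (v : R[i]) : R[i] := Logp s + alpha%:C * ((0 +i* pi) - v).

(* [Galpha] in terms of [v = Logp z]; unlike the original formula it makes sense on the sides of
   the strip [0 <= Im v <= pi]. *)
Definition gv (v : R[i]) : R[i] := cexp (- v + alpha^-1%:C * Logp (QQ p (tauv v))).

Lemma Im_tauv v : Im (tauv v) = Arg s + alpha * (pi - Im v).
Proof. by rewrite /tauv cImD cImMr cImD cImN. Qed.

Lemma Re_tauv v : Re (tauv v) = ln (cabs s) - alpha * Re v.
Proof. by rewrite /tauv cReD cReMr cReD cReN /= sub0r mulrN. Qed.

Lemma Im_tauv_itv v : 0 < Im v < pi -> Arg s < Im (tauv v) < Arg s + alpha * pi.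
Proof.
have a0 := alpha_gt0; move=> /andP[h1 h2].
by rewrite Im_tauv ltrDl ltrD2l ltr_pM2l // mulr_gt0 // ?subr_gt0 // gtrBl h1.
Qed.

Lemma tauv_interior v : 0 < Im v < pi -> 0 < Im (tauv v) < 2 * pi.
Proof. by move=> /Im_tauv_itv; case: admissibleE => _ _; lra. Qed.

(* The logarithm of [Gmid] in terms of [v = Logp z]. *)
Definition Yv (v : R[i]) : R[i] := Logp (QQ p (tauv v)) + (tauv v - Logp s) - (ln r)%:C.

(** The sector from [Arg s] to [Arg s + alpha * pi] has [pi] in its closure, so moving the argument
    towards [pi] keeps it inside. Division by [s] then subtracts [Arg s]. *)
Lemma Im_Yv v : 0 < Im v < pi -> 0 < Im (Yv v) < alpha * pi.
Proof.
move=> Iv; have [_ _ h1 h2] := admissibleE.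
have H : Arg s <= pi <= Arg s + alpha * pi by lra.
have := Arg_QQ_sector invr01 (tauv_interior Iv) H (Im_tauv_itv Iv).
rewrite /Yv !(cImD, cImN) !Im_Logp /= subr0; lra.
Qed.

Lemma upper_Logp (z : R[i]) : upper z -> 0 < Im (Logp z) < pi.
Proof.
move=> u; have H : ~ on_nonpos_axis z by apply: Im_neq0_off_cut; rewrite gt_eqF.
by rewrite Im_Logp Arg_gt0 //; have /andP[] := Arg_lt H.
Qed.

Lemma upper_neq0 (z : R[i]) : upper z -> z != 0.
Proof. by move=> u; apply/eqP => E; move: u; rewrite E /upper ltxx. Qed.

Lemma neg_invE (z : R[i]) : upper z -> - z^-1 = cexp ((0 +i* pi) - Logp z).
Proof. by move=> u; rewrite cexpB cexp_ipi LogpK ?upper_neq0 // mulN1r. Qed.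

Lemma log1_neg_inv (z : R[i]) : upper z -> log1 (- z^-1) = (0 +i* pi) - Logp z.
Proof.
move=> u; have := upper_Logp u => H; rewrite neg_invE // cexp_log1 //.
by move: H; rewrite cImD cImN /=; lra.
Qed.

Lemma Ginner_eq (z : R[i]) : upper z -> Ginner alpha s z = 1 - cexp (tauv (Logp z)).
Proof.
by move=> u; rewrite /Ginner /cpow1 log1_neg_inv // /tauv cexpD LogpK // s_neq0.
Qed.

Lemma Gmid_eq (z : R[i]) : upper z -> Gmid alpha s r z = cexp (Yv (Logp z)).
Proof.
move=> u; have Iv := upper_Logp u; have I := tauv_interior Iv.
have G : regular p (tauv (Logp z)) by left.
rewrite /Gmid /cpowP Ginner_eq // -ell_Logp //.
have -> : Yv (Logp z) = (Logp (QQ p (tauv (Logp z))) + tauv (Logp z)) - Logp s - (ln r)%:C.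
  by rewrite /Yv; ring.
rewrite !cexpB (cexp_Logp_QQ invr01 G) QQ_cexp LogpK ?s_neq0 // cexp_lnr ?r_gt0 // invrK.
have rn : r%:C != 0 :> R[i] by rewrite eq_complex /= negb_and gt_eqF ?r_gt0.
by rewrite [RHS]mulrC !mulrA mulVf // mul1r.
Qed.

Lemma Galpha_Yv (z : R[i]) : upper z ->
  Galpha alpha s r z = cexp (alpha^-1%:C * (Yv (Logp z) + (ln r)%:C) + (0 +i* pi)).
Proof.
move=> u; have Iv := upper_Logp u; have [_ _ _ h2] := admissibleE.
have h1 : 0 <= Arg s by case: admissibleE => _ _ /andP[].
rewrite /Galpha /cpow1 Gmid_eq // cexp_log1; last by have := Im_Yv Iv; lra.
move: (Yv _) => Y.
rewrite mulrDr !cexpD cexp_ipi mulrN1 mulNr; congr (- _).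
have -> : alpha^-1%:C * (ln r)%:C = (alpha^-1 * ln r)%:C by rewrite rmorphM.
by rewrite cexp_real /powR gt_eqF ?r_gt0 // mulrC.
Qed.

(** The minus sign of [Galpha] is written as [e^(- i pi)] here instead of [e^(i pi)]; this brings
    the imaginary part into [(- pi, 0)]. *)
Lemma exponentE v : - v + alpha^-1%:C * Logp (QQ p (tauv v)) =
  alpha^-1%:C * (Yv v + (ln r)%:C) - (0 +i* pi).
Proof.
have an : alpha%:C != 0 :> R[i] by rewrite eq_complex /= negb_and gt_eqF ?alpha_gt0.
have aV : alpha^-1%:C = (alpha%:C)^-1 :> R[i] by rewrite fmorphV.
by rewrite aV /Yv /tauv; field.
Qed.

Lemma Galpha_eq (z : R[i]) : upper z -> Galpha alpha s r z = gv (Logp z).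
Proof.
move=> u; rewrite Galpha_Yv // /gv exponentE.
rewrite cexpD [in RHS]cexpB cexp_ipi invrN1 //.
Qed.

Lemma Im_exponent v : 0 < Im v < pi ->
  - pi < Im (- v + alpha^-1%:C * Logp (QQ p (tauv v))) < 0.
Proof.
move=> /Im_Yv /andP[h1 h2]; rewrite exponentE cImD cImN cImMr cImD /= addr0.
have a0 := alpha_gt0.
have k1 : 0 < alpha^-1 * Im (Yv v) by rewrite mulr_gt0 // invr_gt0.
have k2 : alpha^-1 * Im (Yv v) < pi by rewrite ltr_pdivrMl.
lra.
Qed.

Lemma Im_gv_lt0 v : 0 < Im v < pi -> Im (gv v) < 0.
Proof.
move=> /Im_exponent H; rewrite /gv [Im _]/= pmulr_rlt0 ?expR_gt0 //.
by rewrite -oppr_gt0 -sinN sin_gt0_pi //; move: H => /=; lra.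
Qed.

Lemma well_defined (z : R[i]) : upper z -> ~ on_nonneg_axis (- z^-1) /\
  ~ on_nonpos_axis (Ginner alpha s z) /\ ~ on_nonneg_axis (Gmid alpha s r z).
Proof.
move=> u; have Iv := upper_Logp u; split; [|split].
- by rewrite neg_invE //; apply: cexp_nonneg_axis; rewrite cImD cImN /=; move: Iv => /=; lra.
- by rewrite Ginner_eq //; apply: cexp_off_ray; exact: tauv_interior.
- rewrite Gmid_eq //; apply: cexp_nonneg_axis; have := Im_Yv Iv.
  by case: admissibleE => _ _; lra.
Qed.

Lemma Galpha_inj (z1 z2 : R[i]) : upper z1 -> upper z2 ->
  Galpha alpha s r z1 = Galpha alpha s r z2 -> z1 = z2.
Proof.
move=> u1 u2; have I1 := upper_Logp u1; have I2 := upper_Logp u2; have pi0 := @pi_gt0 R.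
rewrite (Galpha_eq u1) (Galpha_eq u2) => E.
have an : alpha^-1%:C != 0 :> R[i].
  by rewrite eq_complex /= negb_and gt_eqF ?invr_gt0 ?alpha_gt0.
have E1 : Yv (Logp z1) = Yv (Logp z2).
  have := cexp_inj E; rewrite !exponentE => H.
  have {H} : alpha^-1%:C * (Yv (Logp z1) + (ln r)%:C) - (0 +i* pi) =
     alpha^-1%:C * (Yv (Logp z2) + (ln r)%:C) - (0 +i* pi).
    apply: H; have := Im_exponent I1; have := Im_exponent I2; rewrite !exponentE.
    by move=> *; rewrite ltr_norml; lra.
  by move/addIr/(mulfI an)/addIr.
have := Gmid_eq u1; rewrite E1 -(Gmid_eq u2) /Gmid => /(mulIf _).
rewrite invr_eq0 s_neq0 => /(_ isT) /addrI /oppr_inj.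
have n1 : ~ on_nonpos_axis (Ginner alpha s z1) by case: (well_defined u1) => _ [].
have n2 : ~ on_nonpos_axis (Ginner alpha s z2) by case: (well_defined u2) => _ [].
move=> /(cpowP_inj invr01 n1 n2); rewrite (Ginner_eq u1) (Ginner_eq u2).
move=> /addrI /oppr_inj /cexp_inj H.
have : tauv (Logp z1) = tauv (Logp z2).
  apply: H; have := tauv_interior I1; have := tauv_interior I2.
  by move=> *; rewrite ltr_norml; lra.
have an' : alpha%:C != 0 :> R[i] by rewrite eq_complex /= negb_and gt_eqF ?alpha_gt0.
move=> /addrI /(mulfI an') /addrI /oppr_inj /(congr1 cexp).
by rewrite !LogpK ?upper_neq0.
Qed.

Lemma C1at_gv (v : C) : regular p (tauv v) -> C1at (gv : C -> C) v.
Proof.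
move=> G.
have c1 := @C1atD R[i] (cst (0 +i* pi)) _ v (C1at_cst _ _) (C1atN (C1at_id v)).
have c2 := @C1atM R[i] (cst alpha%:C) _ v (C1at_cst _ _) c1.
have c3 : C1at (tauv : C -> C) v by exact: (@C1atD R[i] (cst (Logp s)) _ v (C1at_cst _ _) c2).
have c4 := @C1at_comp R[i] (QQ p) tauv v (C1at_QQ G) c3.
have c5 := @C1at_comp R[i] (@Logp R) (QQ p \o tauv) v (C1at_Logp (QQ_off_cut invr01 G)) c4.
have c6 := @C1atM R[i] (cst alpha^-1%:C) _ v (C1at_cst _ _) c5.
exact: (C1at_cexp_comp (C1atD (C1atN (C1at_id v)) c6)).
Qed.

Lemma C1at_Galpha (z : C) : upper z -> C1at (Galpha alpha s r : C -> C) z.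
Proof.
move=> u; have Iv := upper_Logp u.
have G : regular p (tauv (Logp z)) by left; exact: tauv_interior.
have n0 : ~ on_nonpos_axis (z : R[i]) by apply: Im_neq0_off_cut; rewrite gt_eqF.
have c := @C1at_comp R[i] gv (@Logp R) z (C1at_gv G) (C1at_Logp n0).
apply: C1at_near c; apply: filterS (near_Im_gt u) => w w0.
by rewrite Galpha_eq.
Qed.

End CauchyTransform.

(** * Growth near the origin and behaviour at infinity *)

Section Estimates.
Context {R : realType}.
Local Notation C := (R[i]^o).

Section Power.
Variable p : R.
Hypothesis p01 : 0 < p <= 1.

Let F (t : C) : C := cexp (p%:C * Logp (1 - t)).

Let F0 : F 0 = 1.
Proof. by rewrite /F subr0 Logp1 mulr0 cexp0. Qed.

Let dF : is_derive (0 : C) 1 F (- p%:C : C).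
Proof.
have n1 : ~ on_nonpos_axis (1 - 0 : R[i]) by rewrite subr0; apply: Re_gt0_off_cut; exact: ltr01.
have d1 := is_deriveB (is_derive_cst (1 : C) (0 : C) 1) (is_derive_id (0 : C) 1).
have d2 := @is_derive1_compK R[i] (@Logp R) (fun t => 1 - t) 0 _ _ (is_derive_Logp n1) d1.
have d3 := is_deriveMK (is_derive_cst (p%:C : C) (0 : C) 1) d2.
have d4 := @is_derive1_compK R[i] (@cexp R) (fun t => p%:C * Logp (1 - t)) 0 _ _ (is_derive_cexp _) d3.
apply: is_derive_eq d4 _.
by rewrite /= !subr0 Logp1 mulr0 cexp0 mul0r addr0 invr1 sub0r !mul1r mulrN1.
Qed.

Let QE (tau : R[i]) : 0 < Im tau < 2 * pi -> QQ p tau = p^-1%:C * ((1 - F (cexp tau)) * cexp (- tau)).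
Proof. by move=> H; rewrite /QQ ell_Logp. Qed.

(** [Re tau] tending to minus infinity means [t] tending to [0], where [(1 - t)^p] has derivative
    [- p]. *)
Lemma QQ_cvg1 (e : R) : 0 < e -> exists x0 : R, forall tau : R[i],
  0 < Im tau < 2 * pi -> Re tau < x0 -> cabs (QQ p tau - 1) < e.
Proof.
move=> e0; have /andP[p0 p1] := p01.
(* Division by [p * |t|] turns this tolerance into [e / 2], which gives the strict inequality. *)
have /is_derive_cabsP /(_ _ (_ : 0 < e * p / 2))[|d d0 H] := dF.
  by rewrite divr_gt0 // mulr_gt0.
exists (ln d) => tau It Rt.
have td : cabs (cexp tau) < d by rewrite cabs_cexp -(lnK (x := d)) // ltr_expR.
have := H _ td; rewrite add0r F0 mulNr opprK => K.
have pn : p%:C != 0 :> R[i] by rewrite eq_complex /= negb_and gt_eqF.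
have -> : QQ p tau - 1 = - (p^-1%:C * ((F (cexp tau) - 1 + p%:C * cexp tau) * cexp (- tau))).
  rewrite QE // cexpN; move: (F (cexp tau)) => f; move: (cexp tau) (cexp_neq0 tau) => t t0.
  have -> : p^-1%:C = (p%:C)^-1 :> R[i] by rewrite fmorphV.
  by field; rewrite t0.
rewrite cabsN !cabsM cabs_real gtr0_norm ?invr_gt0 // cexpN cabsV.
have t0 : 0 < cabs (cexp tau) by rewrite cabs_gt0 cexp_neq0.
rewrite mulrC ltr_pdivrMr // ltr_pdivrMr //.
apply: le_lt_trans K _; rewrite ltr_pM2r //.
have : 0 < e * p by rewrite mulr_gt0.
lra.
Qed.

(** For small [t] the derivative at [0] bounds the quotient; for large [t] the numerator is of order
    [|t|^p]. As [p <= 1], each bound extends to the other range with a larger constant. *)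
Lemma QQ_bound : exists2 B : R, 0 < B & forall tau : R[i], 0 < Im tau < 2 * pi ->
  cabs (QQ p tau) <= B /\ cabs (QQ p tau) <= B * expR ((p - 1) * Re tau).
Proof.
have /andP[p0 p1] := p01.
have [d1 d10 L] := is_derive_lipschitz dF.
pose d := Num.min d1 1.
have d0 : 0 < d by rewrite lt_min d10 ltr01.
have dle : d <= 1 by rewrite ge_min lexx orbT.
have V1 : 1 <= d^-1 by rewrite invf_ge1.
(* [4 / d] bounds the numerator by [expR (p * x)] for [x >= ln d]; another [1 / d] trades this for
   [expR x]; [1 / p] comes from [QQ]. *)
exists (4 / d / d / p); first by rewrite !divr_gt0.
have B4 : 4 <= 4 / d / d by rewrite -mulrA ler_peMr // -[leLHS]mulr1 ler_pM.
have B5 : 4 / d <= 4 / d / d by rewrite ler_peMr // divr_ge0 // ltW.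
move=> tau It; set x := Re tau.
have aQ : cabs (QQ p tau) = cabs (1 - F (cexp tau)) / expR x / p.
  rewrite QE // !cabsM cabs_real gtr0_norm ?invr_gt0 // cexpN cabsV cabs_cexp mulrC.
  by [].
have E0 := expR_gt0 x.
suff [H1 H2] : cabs (1 - F (cexp tau)) <= 4 / d / d * expR x /\
    cabs (1 - F (cexp tau)) <= 4 / d / d * expR (p * x).
  rewrite aQ; split.
    by rewrite ler_pM2r ?invr_gt0 // ler_pdivrMr.
  rewrite [leRHS]mulrAC ler_pM2r ?invr_gt0 // ler_pdivrMr // -[leRHS]mulrA -expRD.
  by rewrite (_ : (p - 1) * x + x = p * x) //; ring.
have [near|far] := ltrP (expR x) d.
  have : cabs (cexp tau - 0) < d1.
    by rewrite subr0 cabs_cexp (lt_le_trans near) // ge_min lexx.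
  move=> /L; rewrite F0 subr0 cabs_distC cabsN cabs_real gtr0_norm // cabs_cexp -/x => K.
  have K2 : cabs (1 - F (cexp tau)) <= 4 * expR x.
    by apply: le_trans K _; rewrite ler_pM2r //; lra.
  have x0 : x <= 0 by rewrite -ler_expR expR0; lra.
  have K3 : expR x <= expR (p * x) by rewrite ler_expR; nra.
  have K4 := expR_gt0 (p * x).
  split; first by apply: le_trans K2 _; rewrite ler_pM2r.
  apply: le_trans K2 _; apply: le_trans (_ : 4 * expR (p * x) <= _).
    by rewrite ler_pM2l.
  by rewrite ler_pM2r.
have n0 := cexp_off_ray It.
have xd : ln d <= x by rewrite -ler_expR lnK.
have ld : ln d <= 0 by rewrite -ler_expR lnK // expR0.
have t1 : cabs (1 - cexp tau) <= 2 / d * expR x.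
  apply: le_trans (cabsB _ _) _; rewrite cabs1 cabs_cexp -/x.
  rewrite mulrAC ler_pdivlMr //; nra.
have F1 : cabs (F (cexp tau)) <= 2 / d * expR (p * x).
  have c0 : 0 < cabs (1 - cexp tau) by rewrite cabs_gt0 neq0_on_nonpos_axis.
  rewrite /F cabs_cexp cReMr /=.
  have h : ln (cabs (1 - cexp tau)) <= ln (2 / d) + x.
    by rewrite -ler_expR lnK // expRD lnK // posrE divr_gt0.
  have l2 : 0 <= ln (2 / d) by rewrite ln_ge0 // ler_pdivlMr // mul1r; lra.
  apply: le_trans (_ : expR (ln (2 / d) + p * x) <= _).
    by rewrite ler_expR; nra.
  by rewrite expRD lnK // posrE divr_gt0.
have px : d <= expR (p * x).
  by rewrite -[leLHS](lnK (x := d)) // ler_expR; nra.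
have q1 : cabs (1 - F (cexp tau)) <= 4 / d * expR (p * x).
  apply: le_trans (cabsB _ _) _; rewrite cabs1.
  have : 1 <= 2 / d * expR (p * x) by rewrite mulrAC ler_pdivlMr //; lra.
  have -> : 4 / d * expR (p * x) = 2 / d * expR (p * x) + 2 / d * expR (p * x) by lra.
  lra.
split; last by apply: le_trans q1 _; rewrite ler_pM2r ?expR_gt0.
apply: le_trans q1 _; rewrite -[leRHS]mulrA ler_pM2l ?divr_gt0 //.
have -> : d^-1 = expR (- ln d) by rewrite expRN lnK.
by rewrite -expRD ler_expR; nra.
Qed.

End Power.

Section Growth.
Variables (alpha r : R) (s : R[i]).
Hypothesis r1 : 1 <= r.
Hypothesis adm : admissible alpha s.

Notation p := r^-1.

(** For [|z| >= 1] the boundedness of [QQ] gives the order [|z|^-1]. For [|z| < 1], [|t|] is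
    proportional to [|z|^(- alpha)], so the second bound on [QQ], raised to [1 / alpha], gains
    [|z|^(1 - p)] over [|z|^-1]. *)
Lemma gv_bound : exists K : R, forall v : R[i], 0 < Im v < pi ->
  cabs (gv alpha r s v) <= K * expR (- ((1 - p) * `|Re v|)) * (1 + expR (- Re v)).
Proof.
have P01 := invr01 r1; have /andP[p0 p1] := P01; have a0 := alpha_gt0 adm.
have [B B0 HB] := QQ_bound P01.
pose A1 := alpha^-1 * ln B; pose A2 := A1 + alpha^-1 * ((p - 1) * ln (cabs s)).
exists (expR A1 + expR A2) => v Iv; have It := tauv_interior adm Iv.
have [H1 H2] := HB _ It.
have Qn : 0 < cabs (QQ p (tauv alpha s v)).
  by rewrite cabs_gt0; apply: neq0_on_nonpos_axis; apply: QQ_off_cut => //; left.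
have aV : 0 < alpha^-1 by rewrite invr_gt0.
set u := Re v; set l := ln (cabs (QQ p (tauv alpha s v))).
have E : cabs (gv alpha r s v) = expR (- u + alpha^-1 * l).
  by rewrite /gv cabs_cexp cReD cReN cReMr.
have l1 : alpha^-1 * l <= A1 by rewrite ler_pM2l // ler_ln // posrE.
have l2 : alpha^-1 * l <= A2 + (1 - p) * u.
  have : l <= ln B + (p - 1) * (ln (cabs s) - alpha * u).
    rewrite -(Re_tauv alpha s v) -ler_expR lnK // expRD lnK //.
  move=> /(ler_wpM2l (ltW aV)).
  have -> : alpha^-1 * (ln B + (p - 1) * (ln (cabs s) - alpha * u)) = A2 + (1 - p) * u.
    by rewrite /A2 /A1; field; rewrite (gt_eqF a0) (gt_eqF (r_gt0 r1)).
  by [].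
have P1 := expR_gt0 A1; have P2 := expR_gt0 A2; have P3 := expR_gt0 (- u).
rewrite E mulrDr mulr1; set W := expR (- ((1 - p) * `|u|)).
have P4 : 0 < W := expR_gt0 _.
have P5 := mulr_gt0 P1 P4; have P6 := mulr_gt0 P2 P4.
have P7 := mulr_gt0 P5 P3; have P8 := mulr_gt0 P6 P3.
case: (ger0P u) => u0.
  apply: le_trans (_ : expR A1 * W <= _); last by lra.
  by rewrite /W ger0_norm // -expRD ler_expR; nra.
apply: le_trans (_ : expR A2 * W * expR (- u) <= _); last by lra.
by rewrite /W ltr0_norm // -!expRD ler_expR; lra.
Qed.

(** [z G(z)] is [QQ] to the power [1 / alpha], hence tends to [1]; for [z = i y] its real part is
    [- y Im G]. *)
Lemma Galpha_asymptotic :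
  n.+1%:R * - Im (Galpha alpha s r (0 +i* n.+1%:R)) @[n --> \oo] --> (1 : R).
Proof.
have P01 := invr01 r1; have a0 := alpha_gt0 adm.
pose z n : R[i] := 0 +i* n.+1%:R.
have uz n : upper (z n) by rewrite /upper /= ltr0n.
pose Qn n : C := QQ p (tauv alpha s (Logp (z n))).
have cQ : Qn n @[n --> \oo] --> (1 : C).
  apply/cvg_cabsP => e e0; have [x0 H] := QQ_cvg1 P01 e0.
  near=> n; apply: H; first by apply: (tauv_interior adm); exact: upper_Logp.
  rewrite Re_tauv /= ltrBlDr -ltrBlDl.
  have -> : cabs (z n) = n.+1%:R.
    by rewrite /cabs /= expr0n add0r sqrtr_sqr ger0_norm.
  rewrite -ltr_pdivrMl // -ltr_expR lnK ?posrE //.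
  set A := expR _; near: n; exists (Num.truncn A) => // m /= hm.
  by apply: lt_le_trans (truncnS_gt A) _; rewrite ler_nat ltnS.
have cG : {for (1 : C), continuous (fun w : C => cexp (alpha^-1%:C * Logp w) : C)}.
  apply: C1at_continuous; apply: C1at_cexp_comp.
  apply: (@C1atM R[i] (cst alpha^-1%:C) (@Logp R) _ (C1at_cst _ _)).
  by apply: C1at_Logp; apply: Re_gt0_off_cut; exact: ltr01.
have cc := cvg_Re (cvg_comp _ _ cQ cG).
have E n : n.+1%:R * - Im (Galpha alpha s r (z n)) = Re (cexp (alpha^-1%:C * Logp (Qn n))).
  have zE : z n * Galpha alpha s r (z n) = cexp (alpha^-1%:C * Logp (Qn n)).
    rewrite (Galpha_eq r1 adm) // /gv cexpD cexpN LogpK ?upper_neq0 // mulrA divff ?mul1r //.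
    exact: upper_neq0.
  have zr : Re (z n) = 0 by [].
  have zi : Im (z n) = n.+1%:R by [].
  by rewrite -zE cReM zr zi mul0r sub0r mulrN.
under eq_fun do rewrite E.
by move: cc; rewrite Logp1 mulr0 cexp0 => cc; exact: cc.
Unshelve. all: by end_near. Qed.

End Growth.
End Estimates.

(** * The representing measure *)

Section Representation.
Context {R : realType}.
Notation mu := (@lebesgue_measure R).
Local Notation T := (measurableTypeR R).

Lemma integral_except (f g : R -> R) (u0 : R) :
  measurable_fun [set: T] f -> measurable_fun [set: T] g ->
  (forall u, u != u0 -> f u = g u) ->
  (\int[mu]_u (f u)%:E = \int[mu]_u (g u)%:E)%E.
Proof.
move=> mf mg fg; apply: ae_eq_integral => //; try exact/measurable_EFinP.
exists [set u0]; split; [exact: measurable_set1 | exact: lebesgue_measure_set1 |].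
by move=> u /=; apply: contra_notP => /eqP /fg -> _.
Qed.

Lemma cauchy_re_continuous (z : R[i]) : 0 < Im z -> continuous (cauchy_re z).
Proof.
move=> z0 x; have c : {for x, continuous (fun x : R => Re z - x)}.
  by apply: (@cvgB R R^o _ (nbhs x)); [exact: cvg_cst | exact: cvg_id].
apply: (@cvgM R _ (nbhs x)) => //; apply: (@cvgV R _ (nbhs x)).
  by rewrite gt_eqF // ltr_wpDl ?sqr_ge0 // exprn_gt0.
by apply: (@cvgD R R^o _ (nbhs x)); [exact: (@cvgM R _ (nbhs x) _ _ _ _ _ c c) | exact: cvg_cst].
Qed.

Lemma cauchy_im_continuous (z : R[i]) : 0 < Im z -> continuous (cauchy_im z).
Proof.
move=> z0 x; have c : {for x, continuous (fun x : R => Re z - x)}.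
  by apply: (@cvgB R R^o _ (nbhs x)); [exact: cvg_cst | exact: cvg_id].
apply: (@cvgM R _ (nbhs x)); first exact: cvg_cst.
apply: (@cvgV R _ (nbhs x)).
  by rewrite gt_eqF // ltr_wpDl ?sqr_ge0 // exprn_gt0.
by apply: (@cvgD R R^o _ (nbhs x)); [exact: (@cvgM R _ (nbhs x) _ _ _ _ _ c c) | exact: cvg_cst].
Qed.

Lemma cauchy_re_bound (z : R[i]) (x : R) : 0 < Im z -> `|cauchy_re z x| <= (Im z)^-1.
Proof.
move=> z0; have Q0 : 0 < (Re z - x) ^+ 2 + Im z ^+ 2 by rewrite ltr_wpDl ?sqr_ge0 // exprn_gt0.
rewrite /cauchy_re normrM normfV (gtr0_norm Q0) ler_pdivrMr // ler_pdivlMl //.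
by rewrite -[X in _ <= X + _]real_normK ?num_real //; nra.
Qed.

Lemma cauchy_im_bound (z : R[i]) (x : R) : 0 < Im z -> `|cauchy_im z x| <= (Im z)^-1.
Proof.
move=> z0; have Q0 : 0 < (Re z - x) ^+ 2 + Im z ^+ 2 by rewrite ltr_wpDl ?sqr_ge0 // exprn_gt0.
rewrite /cauchy_im normrM normfV (gtr0_norm Q0) normrN (gtr0_norm z0) ler_pdivrMr // ler_pdivlMl //.
by rewrite -expr2 lerDr sqr_ge0.
Qed.

Section Density.
Variables (d0 d1 : R -> R) (u1 : R) (G : R[i] -> R[i]).
Hypothesis m0 : measurable_fun [set: T] d0.
Hypothesis m1 : measurable_fun [set: T] d1.
Hypothesis pos0 : forall u, u != u1 -> 0 <= d0 u.
Hypothesis pos1 : forall u, u != u1 -> 0 <= d1 u.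
Hypothesis rep : forall z : R[i], 0 < Im z ->
  [/\ mu.-integrable setT (EFin \o (fun u => d0 u * cauchy_re z (expR u))),
      mu.-integrable setT (EFin \o (fun u => d1 u * cauchy_re z (- expR u))) &
      \int[mu]_u (d0 u * cauchy_re z (expR u)) +
      \int[mu]_u (d1 u * cauchy_re z (- expR u)) = Re (G z)] /\
  [/\ mu.-integrable setT (EFin \o (fun u => d0 u * cauchy_im z (expR u))),
      mu.-integrable setT (EFin \o (fun u => d1 u * cauchy_im z (- expR u))) &
      \int[mu]_u (d0 u * cauchy_im z (expR u)) +
      \int[mu]_u (d1 u * cauchy_im z (- expR u)) = Im (G z)].
Hypothesis asymp : n.+1%:R * - Im (G (0 +i* n.+1%:R)) @[n --> \oo] --> (1 : R).

(** The factor is [- y Im (1 / (i y - X))] for [y = n + 1] and [X = expR u] or [- expR u]; it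
    increases to [1]. *)
Let weight (d : R -> R) (n : nat) (u : R) : R :=
  `|d u| * (n.+1%:R ^+ 2 / (expR u ^+ 2 + n.+1%:R ^+ 2)).

Let weight_ge0 d n u : 0 <= weight d n u.
Proof. by rewrite mulr_ge0 // divr_ge0 ?addr_ge0 ?sqr_ge0. Qed.

Let weight_measurable d n : measurable_fun [set: T] d -> measurable_fun [set: T] (weight d n).
Proof.
move=> md; apply: measurable_funM; first exact: measurableT_comp.
have zn : 0 < Im (0 +i* n.+1%:R : R[i]) by rewrite /= ltr0n.
have -> : (fun u : R => n.+1%:R ^+ 2 / (expR u ^+ 2 + n.+1%:R ^+ 2)) =
    (fun u : T => - n.+1%:R * cauchy_im (0 +i* n.+1%:R) (expR u)).
  by apply/funext => u; rewrite /cauchy_im /= sub0r sqrrN; ring.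
apply: measurable_funM => //; apply: continuous_measurable_fun => u.
by apply: continuous_comp; [exact: continuous_expR | exact: cauchy_im_continuous].
Qed.

(** Monotone convergence is the right tool, since integrability of [d] is only a consequence of this
    limit. *)
Let weight_cvg d : measurable_fun [set: T] d ->
  (\int[mu]_u (weight d n u)%:E @[n --> \oo] --> \int[mu]_u `|d u|%:E)%E.
Proof.
move=> md.
have c u : (weight d n u)%:E @[n --> \oo] --> (`|d u|)%:E.
  apply: cvg_EFin; first exact: nearW.
  rewrite -[X in _ --> X]mulr1; apply: cvgM; first exact: cvg_cst.
  have -> : (fun n : nat => n.+1%:R ^+ 2 / (expR u ^+ 2 + n.+1%:R ^+ 2)) =
      (fun n => (1 + expR u ^+ 2 * (harmonic n * harmonic n))^-1).
    apply/funext => n; rewrite /harmonic /=.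
    have Q0 : expR u ^+ 2 + n.+1%:R ^+ 2 != 0 :> R by rewrite gt_eqF // addr_gt0 // exprn_gt0 ?expR_gt0 ?ltr0n.
    have Q1 : n.+1%:R ^+ 2 + expR u ^+ 2 != 0 :> R by rewrite addrC.
    have n0 : n.+1%:R != 0 :> R by rewrite pnatr_eq0.
    move: (n.+1%:R : R) (expR u) n0 Q0 Q1 => k a n0 Q0 Q1.
    have -> : 1 + a ^+ 2 * (k^-1 * k^-1) = (a ^+ 2 + k ^+ 2) / k ^+ 2 by field.
    by rewrite invf_div.
  have h0 : @harmonic R n * harmonic n @[n --> \oo] --> 0.
    by rewrite -[X in _ --> X](mulr0 0); apply: cvgM; exact: cvg_harmonic.
  rewrite -[X in _ --> X]invr1; apply: cvgV; first exact: oner_neq0.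
  rewrite -[X in _ --> X]addr0; apply: cvgD; first exact: cvg_cst.
  by rewrite -[X in _ --> X](mulr0 (expR u ^+ 2)); apply: cvgM => //; exact: cvg_cst.
have -> : (\int[mu]_u `|d u|%:E = \int[mu]_u limn (fun n => (weight d n u)%:E))%E.
  by apply: eq_integral => u _; apply/esym/cvg_lim => //; exact: c.
apply: (@cvg_monotone_convergence _ _ _ mu setT measurableT (fun n u => (weight d n u)%:E)).
- by move=> n; apply/measurable_EFinP; exact: weight_measurable.
- by move=> n u _; rewrite lee_fin.
- move=> u _ m n mn; rewrite lee_fin /weight ler_wpM2l //.
  have p k : 0 < expR u ^+ 2 + k.+1%:R ^+ 2 by rewrite addr_gt0 // exprn_gt0 ?expR_gt0 ?ltr0n.
  rewrite ler_pdivrMr // mulrAC ler_pdivlMr // !mulrDr [_ ^+ 2 * m.+1%:R ^+ 2]mulrC lerD2r.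
  by rewrite ler_wpM2r ?sqr_ge0 // ler_pXn2r ?nnegrE ?ler0n // ler_nat ltnS.
Qed.

Let weight_integral n : (\int[mu]_u (weight d0 n u)%:E + \int[mu]_u (weight d1 n u)%:E =
  (n.+1%:R * - Im (G (0 +i* n.+1%:R)))%:E)%E.
Proof.
have zn : 0 < Im (0 +i* n.+1%:R : R[i]) by rewrite /= ltr0n.
have [_ [i0 i1 <-]] := rep zn.
have E (d : R -> R) (e : R -> R) : measurable_fun [set: T] d -> (forall u, u != u1 -> 0 <= d u) ->
    (forall u, e u ^+ 2 = expR u ^+ 2) ->
    mu.-integrable setT (EFin \o (fun u => d u * cauchy_im (0 +i* n.+1%:R) (e u))) ->
    (\int[mu]_u (weight d n u)%:E =
      (- n.+1%:R * \int[mu]_u (d u * cauchy_im (0 +i* n.+1%:R) (e u)))%:E)%E.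
  move=> md pd e2 int; rewrite EFinM /Rintegral fineK; last by apply: integrable_fin_num.
  rewrite -integralZl //; under [RHS]eq_integral do rewrite /= -EFinM.
  apply: (@integral_except _ _ u1); first exact: weight_measurable.
    apply: measurable_funM => //; apply/measurable_EFinP; exact: measurable_int int.
  move=> u /pd du; rewrite /weight ger0_norm // /cauchy_im /= sub0r sqrrN e2; ring.
rewrite (E d0 expR) // (E d1 (fun u => - expR u)) //; last by move=> u; rewrite sqrrN.
by rewrite -EFinD; congr (_ %:E); ring.
Qed.

Let mass : (\int[mu]_u `|d0 u|%:E + \int[mu]_u `|d1 u|%:E = 1)%E.
Proof.
have c1 : (\int[mu]_u (weight d0 n u)%:E + \int[mu]_u (weight d1 n u)%:E)%E @[n --> \oo] -->
    (\int[mu]_u `|d0 u|%:E + \int[mu]_u `|d1 u|%:E)%E.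
  apply: cvgeD; [|exact: weight_cvg|exact: weight_cvg].
  by apply: ge0_adde_def; rewrite inE integral_ge0.
have c2 : (\int[mu]_u (weight d0 n u)%:E + \int[mu]_u (weight d1 n u)%:E)%E @[n --> \oo] -->
    1%E.
  under eq_fun do rewrite weight_integral.
  by apply: cvg_EFin; [exact: nearW | exact: asymp].
exact: cvg_unique c1 c2.
Qed.

Let norm_integrable (d d' : R -> R) : measurable_fun [set: T] d ->
  (\int[mu]_u `|d u|%:E + \int[mu]_u `|d' u|%:E = 1)%E ->
  mu.-integrable setT (EFin \o (fun u => `|d u|)).
Proof.
move=> md E; apply/integrableP; split.
  by apply/measurable_EFinP; exact: measurableT_comp.
under eq_integral do rewrite /= normr_id.
apply: le_lt_trans (_ : (_ <= 1)%E) _; last exact: ltry.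
by rewrite -E leeDl // integral_ge0.
Qed.

(* [d0] and [d1] need not be nonnegative at [u1], hence the absolute values in the measure. *)
Lemma cauchy_representation : exists P : probability R R, forall z : R[i], upper z ->
  (Re (G z))%:E = (\int[P]_x (cauchy_re z x)%:E)%E /\
  (Im (G z))%:E = (\int[P]_x (cauchy_im z x)%:E)%E.
Proof.
have i0 := norm_integrable m0 mass.
have i1 : mu.-integrable setT (EFin \o (fun u => `|d1 u|)).
  by apply: (@norm_integrable d1 d0) => //; rewrite addeC mass.
have [P HP] := @two_ray_probability R (fun u => `|d0 u|) (fun u => `|d1 u|)
  (fun=> normr_ge0 _) (fun=> normr_ge0 _) i0 i1 mass.
exists P => z z0; have [[r0 r1 <-] [j0 j1 <-]] := rep z0.
have E (k : R -> R) (d e : R -> R) : continuous k -> continuous e ->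
    measurable_fun [set: T] d -> (forall u, u != u1 -> 0 <= d u) ->
    mu.-integrable setT (EFin \o (fun u => d u * k (e u))) ->
    (\int[mu]_u (k (e u) * `|d u|)%:E = (\int[mu]_u (d u * k (e u)))%:E)%E.
  move=> ck ce md pd int; rewrite /Rintegral fineK; last by apply: integrable_fin_num.
  apply: (@integral_except _ _ u1).
  - apply: measurable_funM; last exact: measurableT_comp.
    by apply: continuous_measurable_fun => u; apply: continuous_comp; [exact: ce | exact: ck].
  - by apply/measurable_EFinP; exact: measurable_int int.
  - by move=> u /pd du; rewrite ger0_norm // mulrC.
have ce : continuous (@expR R) by exact: continuous_expR.
have cN : continuous (fun u : R => - expR u) by move=> u; apply: cvgN; exact: continuous_expR.
have cr := cauchy_re_continuous z0; have ci := cauchy_im_continuous z0.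
split; rewrite (HP _ (Im z)^-1).
- by rewrite !E // EFinD.
- by apply: continuous_measurable_fun.
- by move=> x; exact: cauchy_re_bound.
- by rewrite !E // EFinD.
- by apply: continuous_measurable_fun.
- by move=> x; exact: cauchy_im_bound.
Qed.

End Density.
End Representation.

Section Existence.
Context {R : realType}.
Local Notation C := (R[i]^o).
Variables (alpha r : R) (s : R[i]).
Hypothesis adm : admissible alpha s.

Local Notation g := (gv alpha r s).
Local Notation represented :=
  (exists P : probability R R, forall z : R[i], upper z ->
     (Re (Galpha alpha s r z))%:E = (\int[P]_x (cauchy_re z x)%:E)%E /\
     (Im (Galpha alpha s r z))%:E = (\int[P]_x (cauchy_im z x)%:E)%E).

Section ExponentGreaterThanOne.
Hypothesis r1 : 1 < r.

Let u1 : R := ln (cabs s) / alpha.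

Let boundary_continuous (y u : R) : 0 <= y <= pi -> u != u1 ->
  {for (u +i* y : C), continuous (g : C -> C)}.
Proof.
move=> /andP[y0 y1] uu1; have [_ a0 h1 h2] := admissibleE adm.
apply: C1at_continuous; apply: (C1at_gv (ltW r1)); right; split.
- by rewrite invf_lt1 // (lt_trans ltr01).
- have k1 : 0 <= alpha * (pi - y) by rewrite mulr_ge0 ?subr_ge0 // ltW.
  have k2 : 0 <= alpha * y by rewrite mulr_ge0 // ltW.
  by rewrite Im_tauv /=; move: k1; rewrite mulrBr; lra.
- rewrite Re_tauv /=; apply: contraNneq uu1 => E.
  by rewrite /u1 (subr0_eq E) mulrC mulKf // gt_eqF.
Qed.

(** If [Im g] were positive at a boundary point of continuity, it would be positive at nearby
    interior points, where it is negative. *)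
Let density_ge0 (y u : R) : (y == 0) || (y == pi) -> u != u1 -> 0 <= density g y u.
Proof.
move=> yy uu1; have pi0 := @pi_gt0 R.
have y01 : 0 <= y <= pi by case/orP: yy => /eqP ->; rewrite lexx ltW.
rewrite /density oppr_ge0 pmulr_lle0 ?invr_gt0 // pmulr_lle0 ?expR_gt0 //.
rewrite leNgt; apply/negP => G0.
have /nbhs_cabsP[e e0 H] : \forall w \near (u +i* y : C), 0 < Im (g w).
  exact: (cvgr_gt _ (cvg_Im (boundary_continuous y01 uu1))).
(* Below [e] to stay in the neighbourhood, below [pi] to stay in the strip. *)
pose t := Num.min e pi / 2.
have m0 : 0 < Num.min e pi by rewrite lt_min e0 pi0.
have me : Num.min e pi <= e by rewrite ge_min lexx.
have mp : Num.min e pi <= pi by rewrite ge_min lexx orbT.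
pose y' := if y == 0 then t else pi - t.
have yt : `|y' - y| = t.
  rewrite /y'; case: (eqVneq y 0) yy => [->|_ /eqP ->]; first by rewrite subr0 gtr0_norm // /t; lra.
  by rewrite addrAC subrr sub0r normrN gtr0_norm // /t; lra.
have I : 0 < Im (u +i* y') < pi by rewrite /= /y'; case: ifP => _; rewrite /t; lra.
have := Im_gv_lt0 (ltW r1) adm I; apply/negP; rewrite -leNgt ltW //; apply: H.
have -> : (u +i* y') - (u +i* y) = 0 +i* (y' - y) by apply: complex_ext => /=; ring.
by rewrite /cabs /= expr0n add0r sqrtr_sqr yt /t; lra.
Qed.

Lemma representation_gt1 : represented.
Proof.
have pi0 := @pi_gt0 R.
have c0 u : u != u1 -> {for (u +i* 0 : C), continuous (g : C -> C)}.
  by apply: boundary_continuous; rewrite lexx ltW.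
have cpi u : u != u1 -> {for (u +i* pi : C), continuous (g : C -> C)}.
  by apply: boundary_continuous; rewrite lexx ltW.
have md y : 0 <= y <= pi -> measurable_fun [set: measurableTypeR R] (density g y).
  move=> y01; apply: (@measurable_fun_continuous_except _ _ u1) => u uu1.
  have c : {for u, continuous (fun x : R => g (x +i* y) : C)}.
    apply: (@continuous_comp _ _ _ (fun x : R => x +i* y : C) (g : C -> C) u).
      by apply: cvg_Complex; [exact: cvg_id | exact: cvg_cst].
    exact: boundary_continuous.
  apply: (@cvgN R R^o _ (nbhs u)); apply: (@cvgM R _ (nbhs u)); last exact: cvg_cst.
  by apply: (@cvgM R _ (nbhs u)); [exact: cvg_Im c | exact: continuous_expR].
have [K HK] := gv_bound (ltW r1) adm.
have e01 : 0 < 1 - r^-1 <= 1.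
  have r0 : 0 < r by exact: lt_trans ltr01 r1.
  by rewrite subr_gt0 invf_lt1 // r1 /= gerBl invr_ge0 ltW.
have cg (v : C) : 0 < Im v < pi -> C1at (g : C -> C) v.
  by move=> Iv; apply: (C1at_gv (ltW r1)); left; exact: tauv_interior.
apply: (@cauchy_representation _ (density g 0) (density g pi) u1).
- by apply: md; rewrite lexx ltW.
- by apply: md; rewrite lexx ltW.
- by move=> u; apply: density_ge0; rewrite eqxx.
- by move=> u; apply: density_ge0; rewrite eqxx orbT.
- move=> z z0; rewrite (Galpha_eq (ltW r1) adm z0).
  exact: (@cauchy_boundary _ g u1 (1 - r^-1) K).
- exact: Galpha_asymptotic (ltW r1) adm.
Qed.

End ExponentGreaterThanOne.

(** For [p = 1] the quotient [QQ] is identically [1], and the measure is the point mass at [0]. *)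
Lemma representation_eq1 : r = 1 -> represented.
Proof.
move=> r1; have r11 : 1 <= r by rewrite r1.
have E (z : R[i]) : upper z -> Galpha alpha s r z = z^-1.
  move=> z0; have It := tauv_interior adm (upper_Logp z0).
  rewrite (Galpha_eq r11 adm z0) /gv r1 invr1 /QQ invr1 ell_Logp // !mul1r.
  rewrite LogpK; last exact: neq0_on_nonpos_axis (cexp_off_ray It).
  rewrite subKr -cexpD subrr cexp0.
  by rewrite Logp1 mulr0 addr0 cexpN LogpK // upper_neq0.
exists (@dirac _ R (0 : R) R : probability R R) => z z0; rewrite E // !integral_dirac //.
- rewrite !diracT !mul1e /cauchy_re /cauchy_im !subr0.
  by rewrite cReV cImV.
- by apply/measurable_EFinP; apply: continuous_measurable_fun; exact: cauchy_im_continuous.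
- by apply/measurable_EFinP; apply: continuous_measurable_fun; exact: cauchy_re_continuous.
Qed.

End Existence.

Theorem theorem3p2 (R : realType) (alpha r : R) (s : R[i]) :
  1 <= r -> admissible alpha s ->
  (* the formula is well defined: every intermediate quantity avoids the branch cut *)
  (forall z : R[i], upper z ->
     ~ on_nonneg_axis (- z^-1) /\
     ~ on_nonpos_axis (Ginner alpha s z) /\
     ~ on_nonneg_axis (Gmid alpha s r z)) /\
  (* analytic (complex differentiable) at every point of C_+ *)
  (forall z : R[i], upper z ->
     derivable (Galpha alpha s r : R[i]^o -> R[i]^o) z 1) /\
  (* maps C_+ into C_- *)
  (forall z : R[i], upper z -> complex.Im (Galpha alpha s r z) < 0) /\
  (* univalent on C_+ *)
  (forall z1 z2 : R[i], upper z1 -> upper z2 ->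
     Galpha alpha s r z1 = Galpha alpha s r z2 -> z1 = z2) /\
  (* Cauchy transform of a Borel probability measure on R *)
  (exists mu : probability R R,
     forall z : R[i], upper z ->
       (complex.Re (Galpha alpha s r z))%:E =
         (\int[mu]_x ((complex.Re z - x) / ((complex.Re z - x) ^+ 2 + complex.Im z ^+ 2))%:E)%E /\
       (complex.Im (Galpha alpha s r z))%:E =
         (\int[mu]_x (- complex.Im z / ((complex.Re z - x) ^+ 2 + complex.Im z ^+ 2))%:E)%E).
Proof.
move=> r1 adm; split; [|split; [|split; [|split]]].
- by move=> z z0; exact: well_defined.
- by move=> z z0; have [d _] := C1at_is_derive1 (C1at_Galpha r1 adm z0); exact: d.
- by move=> z z0; rewrite Galpha_eq //; apply: Im_gv_lt0 => //; exact: upper_Logp.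
- by move=> z1 z2; exact: Galpha_inj.
- move: r1; rewrite le_eqVlt => /predU1P[/esym r1|r1].
    exact: representation_eq1.
  exact: representation_gt1.
Qed.
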